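(* Let $a<b$ be real numbers, $\Omega=(a,b)$, and $1\le p\le 4$. Let $a_0,b_0\in\mathbb{R}$, and for each $\epsilon>0$ let $a_\epsilon,b_\epsilon\in\mathbb{R}$ satisfy $a_\epsilon\to a_0$ and $b_\epsilon\to b_0$ as $\epsilon\to0^+$. For each $\epsilon>0$ define $G_\epsilon:L^p(\Omega)\to[-\infty,\infty]$ by $$G_\epsilon(u):=\begin{cases}\int_\Omega \epsilon^{-1}(u^2-1)^2+\epsilon^3|u''|^2\,dx, & u\in W^{2,p}(\Omega),\ u(a_+)=a_\epsilon,\ u(b_-)=b_\epsilon,\\ +\infty, & \text{otherwise.}\end{cases}$$ Let $(\epsilon_n)$ be a sequence of positive reals with $\epsilon_n\to0^+$. Then, with respect to strong convergence in $L^p(\Omega)$, the sequence $G_{\epsilon_n}$ Gamma-converges to the functional $$G(u)=\begin{cases}\alpha\,\operatorname{essVar}_\Omega u+\beta(-a_0\operatorname{sgn} u(a_+))+\beta(-b_0\operatorname{sgn}u(b_-)), & u\in BPV(\Omega;\{-1,1\}),\\ +\infty, & \text{otherwise.}\end{cases}$$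
   Context: For $u\in W^{2,p}$ of an interval, $u$ has a $C^1$ representative with absolutely continuous derivative; $u(a_+)$, $u(b_-)$, $u'(0_+)$ etc. denote the one-sided endpoint limits of this representative (resp. its derivative). For an interval $I$ and $v:I\to\mathbb{R}$, $\operatorname{Var}_I v:=\sup\{\sum_{i=1}^n|v(x_i)-v(x_{i-1})|: x_0<\dots<x_n \text{ in } I\}$. For $u\in L^1_{loc}(I)$, $\operatorname{essVar}_I u:=\inf\{\operatorname{Var}_I\tilde u:\tilde u\text{ a representative of }u\}$; this infimum is attained. $BPV(\Omega;\{-1,1\})$ denotes the set of $u\in L^p(\Omega)$ with $u\in\{-1,1\}$ a.e. and $\operatorname{essVar}_\Omega u<\infty$; for such $u$, $u(a_+)$ and $u(b_-)$ denote the one-sided endpoint limits of a representative of minimal pointwise variation (these lie in $\{-1,1\}$). Define, for $w\in W^{2,p}(0,1)$, $\Phi(w):=\left(\int_0^1(w^2-1)^2dy\right)^{3/4}\left(\int_0^1|w''|^2dy\right)^{1/4}$; $\mathscr{J}:=\{w\in W^{2,p}(0,1): w(0_+)=-1,\ w(1_-)=1,\ w'(0_+)=w'(1_-)=0\}$; for $t\in\mathbb{R}$, $\mathscr{J}'(t):=\{w\in W^{2,p}(0,1): w(0_+)=-1,\ w(1_-)=t,\ w'(0_+)=0\}$; $\alpha:=\frac{2}{3^{3/4}}\inf_{w\in\mathscr{J}}\Phi(w)$ and $\beta(t):=\frac{4}{3^{3/4}}\inf_{w\in\mathscr{J}'(t)}\Phi(w)$. Gamma convergence in a metric space $X$: $f_n$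 Gamma-converges to $f$ if for every $x\in X$, (1) $\liminf_n f_n(x_n)\ge f(x)$ for every sequence $x_n\to x$, and (2) $\limsup_n f_n(x_n)\le f(x)$ for some sequence $x_n\to x$. *)

(* Defs.v *)
From HB Require Import structures.
From mathcomp Require Import all_boot all_order all_algebra.
From mathcomp Require Import all_classical all_reals all_analysis.
Set Implicit Arguments. Unset Strict Implicit. Unset Printing Implicit Defensive.
Import Order.TTheory GRing.Theory Num.Theory.
Import numFieldNormedType.Exports.
Local Open Scope classical_set_scope.
Local Open Scope ring_scope.

Section Defs.
Variable R : realType.
Local Notation mu := (@lebesgue_measure R).

Definition Lp (a b p : R) (u : R -> R) : Prop :=
  measurable_fun `]a, b[ u /\
  (\int[mu]_(x in `]a, b[) ((`|u x| `^ p)%:E) < +oo)%E.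

Definition Lp_cvg (a b p : R) (un : nat -> R -> R) (u : R -> R) : Prop :=
  (fun n : nat => (\int[mu]_(x in `]a, b[) ((`|un n x - u x| `^ p)%:E))%E)
    @ \oo --> 0%E.

Definition ae_eq (a b : R) (u v : R -> R) : Prop :=
  mu.-negligible [set x | a < x < b /\ u x <> v x].

(* (v, v1, v2) is the C^1 representative of an element of W^{2,p}(a,b):
   v is differentiable on (a,b) with derivative v1, v1 is absolutely
   continuous, namely an indefinite integral of v2, and v2 = v'' ∈ L^p(a,b). *)
Definition W2p_rep (a b p : R) (v v1 v2 : R -> R) : Prop :=
  (forall x, a < x < b -> is_derive x 1 v (v1 x)) /\
  Lp a b p v2 /\
  mu.-integrable `]a, b[ (EFin \o v2) /\
  (forall x y, a < y -> y <= x -> x < b ->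
     (\int[mu]_(t in `[y, x]) (v2 t)%:E = (v1 x - v1 y)%:E)%E).

Definition W2p (a b p : R) (u : R -> R) : Prop :=
  Lp a b p u /\ exists v v1 v2, W2p_rep a b p v v1 v2 /\ ae_eq a b u v.

(* G_eps(u); the infimum ranges over the (a.e. unique) representatives,
   and is +oo when the constraint set is empty. *)
Definition G_eps (a b p aeps beps eps : R) (u : R -> R) : \bar R :=
  ereal_inf [set e | exists v v1 v2,
    Lp a b p u /\ W2p_rep a b p v v1 v2 /\ ae_eq a b u v /\
    (v x @[x --> a^'+] --> aeps) /\ (v x @[x --> b^'-] --> beps) /\
        e = (\int[mu]_(x in `]a, b[)
              ((eps^-1 * (u x ^+ 2 - 1) ^+ 2 + eps ^+ 3 * `|v2 x| ^+ 2)%:E))%E].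

Definition Phi_rep (w w2 : R -> R) : \bar R :=
  ((\int[mu]_(y in `]0%R, 1%R[) (((w y) ^+ 2 - 1) ^+ 2)%:E) `^ (3 / 4) *
   (\int[mu]_(y in `]0%R, 1%R[) (`|w2 y| ^+ 2)%:E) `^ (1 / 4))%E.

Definition infJ (p : R) : \bar R :=
  ereal_inf [set e | exists w w1 w2,
     W2p_rep 0 1 p w w1 w2 /\
     (w y @[y --> 0^'+] --> (-1 : R)) /\ (w y @[y --> 1^'-] --> (1 : R)) /\
     (w1 y @[y --> 0^'+] --> (0 : R)) /\ (w1 y @[y --> 1^'-] --> (0 : R)) /\
     e = Phi_rep w w2].

Definition infJ' (p t : R) : \bar R :=
  ereal_inf [set e | exists w w1 w2,
     W2p_rep 0 1 p w w1 w2 /\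
     (w y @[y --> 0^'+] --> (-1 : R)) /\ (w y @[y --> 1^'-] --> t) /\
     (w1 y @[y --> 0^'+] --> (0 : R)) /\
     e = Phi_rep w w2].

Definition alpha (p : R) : \bar R :=
  ((2 / (3 `^ (3 / 4)))%:E * infJ p)%E.

Definition beta (p t : R) : \bar R :=
  ((4 / (3 `^ (3 / 4)))%:E * infJ' p t)%E.

Definition Var (a b : R) (v : R -> R) : \bar R :=
  ereal_sup [set e | exists (n : nat) (s : nat -> R),
     (forall i, (i <= n)%N -> a < s i < b) /\
     (forall i, (i < n)%N -> s i < s i.+1) /\
     e = (\sum_(i < n) `|v (s i.+1) - v (s i)|)%:E].

Definition essVar (a b : R) (u : R -> R) : \bar R :=
  ereal_inf [set Var a b v | v in [set v | ae_eq a b u v]].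

Definition BPV (a b p : R) (u : R -> R) : Prop :=
  [/\ Lp a b p u,
      mu.-negligible [set x | a < x < b /\ u x <> 1 /\ u x <> -1] &
      (essVar a b u < +oo)%E].

(* the limit functional G; u(a+), u(b-) are the one-sided limits of a
   representative of minimal pointwise variation *)
Definition G_lim (a b p a0 b0 : R) (u : R -> R) : \bar R :=
  ereal_inf [set e | exists v (la lb : R),
    BPV a b p u /\ ae_eq a b u v /\ Var a b v = essVar a b u /\
    (v x @[x --> a^'+] --> la) /\ (v x @[x --> b^'-] --> lb) /\
        e = (alpha p * essVar a b u + beta p (- a0 * Num.sg la)
             + beta p (- b0 * Num.sg lb))%E].

Definition Gamma_cvg_Lp (a b p : R) (F : nat -> (R -> R) -> \bar R)
    (G : (R -> R) -> \bar R) : Prop :=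
  forall u, Lp a b p u ->
    (forall un : nat -> R -> R, (forall n, Lp a b p (un n)) ->
        Lp_cvg a b p un u -> (G u <= limn_einf (fun n => F n (un n)))%E) /\
    (exists un : nat -> R -> R, (forall n, Lp a b p (un n)) /\
        Lp_cvg a b p un u /\ (limn_esup (fun n => F n (un n)) <= G u)%E).

End Defs.

(* Main.v *)
(** Rescaling by [eps] turns [G_eps] into the integral of [(v^2 - 1)^2 + v''^2]
    over a long interval.  By [4 z^3 y <= 3 z^4 + y^4], optimizing over the length
    of the interval, the infimum of this energy over the transitions from -1 to [t]
    starting with slope 0 is [4 / 3^(3/4)] times the infimum of [Phi].

    Lower bound: let [u_n -> u] with bounded energies and let [u] be predominantly
    [s, -s, s, ...] near the points [x_0 < ... < x_n].  Cells of length [eps] and the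
    pigeonhole principle provide, near each [x_i], a point where [u_n] is close to
    its limit and [eps u_n'] is close to 0.  A small correction at these points makes
    the boundary values exact, so that every piece between two of them costs at
    least [2 alpha], and the two extreme ones cost at least [beta].  As [alpha > 0], the
    length of such chains is bounded, hence [u] is a step function a.e.

    Upper bound: almost optimal profiles are glued at the jumps of [u] and at the
    end points, the boundary values are corrected, and a diagonal sequence is taken. *)
Require Import Defs.
From HB Require Import structures.
From mathcomp Require Import all_boot all_order all_algebra.
From mathcomp Require Import all_classical all_reals all_analysis.
From mathcomp Require Import measurable_realfun.
From mathcomp Require Import ring lra.
Set Implicit Arguments. Unset Strict Implicit. Unset Printing Implicit Defensive.
Import Order.TTheory GRing.Theory Num.Theory.
Import numFieldNormedType.Exports.
Local Open Scope classical_set_scope.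
Local Open Scope ring_scope.

(** Three facts carry the argument; no compactness of sequences is invoked. Where a profile reaches
    1 or -1 with slope 0 it can be prolonged by a constant at no cost. Hence lengths are immaterial:
    recovery sequences concentrate all transitions in windows of length [eps * Q] with [Q]
    independent of [eps], while in the lower bound every piece, however long, is a competitor after
    rescaling. A piece of [u_n] never has exact boundary data. The correction [perturb] repairs
    value and slope within distance 1 of the ends, at a relative and an absolute cost proportional
    to the defect [k]. The same correction absorbs the passage from [a0], [b0] to the boundary
    values at scale [eps]. The structure of the limit is combinatorial: alternating chains of
    bounded length force a step function. The bound may come from the energy or from the essential
    variation, so one induction serves both inequalities. Second derivatives are only in [L^p], so
    the bending energy may be infinite; integrals stay in the extended reals until finiteness is
    known. *)

Section Affine.
Context {R : realType}.
Local Notation mu := (@lebesgue_measure R).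

(** * Affine changes of variable for Lebesgue measure and integrals *)

Definition affine (m l y : R) : R := m + l * y.

Lemma measurable_affine (m l : R) :
  measurable_fun [set: measurableTypeR R] (affine m l : measurableTypeR R -> measurableTypeR R).
Proof.
rewrite /affine.
by apply: measurable_funD => //; exact: measurable_funM.
Qed.

Lemma preimage_affine_itv_pos (m l a b : R) (b0 b1 : bool) : 0 < l ->
  affine m l @^-1` [set` Interval (BSide b0 a) (BSide b1 b)] =
  [set` Interval (BSide b0 ((a - m) / l)) (BSide b1 ((b - m) / l))].
Proof.
move=> l0; apply/seteqP; split => y /=; rewrite !in_itv/= /affine.
- case: b0; case: b1 => /=;
  rewrite ?ler_pdivrMr ?ltr_pdivrMr ?ler_pdivlMr ?ltr_pdivlMr//; lra.
- case: b0; case: b1 => /=;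
  rewrite ?ler_pdivrMr ?ltr_pdivrMr ?ler_pdivlMr ?ltr_pdivlMr//; lra.
Qed.

Lemma preimage_affine_itv_neg (m l a b : R) (b0 b1 : bool) : l < 0 ->
  affine m l @^-1` [set` Interval (BSide b0 a) (BSide b1 b)] =
  [set` Interval (BSide (~~ b1) ((b - m) / l)) (BSide (~~ b0) ((a - m) / l))].
Proof.
move=> l0; apply/seteqP; split => y /=; rewrite !in_itv/= /affine.
- case: b0; case: b1 => /=;
  rewrite ?ler_ndivrMr ?ltr_ndivrMr ?ler_ndivlMr ?ltr_ndivlMr//; lra.
- case: b0; case: b1 => /=;
  rewrite ?ler_ndivrMr ?ltr_ndivrMr ?ler_ndivlMr ?ltr_ndivlMr//; lra.
Qed.

(** By uniqueness of Lebesgue measure: [|l|] times the image measure gives every half-open interval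
    its length. For [l < 0] the preimage is closed at the other end, which does not change the
    length. *)
Lemma lebesgue_affine (m l : R) (A : set R) : l != 0 -> measurable A ->
  mu (affine m l @^-1` A) = (`|l|^-1%:E * mu A)%E.
Proof.
move=> l0 mA.
have nl0 : 0 < `|l| by rewrite normr_gt0.
pose k := NngNum (ltW nl0).
pose nu := mscale k (pushforward mu (affine m l : measurableTypeR R -> measurableTypeR R)).
have H : mu A = nu (measurable_affine m l) A.
  apply: lebesgue_measure_unique => //= _ [[a b]] _ <-.
  rewrite /nu /mscale /= /pushforward.
  have [lp|ln] := ltrP 0 l.
    rewrite preimage_affine_itv_pos// !lebesgue_measure_itv/=.
    rewrite !lte_fin gtr0_norm//.
    rewrite ltr_pM2r ?invr_gt0// ltrD2r.
    case: ifPn => _; rewrite ?mule0// -!EFinD -EFinM; congr EFin.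
    by field.
  have {}ln : l < 0 by rewrite lt_neqAle l0.
  rewrite preimage_affine_itv_neg// !lebesgue_measure_itv/=.
  rewrite !lte_fin ltr0_norm//.
  rewrite ltr_nM2r ?invr_lt0// ltrD2r.
  case: ifPn => _; rewrite ?mule0// -!EFinD -EFinM; congr EFin.
  by field.
rewrite H /nu /mscale /= /pushforward muleA -EFinM mulVf ?mul1e//.
by rewrite normr_eq0.
Qed.

Lemma ge0_integral_affine (m l : R) (D : set R) (f : R -> \bar R) : l != 0 ->
  measurable D -> measurable_fun D f -> (forall x, D x -> 0 <= f x)%E ->
  (\int[mu]_(y in affine m l @^-1` D) f (affine m l y)
   = `|l|^-1%:E * \int[mu]_(x in D) f x)%E.
Proof.
move=> l0 mD mf f0.
have nl0 : 0 <= `|l|^-1 by rewrite invr_ge0.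
pose k := NngNum nl0.
have := @ge0_integral_pushforward _ _ _ _ R _ (measurable_affine m l) mu D f mD mf.
move=> <-; last by move=> y; rewrite inE; exact: f0.
rewrite -(@ge0_integral_mscale _ (measurableTypeR R) R mu D mD k f mf f0).
apply: eq_measure_integral; first exact: measurable_affine.
move=> //= h A mA AD.
by rewrite /pushforward /mscale /= -(lebesgue_affine m).
Qed.

Lemma integrable_affine (m l : R) (D : set R) (f : R -> \bar R) : l != 0 ->
  measurable D -> mu.-integrable D f ->
  mu.-integrable (affine m l @^-1` D) (f \o affine m l).
Proof.
move=> l0 mD /integrableP[mf fi]; apply/integrableP; split.
  apply: (@measurable_comp _ _ _ _ _ _ D f _ (affine m l : measurableTypeR R -> measurableTypeR R)) => //.
    by move=> _ [y Dy <-].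
  exact: measurable_funTS (measurable_affine m l).
rewrite (ge0_integral_affine m (f := fun x => `|f x|%E)) //; last exact: measurableT_comp.
by rewrite lte_mul_pinfty// ?lee_fin ?invr_ge0.
Qed.

Lemma integral_affine (m l : R) (D : set R) (f : R -> \bar R) : l != 0 ->
  measurable D -> mu.-integrable D f ->
  (\int[mu]_(y in affine m l @^-1` D) f (affine m l y)
   = `|l|^-1%:E * \int[mu]_(x in D) f x)%E.
Proof.
move=> l0 mD fi.
have [mf _] := integrableP _ _ _ fi.
rewrite integralE [in RHS]integralE muleBr//; last by apply: integrable_add_def.
rewrite -!(ge0_integral_affine m)//; [|exact: measurable_funeneg|exact: measurable_funepos].
by rewrite (funepos_comp f (affine m l)) (funeneg_comp f (affine m l)).
Qed.

End Affine.

(** * The derivative as a primitive, limits at end points, differentiability at a junction *)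

Section Primitive.
Context {R : realType}.
Local Notation mu := (@lebesgue_measure R).
Implicit Types (f g v : R -> R) (c d x y m : R).

(** Applied to functions extended by 0 outside []c, d[], so that one integrability assumption on the
    whole line covers every subinterval and both end points. *)
Definition prim c f x : R := (\int[mu]_(t in `[c, x]) f t)%R.

Lemma integrableT_patch c d f : mu.-integrable `]c, d[ (EFin \o f) ->
  mu.-integrable setT (EFin \o (f \_ `]c, d[)).
Proof.
move=> fi; rewrite -restrict_EFin; apply/integrable_restrict => //.
by rewrite setTI.
Qed.

Lemma prim_cont c f x : mu.-integrable setT (EFin \o f) -> c < x ->
  {for x, continuous (prim c f)}.
Proof.
move=> fi cx.
have cx1 : c < x + 1 by rewrite ltr_wpDr.
have fi' : mu.-integrable `[c, x + 1] (EFin \o f) by apply: integrableS fi.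
have := parameterized_integral_continuous (ltW cx1) fi'.
move/(continuous_within_itvP _ cx1) => [+ _ _]; apply.
by rewrite in_itv/= cx/= ltrDl.
Qed.

Lemma prim_cvg0 c f : mu.-integrable setT (EFin \o f) ->
  prim c f y @[y --> c^'+] --> (0 : R).
Proof.
move=> fi; apply: cvg_at_right_filter.
apply: (@parameterized_integral_cvg_left _ c (c + 1)); first by rewrite ltrDl.
exact: integrableS fi.
Qed.

Lemma int_prim c f y x : mu.-integrable setT (EFin \o f) -> c <= y -> y <= x ->
  (\int[mu]_(t in `[y, x]) (f t)%:E = (prim c f x - prim c f y)%:E)%E.
Proof.
move=> fi cy yx.
rewrite /prim (@Rintegral_itvB _ f (BLeft c) (BRight x) y).
- rewrite Rintegral_itv_obnd_cbnd; last by apply: integrableS fi.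
  by rewrite fineK//; apply: integrable_fin_num => //; apply: integrableS fi.
- by apply: integrableS fi.
- by rewrite bnd_simp.
- by rewrite bnd_simp.
Qed.

(** The relation between [v1] and [v2] is given only on compact subintervals of []c, d[]. Anchoring
    it at the midpoint yields a primitive that starts at the end point [c] itself; continuity of
    [v1], its boundedness and the identities up to the end points follow. *)
Lemma W2p_v1E c d p v v1 v2 : c < d -> W2p_rep c d p v v1 v2 ->
  exists K, forall y, c < y < d -> v1 y = K + prim c (v2 \_ `]c, d[) y.
Proof.
move=> cd [_ [_ [v2i FTC]]].
have gi := integrableT_patch v2i.
set g := v2 \_ _ in gi *.
have E y x : c < y -> y <= x -> x < d ->
    v1 x - v1 y = prim c g x - prim c g y.
  move=> cy yx xd; apply: EFin_inj; rewrite -FTC// -int_prim ?(ltW cy)//.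
  apply: eq_integral => t; rewrite inE/= in_itv/= => /andP[yt tx].
  rewrite /g patchE mem_set//= in_itv/=.
  by rewrite (lt_le_trans cy yt) (le_lt_trans tx xd).
pose x0 := (c + d) / 2.
have [cx0 x0d] : c < x0 /\ x0 < d by rewrite /x0; split; lra.
exists (v1 x0 - prim c g x0) => y /andP[cy yd].
have [yx0|x0y] := leP y x0.
  by have := E _ _ cy yx0 x0d; lra.
by have := E _ _ cx0 (ltW x0y) yd; lra.
Qed.

Lemma is_derive_continuous f f1 : (forall x, is_derive x 1 f (f1 x)) -> continuous f.
Proof.
move=> df x; apply: differentiable_continuous; apply/derivable1_diffP.
by have [] := df x.
Qed.

Lemma near_itv_oo c d x : c < x < d -> \forall y \near x, c < y < d.
Proof.
move=> /andP[cx xd]; near=> y; apply/andP; split; near: y.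
  exact: lt_nbhsr.
exact: lt_nbhsl.
Unshelve. all: by end_near. Qed.

Lemma near_right_itv c d : c < d -> \forall y \near c^'+, c < y < d.
Proof.
move=> cd; near=> y; apply/andP; split; near: y.
  exact: nbhs_right_gt.
exact: nbhs_right_lt.
Unshelve. all: by end_near. Qed.

Lemma near_left_itv c d : c < d -> \forall y \near d^'-, c < y < d.
Proof.
move=> cd; near=> y; apply/andP; split; near: y.
  exact: nbhs_left_gt.
exact: nbhs_left_lt.
Unshelve. all: by end_near. Qed.

Lemma W2p_v1_cont c d p v v1 v2 x : W2p_rep c d p v v1 v2 -> c < x < d ->
  v1 y @[y --> x] --> v1 x.
Proof.
move=> W cxd; have cd : c < d by case/andP: cxd => /lt_trans; apply.
have [K KE] := W2p_v1E cd W.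
have gi := integrableT_patch W.2.2.1.
rewrite (KE _ cxd).
have H : K + prim c (v2 \_ `]c, d[) y @[y --> x] --> K + prim c (v2 \_ `]c, d[) x.
  by apply: cvgD; [exact: cvg_cst|apply: prim_cont => //; case/andP: cxd].
apply: cvg_trans H; apply: near_eq_cvg.
by near=> y; apply/esym/KE; near: y; exact: near_itv_oo.
Unshelve. all: by end_near. Qed.

Lemma W2p_v_cont c d p v v1 v2 x : W2p_rep c d p v v1 v2 -> c < x < d ->
  {for x, continuous v}.
Proof.
move=> [W _] cxd; apply: differentiable_continuous.
by apply/derivable1_diffP; have [] := W x cxd.
Qed.

Lemma int_oo_patch c d (f : R -> R) (D : set R) : D `<=` `]c, d[ ->
  (\int[mu]_(t in D) (f t)%:E = \int[mu]_(t in D) ((f \_ `]c, d[) t)%:E)%E.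
Proof.
move=> Dcd; apply: eq_integral => t; rewrite inE => Dt.
by rewrite patchE mem_set//; exact: Dcd.
Qed.

(** The primitive is continuous up to [d], so the integral identity passes to the limit there;
    needed where two pieces meet. *)
Lemma W2p_int_left c d p v v1 v2 l : W2p_rep c d p v v1 v2 ->
  v1 y @[y --> d^'-] --> l -> forall y, c < y < d ->
  (\int[mu]_(t in `[y, d[) (v2 t)%:E = (l - v1 y)%:E)%E.
Proof.
move=> W vl y cyd; have cd : c < d by case/andP: cyd => /lt_trans; apply.
have [K KE] := W2p_v1E cd W.
have gi := integrableT_patch W.2.2.1.
have lE : l = K + prim c (v2 \_ `]c, d[) d.
  apply: (@cvg_unique _ _ (v1 y @[y --> d^'-])) => //.
  have H : K + prim c (v2 \_ `]c, d[) y @[y --> d^'-] --> K + prim c (v2 \_ `]c, d[) d.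
    apply: cvgD; [exact: cvg_cst|].
    by apply: cvg_at_left_filter; exact: prim_cont.
  apply: cvg_trans H; apply: near_eq_cvg.
  by near=> z; apply/esym/KE; near: z; exact: near_left_itv.
case/andP: (cyd) => cy yd.
rewrite (int_oo_patch (c := c) (d := d)); last first.
  by move=> t /=; rewrite !in_itv/= => /andP[/(lt_le_trans cy) -> ->].
rewrite integral_itv_bndo_bndc; last first.
  by apply: measurable_funTS; apply: measurable_int gi.
rewrite (int_prim (c := c))// ?(ltW cy) ?(ltW yd)//.
by rewrite lE (KE y)//; congr EFin; ring.
Unshelve. all: by end_near. Qed.

Lemma W2p_int_right c d p v v1 v2 l : W2p_rep c d p v v1 v2 ->
  v1 y @[y --> c^'+] --> l -> forall y, c < y < d ->
  (\int[mu]_(t in `]c, y]) (v2 t)%:E = (v1 y - l)%:E)%E.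
Proof.
move=> W vl y cyd; have cd : c < d by case/andP: cyd => /lt_trans; apply.
have [K KE] := W2p_v1E cd W.
have gi := integrableT_patch W.2.2.1.
have lE : l = K + prim c (v2 \_ `]c, d[) c.
  apply: (@cvg_unique _ _ (v1 y @[y --> c^'+])) => //.
  have H : K + prim c (v2 \_ `]c, d[) y @[y --> c^'+] --> K + prim c (v2 \_ `]c, d[) c.
    apply: cvgD; [exact: cvg_cst|].
    rewrite [X in _ --> X](_ : _ = 0) /prim ?set_itv1 ?Rintegral_set1//.
    exact: prim_cvg0.
  apply: cvg_trans H; apply: near_eq_cvg.
  by near=> z; apply/esym/KE; near: z; exact: near_right_itv.
case/andP: (cyd) => cy yd.
rewrite (int_oo_patch (c := c) (d := d)); last first.
  by move=> t /=; rewrite !in_itv/= => /andP[-> /le_lt_trans ->].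
rewrite integral_itv_obnd_cbnd; last first.
  by apply: measurable_funTS; apply: measurable_int gi.
rewrite (int_prim (c := c))// ?(ltW cy)//.
by rewrite lE (KE y)//; congr EFin; ring.
Unshelve. all: by end_near. Qed.

(** By the mean value theorem the difference quotient at [m] is a value of [f1] at an intermediate
    point, hence tends to [l]; Caratheodory's criterion turns this into a derivative. *)
Lemma is_derive_junction f f1 m l r : 0 < r ->
  (forall x, m - r < x < m + r -> x != m -> is_derive x 1 f (f1 x)) ->
  {for m, continuous f} -> f1 x @[x --> m^'] --> l -> is_derive m 1 f l.
Proof.
move=> r0 df cf f1l.
apply/is_derive1_caratheodory.
exists (fun z => if z == m then l else (f z - f m) / (z - m)); split.
- move=> z; case: eqP => [->|/eqP zm]; first by rewrite !subrr mulr0.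
  by rewrite divfK// subr_eq0.
- rewrite /prop_for /continuous_at eqxx.
  apply/cvgrPdist_le => e e0.
  move/cvgrPdist_le : f1l => /(_ e e0) [s /= s0 Hs].
  have st0 : 0 < Num.min r s by rewrite lt_min r0.
  exists (Num.min r s) => // z; rewrite /ball_/= lt_min => /andP[zr zs].
  case: ifPn => [_|zm0]; first by rewrite subrr normr0 ltW.
  have zm : (z : R) != m := zm0.
  have HP x : `|m - x| < s -> x != m -> `|l - f1 x| <= e.
    by move=> ? ?; apply: Hs.
  have dfc x : `|m - x| < r -> {for x, continuous f}.
    move=> xr; have [->//|xm] := eqVneq x m.
    apply: differentiable_continuous; apply/derivable1_diffP.
    have [|] := df x _ xm => //.
    by move: xr; rewrite ltr_distl => /andP[? ?]; apply/andP; split; lra.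
  move: zr zs; rewrite !ltr_distl => /andP[z1 z2] /andP[z3 z4].
  have [zlt|zgt|zE] := ltgtP z m; last by rewrite zE eqxx in zm.
  + have [||x] := @MVT _ f f1 z m zlt.
    * move=> x; rewrite in_itv/= => /andP[zx xm]; apply: df; last by rewrite lt_eqF.
      by apply/andP; split; lra.
    * apply: continuous_in_subspaceT => x; rewrite inE/= in_itv/= => /andP[zx xm].
      by apply: dfc; rewrite ltr_distl; apply/andP; split; lra.
    rewrite in_itv/= => /andP[zx xm] E.
    have -> : (f z - f m) / (z - m) = f1 x.
      by rewrite -[f z - f m]opprB E; field; rewrite subr_eq0 lt_eqF.
    apply: HP; last by rewrite lt_eqF.
    by rewrite ltr_distl; apply/andP; split; lra.
  + have [||x] := @MVT _ f f1 m z zgt.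
    * move=> x; rewrite in_itv/= => /andP[zx xm]; apply: df; last by rewrite gt_eqF.
      by apply/andP; split; lra.
    * apply: continuous_in_subspaceT => x; rewrite inE/= in_itv/= => /andP[zx xm].
      by apply: dfc; rewrite ltr_distl; apply/andP; split; lra.
    rewrite in_itv/= => /andP[zx xm] E.
    have -> : (f z - f m) / (z - m) = f1 x.
      by rewrite E; field; rewrite subr_eq0 gt_eqF.
    apply: HP; last by rewrite gt_eqF.
    by rewrite ltr_distl; apply/andP; split; lra.
- by rewrite eqxx.
Qed.

End Primitive.

(** * Gluing and algebra of [W^{2,p}] representatives *)

Section Gluing.
Context {R : realType}.
Local Notation mu := (@lebesgue_measure R).
Implicit Types (f g v : R -> R) (c d x y m l p k M e : R).

Lemma ge0_integral_itv_split c m d (F : R -> \bar R) : c < m -> m < d ->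
  measurable_fun `]c, d[ F -> (forall x, c < x < d -> (0 <= F x)%E) ->
  (\int[mu]_(x in `]c, d[) F x =
   \int[mu]_(x in `]c, m[) F x + \int[mu]_(x in `]m, d[) F x)%E.
Proof.
move=> cm md mF F0.
have E : `]c, d[%classic = `]c, m] `|` `]m, d[ :> set R.
  by apply: itv_bndbnd_setU; rewrite bnd_simp// ltW.
rewrite {1}E ge0_integral_setU//.
- congr (_ + _)%E; rewrite integral_itv_bndo_bndc//.
  apply: measurable_funS mF => // x /=; rewrite !in_itv/= => /andP[-> xm].
  by rewrite (lt_trans xm md).
- by rewrite -E.
- by rewrite -E => x /=; rewrite in_itv/=; exact: F0.
- apply/disj_set2P; rewrite -subset0 => x [] /=; rewrite !in_itv/=.
  by move=> /andP[_ xm] /andP[/(le_lt_trans xm)]; rewrite ltxx.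
Qed.

Lemma measurable_fun_itv_glue c m d f : c < m -> m < d ->
  measurable_fun `]c, m[ f -> measurable_fun `]m, d[ f ->
  measurable_fun `]c, d[ f.
Proof.
move=> cm md mf1 mf2.
have -> : `]c, d[%classic = (`]c, m[ `|` [set m]) `|` `]m, d[ :> set R.
  apply/seteqP; split => x /=; rewrite !in_itv/=.
    by move=> /andP[cx xd]; have [xm|mx|->] := ltgtP x m; [left; left|right|left;right];
      rewrite ?cx ?xd.
  move=> [[/andP[-> xm]|->]|/andP[mx ->]].
  - by rewrite (lt_trans xm).
  - by rewrite cm.
  - by rewrite (lt_trans cm).
apply/measurable_funU => //; first exact: measurableU.
split => //; apply/measurable_funU => //; split => //.
exact: measurable_fun_set1.
Qed.

Lemma eq_measurable_itv c d f g : (forall x, c < x < d -> f x = g x) ->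
  measurable_fun `]c, d[ f -> measurable_fun `]c, d[ g.
Proof.
move=> fg; apply: eq_measurable_fun => x; rewrite inE/= in_itv/=.
exact: fg.
Qed.

Lemma eq_integral_itv c d (F G : R -> \bar R) :
  (forall x, c < x < d -> F x = G x) ->
  (\int[mu]_(x in `]c, d[) F x = \int[mu]_(x in `]c, d[) G x)%E.
Proof.
move=> fg; apply: eq_integral => x; rewrite inE/= in_itv/=.
exact: fg.
Qed.

Lemma normr_sign1 k : k ^+ 2 = 1 -> `|k| = 1.
Proof. by move=> k1; apply/eqP; rewrite -sqrp_eq1// real_normK ?num_real// k1. Qed.

Lemma measurable_superlevel c d k f : measurable_fun `]c, d[ f ->
  measurable ([set x | k < `|f x|] `&` `]c, d[ : set R).
Proof.
move=> mf; rewrite setIC.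
have mnf : measurable_fun `]c, d[ (fun x => `|f x|) by exact: measurableT_comp.
rewrite -[X in _ `&` X]/((fun x => `|f x|) @^-1` [set t | k < t]).
by apply: mnf => //; rewrite -set_itvoy; exact: measurable_itv.
Qed.

Lemma measurable_neq c d k f : measurable_fun `]c, d[ f ->
  measurable ([set x | f x <> k] `&` `]c, d[ : set R).
Proof.
move=> mf; rewrite setIC -[X in _ `&` X]/(f @^-1` (~` [set k])).
by apply: mf => //; exact: measurableC.
Qed.

(** The value at [m] is a separate argument because representatives on the two open intervals say
    nothing about [m]. *)
Definition glue m l f g x := if x < m then f x else if x == m then l else g x.

Lemma glueL m l f g x : x < m -> glue m l f g x = f x.
Proof. by rewrite /glue => ->. Qed.

Lemma glueR m l f g x : m < x -> glue m l f g x = g x.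
Proof. by move=> mx; rewrite /glue ltNge (ltW mx)/= gt_eqF. Qed.

Lemma glueM m l f g : glue m l f g m = l.
Proof. by rewrite /glue ltxx eqxx. Qed.

Lemma measurable_glue c m d l f g : c < m -> m < d ->
  measurable_fun `]c, m[ f -> measurable_fun `]m, d[ g ->
  measurable_fun `]c, d[ (glue m l f g).
Proof.
move=> cm md mf mg; apply: (measurable_fun_itv_glue cm md).
  by apply: eq_measurable_itv mf => x /andP[_ /glueL ->].
by apply: eq_measurable_itv mg => x /andP[/glueR ->].
Qed.

Lemma measurable_normr_powR c d p f : measurable_fun `]c, d[ f ->
  measurable_fun `]c, d[ (fun x => (`|f x| `^ p)%:E).
Proof.
move=> mf; apply/measurable_EFinP.
apply: (@measurableT_comp _ _ _ _ _ _ (fun x : R => x `^ p)) => //.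
exact: measurableT_comp.
Qed.

Lemma Lp_glue c m d p l f g : c < m -> m < d ->
  Lp c m p f -> Lp m d p g -> Lp c d p (glue m l f g).
Proof.
move=> cm md [mf fi] [mg gi].
have mh := measurable_glue l cm md mf mg.
split; first exact: mh.
rewrite (ge0_integral_itv_split cm md (measurable_normr_powR p mh)); last first.
  by move=> x _; rewrite lee_fin powR_ge0.
apply: lte_add_pinfty.
  rewrite (@eq_integral_itv _ _ _ (fun x => (`|f x| `^ p)%:E)); first exact: fi.
  by move=> x /andP[_ /glueL ->].
rewrite (@eq_integral_itv _ _ _ (fun x => (`|g x| `^ p)%:E)); first exact: gi.
by move=> x /andP[/glueR ->].
Qed.

Lemma integrable_glue c m d l f g : c < m -> m < d ->
  mu.-integrable `]c, m[ (EFin \o f) -> mu.-integrable `]m, d[ (EFin \o g) ->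
  mu.-integrable `]c, d[ (EFin \o glue m l f g).
Proof.
move=> cm md /integrableP[/measurable_EFinP mf fi] /integrableP[/measurable_EFinP mg gi].
have mh := measurable_glue l cm md mf mg.
apply/integrableP; split; first exact/measurable_EFinP.
rewrite (@ge0_integral_itv_split c m d)//.
- rewrite lte_add_pinfty//.
    by rewrite (@eq_integral_itv _ _ _ (fun x => `|(EFin \o f) x|)%E)// => x /andP[_ xm] /=; rewrite glueL.
  by rewrite (@eq_integral_itv _ _ _ (fun x => `|(EFin \o g) x|)%E)// => x /andP[xm _] /=; rewrite glueR.
- by apply: measurableT_comp => //; exact/measurable_EFinP.
Qed.

Lemma cvg_glue m l f g : f x @[x --> m^'-] --> l -> g x @[x --> m^'+] --> l ->
  glue m l f g x @[x --> m^'] --> l.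
Proof.
move=> fl gl; apply: (@cvg_at_right_left_dnbhs _ R^o).
  apply: cvg_trans gl; apply: near_eq_cvg; near=> x.
  by rewrite glueR//; near: x; exact: nbhs_right_gt.
apply: cvg_trans fl; apply: near_eq_cvg; near=> x.
by rewrite glueL//; near: x; exact: nbhs_left_lt.
Unshelve. all: by end_near. Qed.

(** Equal limits of values and slopes make the junction [C^1]; the second derivative is arbitrary at
    the single point [m] and is set to 0. *)
Lemma W2p_glue c m d p l l1 (f f1 f2 g g1 g2 : R -> R) : c < m -> m < d ->
  W2p_rep c m p f f1 f2 -> W2p_rep m d p g g1 g2 ->
  f x @[x --> m^'-] --> l -> g x @[x --> m^'+] --> l ->
  f1 x @[x --> m^'-] --> l1 -> g1 x @[x --> m^'+] --> l1 ->
  W2p_rep c d p (glue m l f g) (glue m l1 f1 g1) (glue m 0 f2 g2).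
Proof.
move=> cm md Wf Wg fl gl fl1 gl1.
have [df [Lf [fi Ff]]] := Wf; have [dg [Lg [gi Fg]]] := Wg.
have hi := integrable_glue 0 cm md fi gi.
have off x : c < x < d -> x != m -> is_derive x 1 (glue m l f g) (glue m l1 f1 g1 x).
  move=> /andP[cx xd]; rewrite neq_lt => /orP[xm|mx].
  - rewrite glueL//; have := df x; rewrite cx xm => /(_ isT).
    apply: near_eq_is_derive; near=> z; rewrite glueL//; near: z.
    exact: lt_nbhsl.
  - rewrite glueR//; have := dg x; rewrite mx xd => /(_ isT).
    apply: near_eq_is_derive; near=> z; rewrite glueR//; near: z.
    exact: lt_nbhsr.
split; last split; last split => //.
- move=> x cxd; have [->|xm] := eqVneq x m; last exact: off.
  rewrite glueM.
  apply: (@is_derive_junction _ _ (glue m l1 f1 g1) _ _ (Num.min (m - c) (d - m))).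
  + by rewrite lt_min !subr_gt0 cm.
  + move=> z /andP[z1 z2]; apply: off; apply/andP; split.
      by move: z1; rewrite ltrBlDr -ltrBlDl lt_min ltrD2l ltrN2 => /andP[].
    by move: z2; rewrite -ltrBlDl lt_min ltrD2r => /andP[].
  + rewrite /prop_for /continuous_at glueM.
    apply/cvgrPdist_lt => e e0.
    have /cvgrPdist_lt/(_ _ e0) H := cvg_glue fl gl.
    have H' : \forall z \near m, z != m -> `|l - glue m l f g z| < e.
      by move: H; rewrite near_withinE.
    near=> z; have [->|zm] := eqVneq z m; first by rewrite glueM subrr normr0.
    by move: zm; near: z; exact: H'.
  + exact: cvg_glue.
- exact: Lp_glue.
- move=> x y cy yx xd.
  have mh : measurable_fun setT (EFin \o (glue m 0 f2 g2 \_ `]c, d[)).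
    by apply: measurable_int (integrableT_patch hi).
  have [xm|mx] := ltP x m.
    rewrite !glueL// ?(le_lt_trans yx)// -Ff//.
    apply: eq_integral => t; rewrite inE/= in_itv/= => /andP[_ tx].
    by rewrite glueL// (le_lt_trans tx).
  have [my|ym] := ltP m y.
    rewrite !glueR// ?(lt_le_trans my)// -Fg//.
    apply: eq_integral => t; rewrite inE/= in_itv/= => /andP[yt _].
    by rewrite glueR// (lt_le_trans my).
  have subcd : `[y, x] `<=` `]c, d[.
    move=> t /=; rewrite !in_itv/= => /andP[yt tx].
    by rewrite (lt_le_trans cy yt) (le_lt_trans tx xd).
  rewrite (int_oo_patch _ subcd).
  (* Across the junction the integral is split at [m], and each half is the one-sided identity up to
     an end point. Either half may be degenerate, [y = m] or [x = m]. *)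
  have E : `[y, x]%classic = `[y, m[ `|` `[m, x] :> set R.
    by apply: itv_bndbnd_setU; rewrite bnd_simp.
  rewrite E integral_setU//; last 2 first.
    by apply: measurable_funTS.
    apply/disj_set2P; rewrite -subset0 => t [] /=; rewrite !in_itv/=.
    by move=> /andP[_ tm] /andP[/(lt_le_trans tm)]; rewrite ltxx.
  rewrite -!int_oo_patch; last 2 first.
    by apply: subset_trans subcd; rewrite E.
    by apply: subset_trans subcd; rewrite E.
  have -> : (\int[mu]_(t in `[y, m[) (glue m 0 f2 g2 t)%:E = (l1 - glue m l1 f1 g1 y)%:E)%E.
    have [ym'|ym'] := ltP y m.
      rewrite glueL// -(W2p_int_left Wf fl1) ?cy//.
      apply: eq_integral => t; rewrite inE/= in_itv/= => /andP[_ tm].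
      by rewrite glueL.
    rewrite (_ : y = m) ?glueM; last by apply/eqP; rewrite eq_le ym ym'.
    by rewrite set_itv_ge ?bnd_simp ?ltxx// integral_set0 subrr.
  have -> : (\int[mu]_(t in `[m, x]) (glue m 0 f2 g2 t)%:E = (glue m l1 f1 g1 x - l1)%:E)%E.
    have [mx'|mx'] := ltP m x.
      rewrite -integral_itv_obnd_cbnd; last first.
        have mxs : `]m, x] `<=` `]c, d[.
          move=> t /=; rewrite !in_itv/= => /andP[mt tx].
          by rewrite (lt_trans cm mt) (le_lt_trans tx xd).
        apply: measurable_funS mxs _ => //.
        by apply: measurable_int hi.
      rewrite glueR// -(W2p_int_right Wg gl1) ?xd ?andbT//.
      apply: eq_integral => t; rewrite inE/= in_itv/= => /andP[mt _].
      by rewrite glueR.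
    rewrite (_ : x = m) ?glueM; last by apply/eqP; rewrite eq_le mx mx'.
    by rewrite set_itv1 integral_set1 subrr.
  by rewrite -EFinD; congr EFin; ring.
Unshelve. all: by end_near. Qed.

Lemma W2p_sub c d c' d' p v v1 v2 : c <= c' -> d' <= d ->
  W2p_rep c d p v v1 v2 -> W2p_rep c' d' p v v1 v2.
Proof.
move=> cc dd [dv [[mv Lv] [vi F]]].
have sub : `]c', d'[ `<=` `]c, d[.
  move=> x /=; rewrite !in_itv/= => /andP[h1 h2].
  by rewrite (le_lt_trans cc h1) (lt_le_trans h2 dd).
have mv' : measurable_fun `]c', d'[ v2 by apply: measurable_funS mv.
split.
  by move=> x /andP[h1 h2]; apply: dv; rewrite (le_lt_trans cc h1) (lt_le_trans h2 dd).
split; [split|split] => //.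
- apply: le_lt_trans Lv; apply: ge0_subset_integral => //.
  exact: measurable_normr_powR.
- exact: integrableS vi.
- move=> x y h1 h2 h3; apply: F => //.
    exact: le_lt_trans h1.
  exact: lt_le_trans dd.
Qed.

(** The sum is at most twice the larger modulus. As only finiteness of integrals is wanted, this
    stands in for Minkowski's inequality. *)
Lemma powR_normD p (s t : R) : 0 <= p ->
  `|s + t| `^ p <= 2 `^ p * (`|s| `^ p + `|t| `^ p).
Proof.
move=> p0.
have [st|ts] := leP `|s| `|t|.
  apply: (@le_trans _ _ ((2 * `|t|) `^ p)).
    rewrite ge0_ler_powR ?nnegrE ?mulr_ge0//.
    by rewrite (le_trans (ler_normD _ _))// mulr_natl mulr2n lerD2r.
  by rewrite powRM// ler_pM2l ?powR_gt0// lerDr powR_ge0.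
apply: (@le_trans _ _ ((2 * `|s|) `^ p)).
  rewrite ge0_ler_powR ?nnegrE ?mulr_ge0//.
  by rewrite (le_trans (ler_normD _ _))// mulr_natl mulr2n lerD2l ltW.
by rewrite powRM// ler_pM2l ?powR_gt0// lerDl powR_ge0.
Qed.

Lemma Lp_add c d p f g : 0 <= p -> Lp c d p f -> Lp c d p g ->
  Lp c d p (fun x => f x + g x).
Proof.
move=> p0 [mf fi] [mg gi].
have mfg : measurable_fun `]c, d[ (fun x => f x + g x) by exact: measurable_funD.
split; first exact: mfg.
have h0 (h : R -> R) : forall x, `]c, d[%classic x -> (0 <= (`|h x| `^ p)%:E)%E.
  by move=> x _; rewrite lee_fin powR_ge0.
have mh (h : R -> R) : measurable_fun `]c, d[ h -> measurable_fun `]c, d[ (fun x => (`|h x| `^ p)%:E).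
  exact: measurable_normr_powR.
apply: (@le_lt_trans _ _ (\int[mu]_(x in `]c, d[) ((2 `^ p)%:E * ((`|f x| `^ p)%:E + (`|g x| `^ p)%:E)))%E).
  apply: ge0_le_integral.
  - exact: measurable_itv.
  - exact: (h0 (fun x => f x + g x)).
  - exact: mh mfg.
  - by apply: measurable_funeM; apply: emeasurable_funD; exact: mh.
  - by move=> x _; rewrite -EFinD -EFinM lee_fin powR_normD.
rewrite ge0_integralZl_EFin; last 4 first.
- exact: measurable_itv.
- by move=> x _; rewrite -EFinD lee_fin addr_ge0 ?powR_ge0.
- by apply: emeasurable_funD; exact: mh.
- exact: powR_ge0.
rewrite (@ge0_integralD _ _ _ mu); last 5 first.
- exact: measurable_itv.
- exact: h0.
- exact: mh.
- exact: h0.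
- exact: mh.
apply: lte_mul_pinfty; [by rewrite lee_fin powR_ge0|by []|].
by apply: lte_add_pinfty; [exact: fi|exact: gi].
Qed.

Lemma Lp_scale c d p k f : Lp c d p f -> Lp c d p (fun x => k * f x).
Proof.
move=> [mf fi].
have mfg : measurable_fun `]c, d[ (fun x => k * f x) by exact: measurable_funM.
split; first exact: mfg.
under eq_integral do rewrite normrM powRM// EFinM.
rewrite ge0_integralZl_EFin; last 4 first.
- exact: measurable_itv.
- by move=> x _; rewrite lee_fin powR_ge0.
- exact: measurable_normr_powR.
- exact: powR_ge0.
by apply: lte_mul_pinfty; [rewrite lee_fin powR_ge0|by []|].
Qed.

Lemma Lp_bounded c d p M f : 0 <= p -> measurable_fun `]c, d[ f ->
  (forall x, c < x < d -> `|f x| <= M) -> Lp c d p f.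
Proof.
move=> p0 mf fM; split => //.
apply: (@le_lt_trans _ _ (\int[mu]_(x in `]c, d[) (M `^ p)%:E)%E).
  apply: ge0_le_integral.
  - exact: measurable_itv.
  - by move=> x _; rewrite lee_fin powR_ge0.
  - exact: measurable_normr_powR.
  - exact: measurable_cst.
  - move=> x; rewrite /= in_itv/= => xcd; rewrite lee_fin ge0_ler_powR ?nnegrE//.
      exact: le_trans (fM _ xcd).
    exact: fM.
rewrite integral_cst//= lebesgue_measure_itv/= -EFinD.
by case: ifP => _; rewrite -?EFinM ?mule0 ltry.
Qed.

Lemma W2p_add c d p (f f1 f2 g g1 g2 : R -> R) : 0 <= p ->
  W2p_rep c d p f f1 f2 -> W2p_rep c d p g g1 g2 ->
  W2p_rep c d p (fun x => f x + g x) (fun x => f1 x + g1 x) (fun x => f2 x + g2 x).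
Proof.
move=> p0 [df [Lf [fi Ff]]] [dg [Lg [gi Fg]]].
split.
  by move=> x h; apply: is_deriveD; [exact: df|exact: dg].
split; first exact: Lp_add.
split; first exact: (integrableD _ fi gi).
move=> x y h1 h2 h3.
have s : `[y, x] `<=` `]c, d[.
  by move=> t /=; rewrite !in_itv/= => /andP[/(lt_le_trans h1) -> /le_lt_trans ->].
rewrite (@integralD_EFin _ _ _ mu)//; [|exact: integrableS fi|exact: integrableS gi].
by rewrite Ff// Fg// -EFinD; congr EFin; ring.
Qed.

Lemma W2p_scale c d p k (f f1 f2 : R -> R) :
  W2p_rep c d p f f1 f2 ->
  W2p_rep c d p (fun x => k * f x) (fun x => k * f1 x) (fun x => k * f2 x).
Proof.
move=> [df [Lf [fi Ff]]]; split.
  by move=> x h; apply: is_deriveZ; exact: df.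
split; first exact: Lp_scale.
split; first exact: (integrableZl _ _ fi).
move=> x y h1 h2 h3.
have s : `[y, x] `<=` `]c, d[.
  by move=> t /=; rewrite !in_itv/= => /andP[/(lt_le_trans h1) -> /le_lt_trans ->].
under eq_integral do rewrite EFinM.
rewrite integralZl//; last exact: integrableS fi.
by rewrite Ff// -EFinM; congr EFin; ring.
Qed.

Lemma W2p_smooth c d p (f f1 f2 : R -> R) : 0 <= p -> c < d ->
  (forall x, is_derive x 1 f (f1 x)) -> (forall x, is_derive x 1 f1 (f2 x)) ->
  continuous f2 -> W2p_rep c d p f f1 f2.
Proof.
move=> p0 cd df df1 cf2.
have cw a b : {within `[a, b], continuous f2} by exact: continuous_subspaceT.
have mf2 : measurable_fun setT f2 by exact: continuous_measurable_fun.
have cf1 : continuous f1 by exact: is_derive_continuous df1.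
split => //; split.
  have [M [_ HM]] : bounded_set (f2 @` `[c, d]).
    by apply: compact_bounded; apply: continuous_compact => //; exact: segment_compact.
  apply: (@Lp_bounded _ _ _ (M + 1)) => //; first exact: measurable_funTS.
  move=> x /andP[cx xd]; apply: (HM (M + 1)); first by rewrite ltrDl.
  by exists x => //=; rewrite in_itv/= !ltW.
split.
  apply: (@integrableS _ _ _ mu `[c, d]) => //.
    exact: subset_itv_oo_cc.
  by apply: continuous_compact_integrable => //; exact: segment_compact.
move=> x y _ yx _.
move: yx; rewrite le_eqVlt => /predU1P[->|yx].
  by rewrite set_itv1 integral_set1 subrr.
rewrite (@continuous_FTC2 _ f2 f1 y x)// ?EFinB//.
- split.
  + by move=> z _; have [] := df1 z.
  + by apply: cvg_at_right_filter; exact: cf1.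
  + by apply: cvg_at_left_filter; exact: cf1.
- by move=> z _; rewrite derive1E; have [_] := df1 z.
Qed.

End Gluing.

(** * Energy at unit scale, rescaling of representatives, truncated powers *)

Section Energy.
Context {R : realType}.
Local Notation mu := (@lebesgue_measure R).
Implicit Types (f g v w : R -> R) (c d x y m l p k M e r : R).

Definition dens w (w2 : R -> R) x : R := (w x ^+ 2 - 1) ^+ 2 + w2 x ^+ 2.
Definition energy c d w (w2 : R -> R) : \bar R := (\int[mu]_(x in `]c, d[) (dens w w2 x)%:E)%E.

Lemma dens_ge0 w w2 x : 0 <= dens w w2 x.
Proof. by rewrite addr_ge0 ?sqr_ge0. Qed.

Lemma W2p_measurable c d p v v1 v2 : W2p_rep c d p v v1 v2 ->
  measurable_fun `]c, d[ v.
Proof.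
move=> W; apply: open_continuous_measurable_fun => //.
by move=> x; rewrite inE/= in_itv/= => xcd; apply: (W2p_v_cont W).
Qed.

Lemma W2p_measurable2 c d p v v1 v2 : W2p_rep c d p v v1 v2 ->
  measurable_fun `]c, d[ v2.
Proof. by move=> [_ [[]]]. Qed.

Lemma measurable_well c d w : measurable_fun `]c, d[ w ->
  measurable_fun `]c, d[ (fun x => (w x ^+ 2 - 1) ^+ 2).
Proof.
move=> mw; apply: measurable_funX.
by apply: measurable_funB => //; exact: measurable_funX.
Qed.

Lemma measurable_dens c d w w2 : measurable_fun `]c, d[ w ->
  measurable_fun `]c, d[ w2 -> measurable_fun `]c, d[ (dens w w2).
Proof.
move=> mw mw2; apply: measurable_funD; first exact: measurable_well.
exact: measurable_funX.
Qed.

Lemma W2p_measurable_dens c d p w w1 w2 : W2p_rep c d p w w1 w2 ->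
  measurable_fun `]c, d[ (dens w w2).
Proof.
by move=> W; apply: measurable_dens; [exact: W2p_measurable W|exact: W2p_measurable2 W].
Qed.

Lemma energy_split c m d p w w1 w2 : c < m -> m < d -> W2p_rep c d p w w1 w2 ->
  energy c d w w2 = (energy c m w w2 + energy m d w w2)%E.
Proof.
move=> cm md W; rewrite /energy (ge0_integral_itv_split cm md)//.
- by apply/measurable_EFinP; exact: W2p_measurable_dens W.
- by move=> x _; rewrite lee_fin dens_ge0.
Qed.

Lemma energy_eq c d w w2 v v2 : (forall x, c < x < d -> w x = v x) ->
  (forall x, c < x < d -> w2 x = v2 x) -> energy c d w w2 = energy c d v v2.
Proof.
by move=> E E2; apply: eq_integral_itv => x xcd; rewrite /dens E ?E2.
Qed.

Lemma energy_glue c m d p l l1 f f1 f2 g g1 g2 : c < m -> m < d ->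
  W2p_rep c m p f f1 f2 -> W2p_rep m d p g g1 g2 ->
  f x @[x --> m^'-] --> l -> g x @[x --> m^'+] --> l ->
  f1 x @[x --> m^'-] --> l1 -> g1 x @[x --> m^'+] --> l1 ->
  energy c d (glue m l f g) (glue m 0 f2 g2) = (energy c m f f2 + energy m d g g2)%E.
Proof.
move=> cm md Wf Wg h1 h2 h3 h4.
rewrite (energy_split cm md (W2p_glue cm md Wf Wg h1 h2 h3 h4)).
by congr (_ + _)%E; apply: energy_eq => x /andP[xm xd]; rewrite ?(glueL _ _ _ xd) ?(glueR _ _ _ xm).
Qed.

Lemma exists_lt_mean c d r f : c < d -> measurable_fun `]c, d[ f ->
  (forall x, c < x < d -> 0 <= f x) ->
  (\int[mu]_(x in `]c, d[) (f x)%:E < (r * (d - c))%:E)%E ->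
  exists2 x, c < x < d & f x < r.
Proof.
move=> cd mf f0 H; apply: contrapT => nex.
have f1 x : c < x < d -> r <= f x.
  by move=> xcd; rewrite leNgt; apply/negP => xr; apply: nex; exists x.
have [r0|r0] := ltP r 0.
  move: H; apply/negP; rewrite -leNgt; apply: (@le_trans _ _ 0%E).
    by rewrite lee_fin mulr_le0_ge0 ?subr_ge0 ?ltW.
  by apply: integral_ge0 => x /=; rewrite in_itv/= lee_fin; exact: f0.
move: H; apply/negP; rewrite -leNgt.
apply: (@le_trans _ _ (\int[mu]_(x in `]c, d[) r%:E)%E).
  rewrite integral_cst//= lebesgue_measure_itv/= lte_fin cd -EFinB -EFinM.
  by rewrite lee_fin.
apply: ge0_le_integral.
- exact: measurable_itv.
- by move=> x _; rewrite lee_fin.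
- exact: measurable_cst.
- exact/measurable_EFinP.
- by move=> x; rewrite /= in_itv/= => /f1; rewrite lee_fin.
Qed.

Lemma is_derive_affine m l y : is_derive y 1 (affine m l) l.
Proof.
have := is_deriveD (is_derive_cst m y 1) (is_deriveZ l (is_derive_id y 1)).
by rewrite add0r /GRing.scale/= mulr1.
Qed.

Section affine_maps.
(** [H] describes the correspondence of intervals through membership, so that both orientations are
    handled at once; [l < 0] is what reflects the left boundary layer. *)
Context (c d c' d' m l : R) (l0 : l != 0)
  (H : forall y, (c' < y < d') = (c < affine m l y < d)).

Lemma preimage_affine_oo : affine m l @^-1` `]c, d[ = `]c', d'[%classic.
Proof. by apply/seteqP; split => y /=; rewrite !in_itv/= H. Qed.

Lemma ge0_integral_affine_oo (F : R -> \bar R) : measurable_fun `]c, d[ F ->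
  (forall x, c < x < d -> (0 <= F x)%E) ->
  (\int[mu]_(y in `]c', d'[) F (affine m l y) =
   `|l|^-1%:E * \int[mu]_(x in `]c, d[) F x)%E.
Proof.
by move=> mF F0; rewrite -preimage_affine_oo ge0_integral_affine.
Qed.

Lemma measurable_affine_oo f : measurable_fun `]c, d[ f ->
  measurable_fun `]c', d'[ (f \o affine m l).
Proof.
move=> mf; rewrite -preimage_affine_oo.
apply: (@measurable_comp _ _ _ _ _ _ `]c, d[ f _ (affine m l : measurableTypeR R -> measurableTypeR R)) => //.
  by move=> _ [y Dy <-].
exact: measurable_funTS (measurable_affine m l).
Qed.

Lemma Lp_affine p f : Lp c d p f -> Lp c' d' p (f \o affine m l).
Proof.
move=> [mf fi]; split; first exact: measurable_affine_oo.
have := @ge0_integral_affine_oo (fun x => (`|f x| `^ p)%:E) (measurable_normr_powR p mf).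
have h0 x : c < x < d -> (0 <= (`|f x| `^ p)%:E)%E by rewrite lee_fin powR_ge0.
move=> /(_ h0) /= ->.
by apply: lte_mul_pinfty; [rewrite lee_fin invr_ge0|by []|exact: fi].
Qed.

Lemma W2p_affine p v v1 v2 : W2p_rep c d p v v1 v2 ->
  W2p_rep c' d' p (v \o affine m l) (fun y => l * v1 (affine m l y))
    (fun y => l ^+ 2 * v2 (affine m l y)).
Proof.
move=> [dv [Lv [vi F]]].
split.
  move=> y; rewrite H => yc.
  have Dv := dv _ yc.
  by have := is_derive1_comp Dv (is_derive_affine m l y); rewrite mulrC.
split.
  exact: (Lp_scale (l ^+ 2) (Lp_affine Lv)).
have vi' : mu.-integrable `]c', d'[ (EFin \o (v2 \o affine m l)).
  by rewrite -preimage_affine_oo; apply: (integrable_affine m (f := EFin \o v2)).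
split.
  have := integrableZl _ (l ^+ 2) vi'; apply; exact: measurable_itv.
move=> x y cy yx xd.
have ycd : c' < y < d' by rewrite cy (le_lt_trans yx xd).
have xcd : c' < x < d' by rewrite xd (lt_le_trans cy yx).
have sub : `[y, x] `<=` `]c', d'[.
  by move=> t /=; rewrite !in_itv/= => /andP[/(lt_le_trans cy) -> /le_lt_trans ->].
under eq_integral do rewrite EFinM.
rewrite (@integralZl _ _ _ mu); [|exact: measurable_itv|by apply: integrableS vi'].
move: ycd xcd; rewrite !H => /andP[y1 y2] /andP[x1 x2].
(* For [l < 0] the substitution exchanges the end points, which [Num.sg l] records. As
   [|l|^-1 * Num.sg l = l^-1], one power of [l] is left out of [l ^+ 2]. *)
have E : (\int[mu]_(t in `[y, x]) (v2 (affine m l t))%:E =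
   (`|l|^-1)%:E * (Num.sg l * (v1 (affine m l x) - v1 (affine m l y)))%:E)%E.
  have [lp|ln] := ltP 0 l.
    have -> : `[y, x]%classic = affine m l @^-1` `[affine m l y, affine m l x].
      rewrite preimage_affine_itv_pos//.
      have e t : (affine m l t - m) / l = t by rewrite /affine; field.
      by rewrite !e.
    have yx' : affine m l y <= affine m l x by rewrite lerD2l ler_pM2l.
    rewrite (integral_affine m (f := EFin \o v2))//.
      by rewrite gtr0_sg// mul1r /= F.
    apply: integrableS vi => // t /=; rewrite !in_itv/= => /andP[t1 t2].
    by rewrite (lt_le_trans y1 t1) (le_lt_trans t2 x2).
  have {}ln : l < 0 by rewrite lt_neqAle l0.
  have -> : `[y, x]%classic = affine m l @^-1` `[affine m l x, affine m l y].
    rewrite preimage_affine_itv_neg//.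
    have e t : (affine m l t - m) / l = t by rewrite /affine; field.
    by rewrite !e.
  have yx' : affine m l x <= affine m l y by rewrite lerD2l ler_nM2l.
  rewrite (integral_affine m (f := EFin \o v2))//.
    by rewrite ltr0_sg// mulN1r /= F// opprB.
  apply: integrableS vi => // t /=; rewrite !in_itv/= => /andP[t1 t2].
  by rewrite (lt_le_trans x1 t1) (le_lt_trans t2 y2).
rewrite E -!EFinM; congr EFin.
have [ln|lp|l00] := ltgtP l 0; last by move: l0; rewrite l00 eqxx.
- by rewrite ltr0_sg// ltr0_norm//; field.
- by rewrite gtr0_sg// gtr0_norm//; field.
Qed.

End affine_maps.

Lemma affine_cvg_rr m l c : 0 < l -> affine m l y @[y --> c^'+] --> (affine m l c)^'+.
Proof.
move=> l0 P [e /= e0 He]; exists (e / l) => /=; first by rewrite divr_gt0.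
move=> y /= yc cy; apply: He; rewrite /= /affine.
  rewrite (_ : _ - _ = l * (c - y)); last by ring.
  by rewrite normrM gtr0_norm// mulrC -ltr_pdivlMr.
by rewrite ltrD2l ltr_pM2l.
Qed.

Lemma affine_cvg_ll m l c : 0 < l -> affine m l y @[y --> c^'-] --> (affine m l c)^'-.
Proof.
move=> l0 P [e /= e0 He]; exists (e / l) => /=; first by rewrite divr_gt0.
move=> y /= yc cy; apply: He; rewrite /= /affine.
  rewrite (_ : _ - _ = l * (c - y)); last by ring.
  by rewrite normrM gtr0_norm// mulrC -ltr_pdivlMr.
by rewrite ltrD2l ltr_pM2l.
Qed.

Lemma affine_cvg_rl m l c : l < 0 -> affine m l y @[y --> c^'+] --> (affine m l c)^'-.
Proof.
move=> l0 P [e /= e0 He]; exists (e / - l) => /=; first by rewrite divr_gt0// oppr_gt0.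
move=> y /= yc cy; apply: He; rewrite /= /affine.
  rewrite (_ : _ - _ = l * (c - y)); last by ring.
  by rewrite normrM ltr0_norm// mulrC -ltr_pdivlMr// oppr_gt0.
by rewrite ltrD2l ltr_nM2l.
Qed.

Lemma affine_cvg_lr m l c : l < 0 -> affine m l y @[y --> c^'-] --> (affine m l c)^'+.
Proof.
move=> l0 P [e /= e0 He]; exists (e / - l) => /=; first by rewrite divr_gt0// oppr_gt0.
move=> y /= yc cy; apply: He; rewrite /= /affine.
  rewrite (_ : _ - _ = l * (c - y)); last by ring.
  by rewrite normrM ltr0_norm// mulrC -ltr_pdivlMr// oppr_gt0.
by rewrite ltrD2l ltr_nM2l.
Qed.

(** The truncated power, of class [C^(n-1)]: the building block of corrections that vanish
    identically beyond a point. The exponents 3 and 4 used below keep second derivatives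
    continuous. *)
Definition pospow (n : nat) (z : R) : R := (Num.max 0 z) ^+ n.

Lemma continuous_pospow n : continuous (pospow n).
Proof.
move=> z; apply: (@continuous_comp R R R (fun z : R => Num.max 0 z) (fun z : R => z ^+ n)).
  by apply: (@continuous_max _ _ (cst 0) id); [exact: cst_continuous|exact: cvg_id].
exact: exprn_continuous.
Qed.

Lemma is_derive_pospow (n : nat) (z : R) : is_derive z 1 (pospow n.+2) (n.+2%:R * pospow n.+1 z).
Proof.
have off x : x != 0 -> is_derive x 1 (pospow n.+2) (n.+2%:R * pospow n.+1 x).
  rewrite neq_lt => /orP[x0|x0].
    have E : is_derive x 1 (cst 0 : R -> R) 0 by exact: is_derive_cst.
    rewrite /pospow max_l ?ltW// expr0n mulr0.
    apply: near_eq_is_derive E; near=> y; rewrite max_l ?expr0n// ltW//.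
    by near: y; exact: lt_nbhsl.
  have E : is_derive x 1 (fun x : R => x ^+ n.+2) (n.+2%:R * x ^+ n.+1).
    have := @is_deriveX R R id n.+2 x 1 1 (is_derive_id x 1).
    by rewrite exprfctE /GRing.scale/= mulr1.
  rewrite /pospow max_r ?ltW//.
  apply: near_eq_is_derive E; near=> y; rewrite max_r// ltW//.
  by near: y; exact: lt_nbhsr.
have [->|] := eqVneq z 0; last exact: off.
apply: (@is_derive_junction _ _ (fun x => n.+2%:R * pospow n.+1 x) _ _ 1) => //.
- exact: continuous_pospow.
- apply: cvg_within_filter.
  apply: cvgMr; exact: continuous_pospow.
Unshelve. all: by end_near. Qed.

End Energy.

(** * Correction of boundary values and slopes *)

Section Perturb.
Context {R : realType}.
Local Notation mu := (@lebesgue_measure R).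
Implicit Types (f g v w : R -> R) (a b c d x y m l p k M e r A B : R).

Lemma is_derive_lin2 a b f g x df dg : is_derive x 1 f df -> is_derive x 1 g dg ->
  is_derive x 1 (fun x => a * f x + b * g x) (a * df + b * dg).
Proof.
by move=> Df Dg; exact: (is_deriveD (is_deriveZ a Df) (is_deriveZ b Dg)).
Qed.

(* On [x >= c] the bump has value [A] and slope [B] at [c] and vanishes beyond [c + 1]. *)
Definition bump A B c x := (4 * A + B) * pospow 3 (affine (1 + c) (-1) x)
  + - (3 * A + B) * pospow 4 (affine (1 + c) (-1) x).
Definition bump1 A B c x := - (3 * (4 * A + B)) * pospow 2 (affine (1 + c) (-1) x)
  + (4 * (3 * A + B)) * pospow 3 (affine (1 + c) (-1) x).
Definition bump2 A B c x := 6 * (4 * A + B) * pospow 1 (affine (1 + c) (-1) x)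
  + - (12 * (3 * A + B)) * pospow 2 (affine (1 + c) (-1) x).

Lemma is_derive_pospow_affine (n : nat) (m l x : R) :
  is_derive x 1 (pospow n.+2 \o affine m l) (n.+2%:R * pospow n.+1 (affine m l x) * l).
Proof. by apply: is_derive1_comp; [exact: is_derive_pospow|exact: is_derive_affine]. Qed.

Lemma is_derive_bump A B c x : is_derive x 1 (bump A B c) (bump1 A B c x).
Proof.
have := is_derive_lin2 (4 * A + B) (- (3 * A + B))
  (is_derive_pospow_affine 1 (1 + c) (-1) x) (is_derive_pospow_affine 2 (1 + c) (-1) x).
by move=> H; apply: (is_derive_eq H); rewrite /bump1; ring.
Qed.

Lemma is_derive_bump1 A B c x : is_derive x 1 (bump1 A B c) (bump2 A B c x).
Proof.
have := is_derive_lin2 (- (3 * (4 * A + B))) (4 * (3 * A + B))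
  (is_derive_pospow_affine 0 (1 + c) (-1) x) (is_derive_pospow_affine 1 (1 + c) (-1) x).
by move=> H; apply: (is_derive_eq H); rewrite /bump2; ring.
Qed.

Lemma continuous_affine m l : continuous (affine m l).
Proof. exact: is_derive_continuous (is_derive_affine m l). Qed.

Lemma continuous_bump2 A B c : continuous (bump2 A B c).
Proof.
have H (n : nat) : continuous (pospow n \o affine (1 + c) (-1)).
  by move=> x; apply: continuous_comp; [exact: continuous_affine|exact: continuous_pospow].
by move=> x; apply: cvgD; apply: cvgMr; exact: H.
Qed.

Lemma continuous_bump A B c : continuous (bump A B c).
Proof. exact: is_derive_continuous (is_derive_bump A B c). Qed.

Lemma continuous_bump1 A B c : continuous (bump1 A B c).
Proof. exact: is_derive_continuous (is_derive_bump1 A B c). Qed.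

Lemma pospow_bound (n : nat) c x : c <= x -> 0 <= pospow n (affine (1 + c) (-1) x) <= 1.
Proof.
move=> cx; rewrite /pospow exprn_ge0 ?le_max ?lexx//=.
by rewrite exprn_ile1 ?le_max ?lexx// ge_max ler01 /affine; lra.
Qed.

Lemma pospow_far (n : nat) c x : c + 1 <= x -> pospow n.+1 (affine (1 + c) (-1) x) = 0.
Proof.
by move=> cx; rewrite /pospow max_l ?expr0n// /affine; lra.
Qed.

Lemma lin2_bound (a b s t M : R) : `|a| + `|b| <= M -> 0 <= s <= 1 -> 0 <= t <= 1 ->
  `|a * s + b * t| <= M.
Proof.
move=> ab /andP[s0 s1] /andP[t0 t1].
apply: le_trans ab; apply: (le_trans (ler_normD _ _)).
by rewrite !normrM (ger0_norm s0) (ger0_norm t0) lerD// ler_piMr.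
Qed.

(** [|4 A + B| <= 5 k] and [|3 A + B| <= 4 k] add up to [9 k]. *)
Lemma bump_bound A B c k x : `|A| <= k -> `|B| <= k -> c <= x -> `|bump A B c x| <= 9 * k.
Proof.
move=> Ak Bk cx.
have /andP[? ?] : - k <= A <= k by rewrite -ler_norml.
have /andP[? ?] : - k <= B <= k by rewrite -ler_norml.
apply: lin2_bound; [|exact: pospow_bound|exact: pospow_bound].
rewrite normrN.
by have [?|?] := ger0P (4 * A + B); have [?|?] := ger0P (3 * A + B); lra.
Qed.

(** The same two bounds with the weights 6 and 12: [6 * 5 + 12 * 4 = 78]. *)
Lemma bump2_bound A B c k x : `|A| <= k -> `|B| <= k -> c <= x -> `|bump2 A B c x| <= 78 * k.
Proof.
move=> Ak Bk cx.
have /andP[? ?] : - k <= A <= k by rewrite -ler_norml.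
have /andP[? ?] : - k <= B <= k by rewrite -ler_norml.
apply: lin2_bound; [|exact: pospow_bound|exact: pospow_bound].
rewrite normrN.
by have [?|?] := ger0P (6 * (4 * A + B)); have [?|?] := ger0P (12 * (3 * A + B)); lra.
Qed.

Lemma bump_far A B c x : c + 1 <= x ->
  [/\ bump A B c x = 0, bump1 A B c x = 0 & bump2 A B c x = 0].
Proof.
by move=> cx; rewrite /bump /bump1 /bump2 !pospow_far// !mulr0 addr0.
Qed.

Lemma bump_at A B c : bump A B c c = A /\ bump1 A B c c = B.
Proof.
rewrite /bump /bump1 /affine.
have -> : 1 + c + -1 * c = 1 by ring.
rewrite /pospow max_r ?ler01// !expr1n; split; ring.
Qed.

(** With [X = s^2 - 1] the increment [Y] of [X] satisfies [|Y| <= k (2 |s| + 1)], and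
    [(2 |s| + 1)^2 <= 4 X^2 + 14]. Young's inequality for [2 X Y] then gives the factor
    [1 + k + 8 k] and the remainder [2 * 14 k]. *)
Lemma well_perturb (s t k : R) : 0 <= k <= 1 -> `|t| <= k ->
  ((s + t) ^+ 2 - 1) ^+ 2 <= (1 + 9 * k) * (s ^+ 2 - 1) ^+ 2 + 28 * k.
Proof.
move=> /andP[k0 k1] tk.
set X := s ^+ 2 - 1.
pose z := `|s|.
have z0 : 0 <= z by rewrite normr_ge0.
have zs : z ^+ 2 = s ^+ 2 by rewrite real_normK ?num_real.
pose Y := 2 * s * t + t ^+ 2.
have -> : (s + t) ^+ 2 - 1 = X + Y by rewrite /X /Y; ring.
have YB : `|Y| <= k * (2 * z + 1).
  rewrite /Y (le_trans (ler_normD _ _))// normrX !normrM normr_nat -/z.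
  have t0 : 0 <= `|t| by rewrite normr_ge0.
  nra.
have ZB : (2 * z + 1) ^+ 2 <= 4 * X ^+ 2 + 14.
  have : 0 <= (X - 1) ^+ 2 by rewrite sqr_ge0.
  have : 0 <= (z - 1) ^+ 2 by rewrite sqr_ge0.
  rewrite /X -zs; nra.
have Y2 : Y ^+ 2 <= k * (2 * z + 1) ^+ 2.
  rewrite -real_normK ?num_real//.
  apply: (@le_trans _ _ ((k * (2 * z + 1)) ^+ 2)).
    by rewrite lerXn2r ?nnegrE ?normr_ge0// mulr_ge0// addr_ge0// mulr_ge0.
  rewrite exprMn ler_wpM2r ?sqr_ge0// expr2; nra.
have XY : X * Y * 2 <= k * (X ^+ 2 + (2 * z + 1) ^+ 2).
  apply: (@le_trans _ _ (`|X| * `|Y| * 2)).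
    by rewrite -normrM ler_wpM2r// ler_norm.
  have x0 : 0 <= `|X| by rewrite normr_ge0.
  rewrite -(@real_normK _ X) ?num_real//.
  apply: (@le_trans _ _ (`|X| * (k * (2 * z + 1)) * 2)).
    by rewrite ler_wpM2r// ler_wpM2l.
  have : 0 <= (`|X| - (2 * z + 1)) ^+ 2 by rewrite sqr_ge0.
  nra.
nra.
Qed.

(** From [2 |s| k <= k (s^2 + 1)] and [k^2 <= k]. *)
Lemma sq_perturb (s t k : R) : 0 <= k <= 1 -> `|t| <= k ->
  (s + t) ^+ 2 <= (1 + k) * s ^+ 2 + 2 * k.
Proof.
move=> /andP[k0 k1] tk.
have t2 : t ^+ 2 <= k ^+ 2 by rewrite -real_normK ?num_real// lerXn2r ?nnegrE.
have : s * t <= `|s| * k.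
  by apply: le_trans (ler_norm _) _; rewrite normrM ler_wpM2l.
have : `|s| ^+ 2 = s ^+ 2 by rewrite real_normK ?num_real.
have : 0 <= (`|s| - 1) ^+ 2 by rewrite sqr_ge0.
have : 0 <= `|s| by rewrite normr_ge0.
move=> *; nra.
Qed.

(* The bumps at both ends satisfy [|h''| <= 156 k], where [156 = 2 * 78]
   (lemma [bump2_bound]), and live on a set of measure 2, where the pointwise
   error [30 * 156 k] of [well_perturb] and [sq_perturb] is integrated. *)
Lemma perturb c d p k A0 B0 A1 B1 w w1 w2 : 0 <= p -> c + 2 < d ->
  0 <= k -> 156 * k <= 1 ->
  `|A0| <= k -> `|B0| <= k -> `|A1| <= k -> `|B1| <= k ->
  W2p_rep c d p w w1 w2 ->
  exists h h1 h2 : R -> R, [/\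
    W2p_rep c d p (fun x => w x + h x) (fun x => w1 x + h1 x) (fun x => w2 x + h2 x),
    continuous h /\ continuous h1,
    [/\ h c = A0, h1 c = B0, h d = A1 & h1 d = B1],
    (forall x, c < x < d -> `|h x| <= 18 * k) /\
    (forall x, c + 1 <= x <= d - 1 -> h x = 0) &
    (energy c d (fun x => w x + h x)%R (fun x => w2 x + h2 x)%R <=
      (1 + 9360 * k)%:E * energy c d w w2 + (9360 * k)%:E)%E].
Proof.
move=> p0 cd k0 k1 A0k B0k A1k B1k W.
have cd' : c < d by lra.
pose rf := affine (c + d) (-1).
(* The correction at [d] is a bump at [c] reflected by [x |-> c + d - x]; reflection reverses
   slopes, hence [- B1]. *)
pose h x := bump A0 B0 c x + bump A1 (- B1) c (rf x).
pose h1 x := bump1 A0 B0 c x + -1 * bump1 A1 (- B1) c (rf x).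
pose h2 x := bump2 A0 B0 c x + (-1) ^+ 2 * bump2 A1 (- B1) c (rf x).
have B1k' : `|- B1| <= k by rewrite normrN.
have Wl : W2p_rep c d p (bump A0 B0 c) (bump1 A0 B0 c) (bump2 A0 B0 c).
  exact: (W2p_smooth p0 cd' (is_derive_bump _ _ _) (is_derive_bump1 _ _ _) (@continuous_bump2 _ _ _)).
have Wr : W2p_rep c d p (bump A1 (- B1) c \o rf) (fun x => -1 * bump1 A1 (- B1) c (rf x))
    (fun x => (-1) ^+ 2 * bump2 A1 (- B1) c (rf x)).
  apply: (@W2p_affine _ c d c d); first by rewrite oppr_eq0 oner_eq0.
    by move=> y; rewrite /affine; apply/andP/andP => -[? ?]; split; lra.
  exact: (W2p_smooth p0 cd' (is_derive_bump _ _ _) (is_derive_bump1 _ _ _) (@continuous_bump2 _ _ _)).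
have Wh := W2p_add p0 Wl Wr.
have rfc : continuous rf by exact: continuous_affine.
have hb x : c < x < d -> `|h x| <= 18 * k /\ `|h2 x| <= 156 * k.
  move=> /andP[cx xd].
  have cr : c <= rf x by rewrite /rf /affine; lra.
  split.
    apply: (le_trans (ler_normD _ _)).
    have := bump_bound A0k B0k (ltW cx); have := bump_bound A1k B1k' cr; lra.
  apply: (le_trans (ler_normD _ _)); rewrite sqrrN expr1n mul1r.
  have := bump2_bound A0k B0k (ltW cx); have := bump2_bound A1k B1k' cr; lra.
have h0 x : c + 1 <= x <= d - 1 -> h x = 0 /\ h2 x = 0.
  move=> /andP[cx xd].
  have [E1 _ E2] := bump_far A0 B0 cx.
  have cr : c + 1 <= rf x by rewrite /rf /affine; lra.
  have [F1 _ F2] := bump_far A1 (- B1) cr.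
  by rewrite /h /h2 E1 E2 F1 F2 mulr0 addr0.
exists h, h1, h2; split.
- exact: (W2p_add p0 W Wh).
- split=> x.
    by apply: cvgD; [exact: continuous_bump|apply: continuous_comp; [exact: rfc|exact: continuous_bump]].
  apply: cvgD; first exact: continuous_bump1.
  by apply: cvgMr; apply: (@continuous_comp _ _ _ rf); [exact: rfc|exact: continuous_bump1].
- have [E1 E2] := bump_at A0 B0 c; have [F1 F2] := bump_at A1 (- B1) c.
  have d1 : c + 1 <= d by lra.
  have [G1 G2 _] := bump_far A0 B0 d1; have [H1 H2 _] := bump_far A1 (- B1) d1.
  have rc : rf c = d by rewrite /rf /affine; ring.
  have rd : rf d = c by rewrite /rf /affine; ring.
  rewrite /h /h1 rc rd E1 E2 F1 F2 G1 G2 H1 H2.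
  by split; ring.
- by split => x xcd; [have [] := hb x xcd|have [] := h0 x xcd].
pose q := 156 * k.
have q01 : 0 <= q <= 1 by rewrite /q k1 mulr_ge0.
pose S : set R := `]c, c + 1[ `|` `]d - 1, d[.
have mS : measurable S by exact: measurableU.
(* On [S] the additive errors of the two terms are [28 q] and [2 q]; off [S] the function is
   unchanged. *)
pose F x := (1 + 9 * q) * dens w w2 x + 30 * q * \1_S x.
have mD := W2p_measurable_dens W.
have mF1 : measurable_fun `]c, d[ (fun x => (1 + 9 * q) * dens w w2 x).
  by apply: measurable_funM.
have mF2 : measurable_fun `]c, d[ (fun x => 30 * q * \1_S x).
  apply: measurable_funM => //; exact: measurable_indic.
have q0 : 0 <= q by case/andP: q01.
apply: (@le_trans _ _ (\int[mu]_(x in `]c, d[) (F x)%:E)%E).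
  apply: ge0_le_integral.
  - exact: measurable_itv.
  - by move=> x _; rewrite lee_fin dens_ge0.
  - by apply/measurable_EFinP; apply: W2p_measurable_dens (W2p_add p0 W Wh).
  - by apply/measurable_EFinP; exact: measurable_funD.
  move=> x; rewrite /= in_itv/= => xcd; rewrite lee_fin.
  have dp : 0 <= dens w w2 x := dens_ge0 _ _ _.
  have [xS|xS] := pselect (S x).
    rewrite /F indicE mem_set// mulr1.
    have [hx1 hx2] := hb x xcd.
    have hx1' : `|h x| <= q by apply: le_trans hx1 _; rewrite /q; lra.
    have := well_perturb (w x) q01 hx1'; have := sq_perturb (w2 x) q01 hx2.
    rewrite /dens; have : 0 <= w2 x ^+ 2 by rewrite sqr_ge0.
    nra.
  rewrite /F indicE memNset// mulr0 addr0.
  have xm : c + 1 <= x <= d - 1.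
    case/andP: xcd => cx xd.
    rewrite !leNgt; apply/andP; split; apply/negP => xx; apply: xS.
      by left; rewrite /= in_itv/= cx xx.
    by right; rewrite /= in_itv/= xd xx.
  have [hx1 hx2] := h0 x xm.
  rewrite /dens hx1 hx2 !addr0 -/(dens w w2 x); nra.
under eq_integral do rewrite EFinD.
rewrite (@ge0_integralD _ _ _ mu); last 5 first.
- exact: measurable_itv.
- by move=> x _; rewrite lee_fin mulr_ge0 ?dens_ge0//; lra.
- exact/measurable_EFinP.
- by move=> x _; rewrite lee_fin mulr_ge0// mulr_ge0.
- exact/measurable_EFinP.
under eq_integral do rewrite EFinM.
rewrite (@ge0_integralZl_EFin _ _ _ mu); last 4 first.
- exact: measurable_itv.
- by move=> x _; rewrite lee_fin dens_ge0.
- exact/measurable_EFinP.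
- by lra.
under [X in (_ + X <= _)%E]eq_integral do rewrite EFinM.
rewrite (@ge0_integralZl_EFin _ _ _ mu); last 4 first.
- exact: measurable_itv.
- by move=> x _; rewrite lee_fin.
- apply/measurable_EFinP; exact: measurable_indic.
- by lra.
rewrite integral_indic//=.
(* The relative error [9 q = 1404 k] is below the absolute one, [30 q * 2 = 9360 k]; a single
   constant is kept for both. *)
apply: leeD.
  apply: lee_wpmul2r; last by rewrite lee_fin /q; lra.
  by apply: integral_ge0 => x _; rewrite lee_fin dens_ge0.
have mS2 : (mu (S `&` `]c, d[) <= 2%:E)%E.
  apply: (@le_trans _ _ (mu S)).
    apply: le_measure; [rewrite inE; exact: measurableI|rewrite inE; exact: mS|exact: subIsetl].
  apply: (le_trans (measureU2 _ _ _)) => //=.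
  rewrite !lebesgue_measure_itv/= !lte_fin ltrDl ltr01 ltrBlDr ltrDl ltr01.
  by rewrite -!EFinD lee_fin; lra.
apply: (@le_trans _ _ ((30 * q)%:E * 2%:E)%E).
  by apply: lee_wpmul2l => //; rewrite lee_fin; lra.
by rewrite -EFinM lee_fin /q; lra.
Qed.

End Perturb.

(** * Optimal profiles, positivity of the jump cost, good cells *)

Section Profiles.
Context {R : realType}.
Local Notation mu := (@lebesgue_measure R).
Implicit Types (f g v w : R -> R) (a b c d x y z m l p k M e r s t L E : R).

Lemma negligible_itv (N : set R) c d : mu.-negligible N -> c < d ->
  exists2 x, c < x < d & ~ N x.
Proof.
move=> [A [mA A0 NA]] cd; apply: contrapT => H.
have sub : `]c, d[ `<=` A.
  move=> x /=; rewrite in_itv/= => xcd; apply: NA; apply: contrapT => nN.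
  by apply: H; exists x.
have : (mu `]c, d[ <= mu A)%E.
  by apply: le_measure => //; rewrite inE//.
by rewrite A0 /= lebesgue_measure_itv/= lte_fin cd -EFinB lee_fin leNgt subr_gt0 cd.
Qed.

Lemma W2p_MVT c d p v v1 v2 x y : W2p_rep c d p v v1 v2 -> c < x -> x < y -> y < d ->
  exists2 z, x < z < y & v y - v x = v1 z * (y - x).
Proof.
move=> W cx xy yd.
have in_cd z : x <= z <= y -> c < z < d.
  by move=> /andP[xz zy]; rewrite (lt_le_trans cx xz) (le_lt_trans zy yd).
have [||z] := @MVT _ v v1 x y xy.
- move=> z; rewrite in_itv/= => /andP[xz zy]; apply: W.1.
  by apply: in_cd; rewrite !ltW.
- apply: continuous_in_subspaceT => z; rewrite inE/= in_itv/= => xzy.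
  by apply: (W2p_v_cont W); exact: in_cd.
- by rewrite in_itv/= => zxy H; exists z.
Qed.

(** [v1] is a constant plus a primitive of an integrable function, hence bounded; the mean value
    theorem from the midpoint then bounds [v]. *)
Lemma W2p_bounded c d p v v1 v2 : c < d -> W2p_rep c d p v v1 v2 ->
  exists M, forall x, c < x < d -> `|v x| <= M.
Proof.
move=> cd W.
have [K KE] := W2p_v1E cd W.
have gi := integrableT_patch W.2.2.1.
set g := v2 \_ _ in KE gi.
pose I := (\int[mu]_x `|g x|)%R.
have prim_bound y : `|prim c g y| <= I.
  apply: (@le_trans _ _ (\int[mu]_(t in `[c, y]) `|g t|)%R).
    by apply: le_normr_Rintegral => //; exact: integrableS gi.
  have /integrableP[mg /= gfin] := gi.
  have mng : measurable_fun setT (fun x => `|g x|%:E).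
    apply/measurable_EFinP; apply: measurableT_comp => //.
    exact/measurable_EFinP.
  rewrite /I /Rintegral fine_le//.
  - rewrite ge0_fin_numE; last by apply: integral_ge0 => t _; rewrite lee_fin.
    apply: le_lt_trans gfin; apply: ge0_subset_integral => //; exact: mng.
  - by rewrite ge0_fin_numE//; apply: integral_ge0 => t _; rewrite lee_fin.
  - apply: ge0_subset_integral => //; exact: mng.
pose M1 := `|K| + I.
have v1b y : c < y < d -> `|v1 y| <= M1.
  by move=> /KE ->; rewrite (le_trans (ler_normD _ _))// lerD2l.
have M10 : 0 <= M1.
  have := v1b ((c + d) / 2); rewrite !midf_lt// => /(_ isT).
  exact: le_trans.
pose x0 := (c + d) / 2.
have [cx0 x0d] : c < x0 /\ x0 < d by rewrite /x0; split; lra.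
exists (`|v x0| + M1 * (d - c)) => x /andP[cx xd].
have [xx0|x0x|->] := ltgtP x x0; last first.
- by rewrite lerDl mulr_ge0// subr_ge0 ltW.
- have [z /andP[z1 z2] E] := W2p_MVT W cx0 x0x xd.
  have -> : v x = v x0 + v1 z * (x - x0) by rewrite -E; ring.
  rewrite (le_trans (ler_normD _ _))// lerD2l normrM ler_pM//.
    by apply: v1b; rewrite (lt_trans cx0 z1) (lt_trans z2 xd).
  by rewrite gtr0_norm ?subr_gt0//; lra.
- have [z /andP[z1 z2] E] := W2p_MVT W cx xx0 x0d.
  have -> : v x = v x0 - v1 z * (x0 - x) by rewrite -E; ring.
  rewrite (le_trans (ler_normB _ _))// lerD2l normrM ler_pM//.
    by apply: v1b; rewrite (lt_trans cx z1) (lt_trans z2 x0d).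
  by rewrite gtr0_norm ?subr_gt0//; lra.
Qed.

(** By continuity a positive value of the potential at [x] would persist on a short interval to the
    right of [x], where its mean is 0. *)
Lemma W2p_well0 c d p w w1 w2 : W2p_rep c d p w w1 w2 ->
  (\int[mu]_(x in `]c, d[) ((w x ^+ 2 - 1) ^+ 2)%:E = 0)%E ->
  forall x, c < x < d -> w x ^+ 2 = 1.
Proof.
move=> W W0 x xcd.
have mf := measurable_well (W2p_measurable W).
set f := (fun x => _) in mf.
apply/eqP; rewrite -subr_eq0 -sqrf_eq0; apply/negPn/negP => fx0.
have {}fx0 : 0 < f x by rewrite lt_neqAle eq_sym fx0 sqr_ge0.
have cf : {for x, continuous f}.
  have cw := W2p_v_cont W xcd.
  have c2 : {for x, continuous (fun x => w x ^+ 2)}.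
    by apply: (@continuous_comp _ _ _ w (fun z : R => z ^+ 2)) => //; exact: exprn_continuous.
  apply: (@continuous_comp _ _ _ (fun x => w x ^+ 2 - 1) (fun z : R => z ^+ 2)).
    by apply: cvgB => //; exact: cvg_cst.
  exact: exprn_continuous.
have fx2 : 0 < f x / 2 by lra.
have [e /= e0 He] : \forall y \near x, `|f x - f y| < f x / 2.
  by move/cvgrPdist_lt : cf; exact.
have [cx xd] := andP xcd.
pose y := Num.min (x + e) d.
have xy : x < y by rewrite /y lt_min xd ltrDl e0.
have [yxe yd] : y <= x + e /\ y <= d by rewrite /y !ge_min !lexx orbT.
have [|||z /andP[xz zy]] := @exists_lt_mean _ x y (f x / 2) f xy.
- apply: measurable_funS mf => // z /=; rewrite !in_itv/= => /andP[xz zy].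
  by rewrite (lt_trans cx xz) (lt_le_trans zy yd).
- by move=> z _; rewrite /f sqr_ge0.
- apply: (@le_lt_trans _ _ 0%E); last by rewrite lte_fin mulr_gt0 ?subr_gt0//; lra.
  rewrite -W0; apply: ge0_subset_integral => //.
  + exact/measurable_EFinP.
  + by move=> z _; rewrite lee_fin sqr_ge0.
  + move=> z /=; rewrite !in_itv/= => /andP[xz zy].
    by rewrite (lt_trans cx xz) (lt_le_trans zy yd).
have : `|f x - f z| < f x / 2.
  by apply: He; rewrite /= ltr0_norm ?subr_lt0// opprB; lra.
by rewrite ltr_distl => /andP[h1 h2] h3; clear W0; lra.
Qed.

(** [full] switches the slope condition at 1 on and off, so that the infima behind [alpha] and
    [beta] share one set of lemmas. *)
Definition inf_Phi (full : Prop) p t : \bar R :=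
  ereal_inf [set e | exists w w1 w2 : R -> R,
     W2p_rep 0 1 p w w1 w2 /\
     (w y @[y --> 0^'+] --> (-1 : R)) /\ (w y @[y --> 1^'-] --> t) /\
     (w1 y @[y --> 0^'+] --> (0 : R)) /\ (full -> w1 y @[y --> 1^'-] --> (0 : R)) /\
     e = Phi_rep w w2].

Lemma infJE p : infJ p = inf_Phi True p 1.
Proof.
rewrite /infJ /inf_Phi; congr ereal_inf; apply/seteqP; split => e [w [w1 [w2 H]]];
exists w, w1, w2; tauto.
Qed.

Lemma infJ'E p t : infJ' p t = inf_Phi False p t.
Proof.
rewrite /infJ' /inf_Phi; congr ereal_inf; apply/seteqP; split => e [w [w1 [w2 H]]];
exists w, w1, w2; tauto.
Qed.

(** For positive [a] and [b] the minimum over [s > 0] of [a * s + b / s ^+ 3], the energy of a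
    profile spread over the length [s], is [kappa] times a^(3/4) b^(1/4). *)
Definition kappa : R := 4 / (3 `^ (3 / 4)).
(* [beta p t = cost False p t], whereas [cost True p 1] is [2 * alpha p]: a jump
   between -1 and 1 contributes 2 to the variation. *)
Definition cost (full : Prop) p t : \bar R := (kappa%:E * inf_Phi full p t)%E.

Lemma kappa_gt0 : 0 < kappa.
Proof. by rewrite divr_gt0// powR_gt0. Qed.

Lemma Phi_rep_ge0 w (w2 : R -> R) : (0 <= Phi_rep w w2)%E.
Proof. by rewrite mule_ge0// poweR_ge0. Qed.

Lemma inf_Phi_ge0 full p t : (0 <= inf_Phi full p t)%E.
Proof.
by apply: le_ereal_inf_tmp => _ [w [w1 [w2 [_ [_ [_ [_ [_ ->]]]]]]]]; exact: Phi_rep_ge0.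
Qed.

(** Fourth roots turn the exponents 3/4 and 1/4 into integers, and the inequalities below into
    polynomial ones. *)
Lemma root4 a : 0 <= a -> exists2 s : R, 0 <= s & a = s ^+ 4.
Proof.
move=> a0; exists (a `^ (1 / 4)); first exact: powR_ge0.
by rewrite -powR_mulrn ?powR_ge0// -powRrM divfK// powRr1.
Qed.

Lemma powR_34 s : 0 <= s -> (s ^+ 4) `^ (3 / 4) = s ^+ 3.
Proof.
move=> s0; rewrite -powR_mulrn// -powRrM (_ : 4%:R * (3 / 4) = 3%:R); last by field.
by rewrite powR_mulrn.
Qed.

Lemma powR_14 s : 0 <= s -> (s ^+ 4) `^ (1 / 4) = s.
Proof.
move=> s0; rewrite -powR_mulrn// -powRrM (_ : 4%:R * (1 / 4) = 1); last by field.
by rewrite powRr1.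
Qed.

Lemma kappaE : exists2 r : R, 0 < r & r ^+ 4 = 3 /\ kappa = 4 / r ^+ 3.
Proof.
have [r r0 E] := @root4 3 (ler0n _ 3).
exists r; last by split; [rewrite E|rewrite /kappa -(powR_34 r0) -E].
by rewrite lt_neqAle r0 andbT; apply/eqP => r0'; move: E; rewrite -r0' expr0n/=; lra.
Qed.

Lemma amgm4 y z : 0 <= y -> 0 <= z -> 4 * (z ^+ 3 * y) <= 3 * z ^+ 4 + y ^+ 4.
Proof.
move=> y0 z0; rewrite -subr_ge0.
rewrite (_ : _ - _ = (z - y) ^+ 2 * (3 * z ^+ 2 + 2 * z * y + y ^+ 2)); last by ring.
by rewrite mulr_ge0 ?sqr_ge0// !addr_ge0 ?sqr_ge0// !mulr_ge0// sqr_ge0.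
Qed.

(* [L] is the length of the interval on which a profile of [0, 1] is spread:
   the potential energy scales like [L] and the bending energy like [L^-3]. *)
Lemma kappa_amgm a b L : 0 <= a -> 0 <= b -> 0 < L ->
  kappa * ((L^-1 * a) `^ (3 / 4) * (L ^+ 4 * (L^-1 * b)) `^ (1 / 4)) <= a + b.
Proof.
move=> a0 b0 L0.
have [s s0 ->] := root4 a0; have [y y0 ->] := root4 b0.
have [q q0 E] := root4 (ltW L0).
have {}q0 : 0 < q.
  by rewrite lt_neqAle q0 andbT; apply/eqP => q0'; move: L0; rewrite E -q0' expr0n/= ltxx.
have [r r0 [r4 ->]] := kappaE.
rewrite E.
have qn : q != 0 by rewrite gt_eqF.
have rn : r != 0 by rewrite gt_eqF.
rewrite (_ : (q ^+ 4)^-1 * s ^+ 4 = (s / q) ^+ 4); last by field.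
rewrite (_ : (q ^+ 4) ^+ 4 * ((q ^+ 4)^-1 * y ^+ 4) = (q ^+ 3 * y) ^+ 4); last by field.
rewrite powR_34 ?divr_ge0 ?(ltW q0)// powR_14 ?mulr_ge0 ?exprn_ge0 ?(ltW q0)//.
have -> : 4 / r ^+ 3 * ((s / q) ^+ 3 * (q ^+ 3 * y)) = 4 * ((s / r) ^+ 3 * y).
  by field; rewrite qn rn.
have -> : s ^+ 4 = 3 * (s / r) ^+ 4.
  by rewrite -r4; field.
by apply: amgm4 => //; rewrite divr_ge0// ltW.
Qed.

(** For positive [a] and [b] the minimum over [s] is attained. The margin [e] is there for the
    degenerate cases, where the infimum 0 is in general only approached, by long or by short
    intervals. *)
Lemma kappa_amgm_eq a b e : 0 <= a -> 0 <= b -> 0 < e ->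
  exists2 s : R, 0 < s & a * s + b / s ^+ 3 <= kappa * (a `^ (3 / 4) * b `^ (1 / 4)) + e.
Proof.
move=> a0 b0 e0.
have RHS0 : 0 <= kappa * (a `^ (3 / 4) * b `^ (1 / 4)).
  by rewrite mulr_ge0 ?(ltW kappa_gt0)// mulr_ge0// powR_ge0.
have [a00|an] := eqVneq a 0.
  have be : 0 <= b / e by rewrite divr_ge0// ltW.
  (* This [s] is at least 1, so [b <= e * s <= e * s ^+ 3]. *)
  exists (1 + b / e); first lra.
  rewrite {1}a00 mul0r add0r; apply: ler_wpDl => //.
  rewrite ler_pdivrMr ?exprn_gt0//; last by lra.
  apply: (@le_trans _ _ (e * (1 + b / e))).
    by rewrite mulrDr mulrCA divff ?gt_eqF// mulr1 mulr1; lra.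
  rewrite ler_pM2l// -[leLHS]expr1 ler_weXn2l//; lra.
have {}a0 : 0 < a by rewrite lt_neqAle eq_sym an.
have [b00|bn] := eqVneq b 0.
  exists (e / a); first by rewrite divr_gt0.
  by rewrite {1}b00 mul0r addr0 mulrCA divff// mulr1 lerDr.
have {}b0 : 0 < b by rewrite lt_neqAle eq_sym bn.
have [x x0 E] := root4 (ltW a0); have [y y0 F] := root4 (ltW b0).
have xn : x != 0 by apply/eqP => x00; move: an; rewrite E x00 expr0n eqxx.
have yn : y != 0 by apply/eqP => y00; move: bn; rewrite F y00 expr0n eqxx.
have [r r0 [r4 ->]] := kappaE.
have rn : r != 0 by rewrite gt_eqF.
(* The critical point [(3 b / a)^(1/4)], written with fourth roots. *)
exists (r * y / x).
  by rewrite divr_gt0 ?mulr_gt0// lt_neqAle eq_sym ?xn ?yn.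
rewrite E F powR_34// powR_14//.
have -> : x ^+ 4 * (r * y / x) + y ^+ 4 / (r * y / x) ^+ 3 = (r ^+ 4 + 1) * (x ^+ 3 * y) / r ^+ 3.
  by field; rewrite rn xn yn.
rewrite r4 (_ : 3 + 1 = 4); last by ring.
by rewrite [in leRHS]mulrAC lerDl ltW.
Qed.

Lemma integral_well_ge0 c d w : (0 <= \int[mu]_(x in `]c, d[) ((w x ^+ 2 - 1) ^+ 2)%:E)%E.
Proof. by apply: integral_ge0 => x _; rewrite lee_fin sqr_ge0. Qed.

Lemma integral_sq_ge0 c d w : (0 <= \int[mu]_(x in `]c, d[) (w x ^+ 2)%:E)%E.
Proof. by apply: integral_ge0 => x _; rewrite lee_fin sqr_ge0. Qed.

Lemma energyD c d p w w1 w2 : W2p_rep c d p w w1 w2 ->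
  energy c d w w2 = (\int[mu]_(x in `]c, d[) ((w x ^+ 2 - 1) ^+ 2)%:E
    + \int[mu]_(x in `]c, d[) (w2 x ^+ 2)%:E)%E.
Proof.
move=> W; rewrite /energy /dens.
under eq_integral do rewrite EFinD.
rewrite (@ge0_integralD _ _ _ mu); last 5 first.
- exact: measurable_itv.
- by move=> x _; rewrite lee_fin sqr_ge0.
- by apply/measurable_EFinP; apply: measurable_well; exact: W2p_measurable W.
- by move=> x _; rewrite lee_fin sqr_ge0.
- by apply/measurable_EFinP; apply: measurable_funX; exact: W2p_measurable2 W.
by [].
Qed.

Lemma affine_integrals c d c' d' p m l w w1 w2 : l != 0 ->
  (forall y, (c' < y < d') = (c < affine m l y < d)) -> W2p_rep c d p w w1 w2 ->
  ((\int[mu]_(y in `]c', d'[) ((w (affine m l y) ^+ 2 - 1) ^+ 2)%:E =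
    `|l|^-1%:E * \int[mu]_(x in `]c, d[) ((w x ^+ 2 - 1) ^+ 2)%:E) /\
  (\int[mu]_(y in `]c', d'[) ((l ^+ 2 * w2 (affine m l y)) ^+ 2)%:E =
    (l ^+ 4)%:E * (`|l|^-1%:E * \int[mu]_(x in `]c, d[) (w2 x ^+ 2)%:E)))%E.
Proof.
move=> l0 H W; split.
  apply: (ge0_integral_affine_oo l0 H (F := fun x => ((w x ^+ 2 - 1) ^+ 2)%:E)).
    by apply/measurable_EFinP; apply: measurable_well; exact: W2p_measurable W.
  by move=> x _; rewrite lee_fin sqr_ge0.
have mw2 : measurable_fun `]c, d[ (fun x => (w2 x ^+ 2)%:E).
  by apply/measurable_EFinP; apply: measurable_funX; exact: W2p_measurable2 W.
rewrite -(ge0_integral_affine_oo l0 H mw2); last by move=> x _; rewrite lee_fin sqr_ge0.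
under eq_integral do rewrite exprMn -exprM EFinM.
rewrite (@ge0_integralZl_EFin _ _ _ mu)//.
- by move=> x _; rewrite lee_fin sqr_ge0.
- apply/measurable_EFinP; apply: measurable_funX.
  exact: (measurable_affine_oo H (W2p_measurable2 W)).
- by rewrite (_ : l ^+ 4 = (l ^+ 2) ^+ 2) ?sqr_ge0// -exprM.
Qed.

Lemma ge0_lty_EFin (E : \bar R) : (0 <= E)%E -> (E < +oo)%E -> exists2 r : R, 0 <= r & E = r%:E.
Proof.
move=> E0 Eoo; exists (fine E); first exact: fine_ge0.
by rewrite fineK// ge0_fin_numE.
Qed.

Lemma Phi_repE w w2 : Phi_rep w w2 =
  ((\int[mu]_(y in `]0%R, 1%R[) ((w y ^+ 2 - 1) ^+ 2)%:E) `^ (3 / 4) *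
   (\int[mu]_(y in `]0%R, 1%R[) (w2 y ^+ 2)%:E) `^ (1 / 4))%E.
Proof.
rewrite /Phi_rep; congr (_ * (_ `^ _))%E.
by apply: eq_integral => y _; rewrite real_normK ?num_real.
Qed.

(** Rescaled to [[0, 1]] the function competes in [inf_Phi], and [kappa_amgm] with [L = d - c]
    compares [Phi] with the energy. *)
Lemma cost_le_energy (full : Prop) c d p t w w1 w2 : c < d -> W2p_rep c d p w w1 w2 ->
  w y @[y --> c^'+] --> (-1 : R) -> w y @[y --> d^'-] --> t ->
  w1 y @[y --> c^'+] --> (0 : R) -> (full -> w1 y @[y --> d^'-] --> (0 : R)) ->
  (cost full p t <= energy c d w w2)%E.
Proof.
move=> cd W wc wd w1c w1d.
rewrite (energyD W).
set A := (\int[mu]_(x in _) _)%E; set B := (\int[mu]_(x in _) _)%E.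
have A0 : (0 <= A)%E by exact: integral_well_ge0.
have B0 : (0 <= B)%E by exact: integral_sq_ge0.
have [Aoo|Afin] := eqVneq A +oo%E; first by rewrite Aoo addye ?leey// -ltNye (lt_le_trans _ B0).
have [Boo|Bfin] := eqVneq B +oo%E; first by rewrite Boo addey ?leey// -ltNye (lt_le_trans _ A0).
pose L := d - c.
have L0 : 0 < L by rewrite subr_gt0.
have Ln : L != 0 by rewrite gt_eqF.
have H y : (0 < y < 1) = (c < affine c L y < d).
  by rewrite /affine ltrDl pmulr_rgt0// -ltrBrDl -/L gtr_pMr.
have W' := W2p_affine Ln H W.
have [E1 E2] := affine_integrals Ln H W.
have aff0 : affine c L 0 = c by rewrite /affine mulr0 addr0.
have aff1 : affine c L 1 = d by rewrite /affine mulr1 /L; ring.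
have c0 : affine c L y @[y --> 0^'+] --> c^'+ by have := @affine_cvg_rr _ c L 0 L0; rewrite aff0.
have c1 : affine c L y @[y --> 1^'-] --> d^'- by have := @affine_cvg_ll _ c L 1 L0; rewrite aff1.
apply: (@le_trans _ _ (kappa%:E * Phi_rep (w \o affine c L) (fun y => L ^+ 2 * w2 (affine c L y))%R)%E).
  apply: lee_wpmul2l; first by rewrite lee_fin ltW// kappa_gt0.
  apply: ereal_inf_lbound.
  exists (w \o affine c L), (fun y => L * w1 (affine c L y)), (fun y => L ^+ 2 * w2 (affine c L y)).
  split => //; split; first exact: cvg_comp c0 wc.
  split; first exact: cvg_comp c1 wd.
  split.
    by rewrite -[X in _ --> X](mulr0 L); apply: cvgMr; exact: (cvg_comp _ _ c0 w1c).
  split => // hf.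
  by rewrite -[X in _ --> X](mulr0 L); apply: cvgMr; exact: (cvg_comp _ _ c1 (w1d hf)).
rewrite Phi_repE E1 E2 -/A -/B gtr0_norm//.
have [|r r0 ->] := ge0_lty_EFin A0; first by rewrite ltey.
have [|s s0 ->] := ge0_lty_EFin B0; first by rewrite ltey.
by have := kappa_amgm r0 s0 L0; rewrite -lee_fin.
Qed.

Lemma W2p_cst c d p k : 0 <= p -> c < d -> W2p_rep c d p (cst k) (cst 0) (cst 0).
Proof.
move=> p0 cd; by apply: (W2p_smooth p0 cd) => x; exact: cst_continuous.
Qed.

Lemma energy_well c d (s : R) : s ^+ 2 = 1 -> energy c d (cst s) (cst 0) = 0%E.
Proof.
move=> s1; apply: integral0_eq => x _.
by rewrite /dens /= s1 subrr expr0n/= addr0.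
Qed.

Lemma energy_ge0 c d w w2 : (0 <= energy c d w w2)%E.
Proof. by apply: integral_ge0 => x _; rewrite lee_fin dens_ge0. Qed.

(** The competitor is the cubic Hermite interpolant, flat at both ends and therefore admissible with
    and without [full]. *)
Lemma inf_Phi_lty (full : Prop) p t : 0 <= p -> (inf_Phi full p t < +oo)%E.
Proof.
move=> p0.
pose w y : R := -1 + (t + 1) * (3 * y ^+ 2 - 2 * y ^+ 3).
pose w1 y : R := (t + 1) * (6 * y - 6 * y ^+ 2).
pose w2 y : R := (t + 1) * (6 - 12 * y).
have dX (n : nat) x : is_derive x 1 (fun y : R => y ^+ n.+1) (n.+1%:R * x ^+ n).
  have := @is_deriveX R R id n.+1 x 1 1 (is_derive_id x 1).
  by rewrite exprfctE /GRing.scale/= mulr1.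
have dw x : is_derive x 1 w (w1 x).
  have := is_derive_lin2 1 (t + 1) (is_derive_cst (-1 : R) x 1)
    (is_derive_lin2 3 (-2) (dX 1%N x) (dX 2%N x)).
  rewrite (_ : (fun _ => _) = w); last by apply/funext => y; rewrite /w /=; ring.
  by move=> H; apply: (is_derive_eq H); rewrite /w1; ring.
have dw1 x : is_derive x 1 w1 (w2 x).
  have := is_derive_lin2 0 (t + 1) (is_derive_cst (-1 : R) x 1)
    (is_derive_lin2 6 (-6) (dX 0%N x) (dX 1%N x)).
  rewrite (_ : (fun _ => _) = w1); last by apply/funext => y; rewrite /w1 /=; ring.
  by move=> H; apply: (is_derive_eq H); rewrite /w2; ring.
have dw2 x : is_derive x 1 w2 (-12 * (t + 1)).
  have := is_derive_lin2 0 (t + 1) (is_derive_cst (-1 : R) x 1)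
    (is_derive_lin2 6 (-12) (is_derive_cst (1 : R) x 1) (is_derive_id x 1)).
  rewrite (_ : (fun _ => _) = w2); last by apply/funext => y; rewrite /w2 /=; ring.
  by move=> H; apply: (is_derive_eq H); ring.
have cw := is_derive_continuous dw; have cw1 := is_derive_continuous dw1.
have cw2 := is_derive_continuous dw2.
have W : W2p_rep 0 1 p w w1 w2 := W2p_smooth p0 ltr01 dw dw1 cw2.
have fin (h : R -> R) : continuous h -> (forall x, 0 <= h x) ->
    (\int[mu]_(x in `]0%R, 1%R[) (h x)%:E < +oo)%E.
  move=> ch h0.
  have hi : mu.-integrable `]0, 1[ (EFin \o h).
    apply: (@integrableS _ _ _ mu `[0, 1]) => //; first exact: subset_itv_oo_cc.
    apply: continuous_compact_integrable; first exact: segment_compact.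
    exact: continuous_subspaceT.
  have [_] := integrableP _ _ _ hi; apply: le_lt_trans.
  rewrite le_eqVlt; apply/orP; left; apply/eqP; apply: eq_integral => x _.
  by rewrite /= ger0_norm.
have cX (h : R -> R) (n : nat) : continuous h -> continuous (fun x => h x ^+ n).
  by move=> ch x; apply: (@continuous_comp _ _ _ h (fun z : R => z ^+ n)); [exact: ch|exact: exprn_continuous].
apply: (@le_lt_trans _ _ (Phi_rep w w2)).
  apply: ereal_inf_lbound; exists w, w1, w2; split => //.
  have e0 : w 0 = -1 by rewrite /w; ring.
  have e1 : w 1 = t by rewrite /w; ring.
  have f0 : w1 0 = 0 by rewrite /w1; ring.
  have f1 : w1 1 = 0 by rewrite /w1; ring.
  split; first by have := cvg_at_right_filter (cw 0); rewrite e0.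
  split; first by have := cvg_at_left_filter (cw 1); rewrite e1.
  split; first by have := cvg_at_right_filter (cw1 0); rewrite f0.
  by split => // _; have := cvg_at_left_filter (cw1 1); rewrite f1.
rewrite Phi_repE.
have A1 : (\int[mu]_(y in `]0%R, 1%R[) ((w y ^+ 2 - 1) ^+ 2)%:E < +oo)%E.
  apply: (fin (fun y => (w y ^+ 2 - 1) ^+ 2)) => [|x]; last exact: sqr_ge0.
  apply: (cX (fun y => w y ^+ 2 - 1)) => x.
  by apply: cvgB; [exact: cX|exact: cvg_cst].
have A2 : (\int[mu]_(y in `]0%R, 1%R[) (w2 y ^+ 2)%:E < +oo)%E.
  by apply: (fin (fun y => w2 y ^+ 2)) => [|x]; [exact: cX|exact: sqr_ge0].
apply: lte_mul_pinfty.
- exact: poweR_ge0.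
- by rewrite ge0_fin_numE ?poweR_ge0// poweR_lty.
- exact: poweR_lty.
Qed.

Lemma cost_ge0 (full : Prop) p t : (0 <= cost full p t)%E.
Proof. by rewrite mule_ge0 ?inf_Phi_ge0// lee_fin ltW// kappa_gt0. Qed.

Lemma cost_fin_num (full : Prop) p t : 0 <= p -> cost full p t \is a fin_num.
Proof.
move=> p0; rewrite fin_numM// ge0_fin_numE ?inf_Phi_ge0//; exact: inf_Phi_lty.
Qed.

(** An almost minimizer of [Phi] is stretched to the length that is optimal for its two integrals.
    Half of [e] is spent on the infimum and half on the length. *)
Lemma profile (full : Prop) p t e : 0 <= p -> 0 < e -> exists s w w1 w2, 0 < s /\
  W2p_rep 0 s p w w1 w2 /\
  (w y @[y --> 0^'+] --> (-1 : R)) /\ (w y @[y --> s^'-] --> t) /\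
  (w1 y @[y --> 0^'+] --> (0 : R)) /\ (full -> w1 y @[y --> s^'-] --> (0 : R)) /\
  (energy 0 s w w2 <= cost full p t + e%:E)%E.
Proof.
move=> p0 e0.
have e2 : 0 < e / 2 / kappa by rewrite !divr_gt0// kappa_gt0.
have Ifin : inf_Phi full p t \is a fin_num by rewrite ge0_fin_numE ?inf_Phi_ge0//; exact: inf_Phi_lty.
have [_ [w [w1 [w2 [W [w0 [wt [w10 [w11 ->]]]]]]]] Hlt] := lb_ereal_inf_adherent e2 Ifin.
rewrite Phi_repE in Hlt.
have w01 : (0 : R) < 1 by [].
set A := (\int[mu]_(x in _) ((w x ^+ 2 - 1) ^+ 2)%:E)%E in Hlt.
set B := (\int[mu]_(x in _) (w2 x ^+ 2)%:E)%E in Hlt.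
have A0 : (0 <= A)%E by exact: integral_well_ge0.
have B0 : (0 <= B)%E by exact: integral_sq_ge0.
have mA := measurable_well (W2p_measurable W).
have Afin : (A < +oo)%E.
  have [M HM] := W2p_bounded w01 W.
  apply: (@le_lt_trans _ _ (\int[mu]_(x in `]0%R, 1%R[) ((M ^+ 2 + 1) ^+ 2)%:E)%E).
    apply: ge0_le_integral.
    - exact: measurable_itv.
    - by move=> x _; rewrite lee_fin sqr_ge0.
    - exact/measurable_EFinP.
    - exact: measurable_cst.
    - move=> x; rewrite /= in_itv/= => /HM wM; rewrite lee_fin.
      have M0 : 0 <= M by apply: le_trans wM.
      have : w x ^+ 2 <= M ^+ 2 by rewrite -real_normK ?num_real// lerXn2r ?nnegrE.
      have : 0 <= w x ^+ 2 by exact: sqr_ge0.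
      rewrite -(@real_normK _ (w x ^+ 2 - 1)) ?num_real// => ? ?.
      rewrite lerXn2r ?nnegrE ?addr_ge0 ?sqr_ge0// ler_norml; apply/andP; split; lra.
  by rewrite integral_cst//= lebesgue_measure_itv/= lte_fin ltr01 -EFinB -EFinM ltry.
(* As [0 * +oo = 0], a vanishing potential integral would tell nothing about [B]. But then [w] is
   identically -1, so [t = -1] and the constant profile has energy 0. *)
have [AE0|An0] := eqVneq A 0%E.
  have w1' : forall x, 0 < x < 1 -> w x = -1.
    have wsq := W2p_well0 W AE0.
    have w1z x : 0 < x < 1 -> w1 x = 0.
      move=> x01.
      have D := W.1 x x01.
      have D2 := is_deriveX 2 D.
      have D3 : is_derive x 1 (cst 1 : R -> R) 0 by exact: is_derive_cst.
      have D4 : is_derive x 1 (w ^+ 2) 0.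
        apply: near_eq_is_derive D3; near=> y.
        rewrite exprfctE wsq//; near: y; exact: near_itv_oo.
      have [_ E1] := D2; have [_ E2] := D4.
      have : w x * w1 x = 0.
        by have := E1; rewrite E2 /GRing.scale/=; clear -R; lra.
      move/eqP; rewrite mulf_eq0 => /orP[/eqP wx|/eqP//].
      by have := wsq x x01; rewrite wx expr0n/= => /eqP; rewrite eq_sym oner_eq0.
    have wc x y : 0 < x -> x < y -> y < 1 -> w x = w y.
      move=> x0 xy y1; have [z /andP[xz zy] E] := W2p_MVT W x0 xy y1.
      apply/esym/eqP; rewrite -subr_eq0 E w1z ?mul0r//.
      by rewrite (lt_trans x0 xz) (lt_trans zy y1).
    move=> x x01; have [x0 x1] := andP x01.
    apply: (@cvg_unique _ _ (w y @[y --> 0^'+])) => //.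
    have H : cst (w x) @ (0 : R)^'+ --> w x by exact: cvg_cst.
    apply: cvg_trans H; apply: near_eq_cvg; near=> y.
    apply/esym/wc; [|by near: y; exact: nbhs_right_lt|exact: x1].
    by near: y; exact: nbhs_right_gt.
  have tE : t = -1.
    apply: (@cvg_unique _ _ (w y @[y --> 1^'-])) => //.
    have H : cst (-1 : R) @ (1 : R)^'- --> (-1 : R) by exact: cvg_cst.
    apply: cvg_trans H; apply: near_eq_cvg; near=> y.
    by apply/esym/w1'; near: y; exact: near_left_itv.
  exists 1, (cst (-1)), (cst 0), (cst 0); split => //; split; first exact: W2p_cst.
  split; first exact: cvg_cst.
  split; first by rewrite tE; exact: cvg_cst.
  split; first exact: cvg_cst.
  split; first by move=> _; exact: cvg_cst.
  rewrite energy_well ?sqrrN ?expr1n//.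
  by rewrite adde_ge0 ?cost_ge0// lee_fin ltW.
have Apos : (0 < A)%E by rewrite lt_neqAle eq_sym An0.
have [a a0 AE] := ge0_lty_EFin A0 Afin.
have {}a0 : 0 < a by move: Apos; rewrite AE lte_fin.
(* Here [A > 0], so an infinite [B] would make the product infinite, against the choice of [w]. *)
have Bfin : B != +oo%E.
  apply/eqP => BE; move: Hlt; rewrite AE BE poweRyr ?mul1r ?invr_eq0 ?pnatr_eq0//.
  by rewrite poweR_EFin gt0_muley ?lte_fin ?powR_gt0// ltNge leey.
have [|b b0 BE] := ge0_lty_EFin B0; first by rewrite ltey.
have e20 : 0 < e / 2 by rewrite divr_gt0.
have [s s0 Hs] := kappa_amgm_eq (ltW a0) b0 e20.
have sn : s != 0 by rewrite gt_eqF.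
have si0 : 0 < s^-1 by rewrite invr_gt0.
have sin : s^-1 != 0 by rewrite gt_eqF.
have H y : (0 < y < s) = (0 < affine 0 s^-1 y < 1).
  by rewrite /affine add0r pmulr_rgt0// mulrC ltr_pdivrMr// mul1r.
have W' := W2p_affine sin H W.
have [E1 E2] := affine_integrals sin H W.
have aff0 : affine 0 s^-1 0 = 0 by rewrite /affine mulr0 addr0.
have aff1 : affine 0 s^-1 s = 1 by rewrite /affine add0r mulVf.
have c0 : affine 0 s^-1 y @[y --> 0^'+] --> (0 : R)^'+.
  by have := @affine_cvg_rr _ 0 s^-1 0 si0; rewrite aff0.
have c1 : affine 0 s^-1 y @[y --> s^'-] --> (1 : R)^'-.
  by have := @affine_cvg_ll _ 0 s^-1 s si0; rewrite aff1.
exists s, (w \o affine 0 s^-1), (fun y => s^-1 * w1 (affine 0 s^-1 y)),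
  (fun y => s^-1 ^+ 2 * w2 (affine 0 s^-1 y)).
split => //; split => //; split; first exact: cvg_comp c0 w0.
split; first exact: cvg_comp c1 wt.
split.
  by rewrite -[X in _ --> X](mulr0 s^-1); apply: cvgMr; exact: (cvg_comp _ _ c0 w10).
split.
  move=> hf.
  by rewrite -[X in _ --> X](mulr0 s^-1); apply: cvgMr; exact: (cvg_comp _ _ c1 (w11 hf)).
rewrite (energyD W') E1 E2 -/A -/B AE BE normfV gtr0_norm// invrK.
have Hlt' : kappa * (a `^ (3 / 4) * b `^ (1 / 4)) <= fine (cost full p t) + e / 2.
  rewrite /cost fineM//=.
  have : (a `^ (3 / 4) * b `^ (1 / 4) <= fine (inf_Phi full p t) + e / 2 / kappa)%R.
    by rewrite -lee_fin EFinD fineK// ltW//; move: Hlt; rewrite AE BE.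
  rewrite -(ler_pM2l kappa_gt0) => /le_trans; apply.
  by rewrite mulrDr [X in _ + X]mulrC divfK// gt_eqF// kappa_gt0.
rewrite -(fineK (cost_fin_num full t p0)).
rewrite -[leLHS]/((s * a + s^-1 ^+ 4 * (s * b))%:E) -EFinD lee_fin.
have -> : s^-1 ^+ 4 * (s * b) = b / s ^+ 3 by field.
rewrite mulrC; lra.
Unshelve. all: by end_near. Qed.

(** Young's inequality [|v2| <= v2^2 / (2 k) + k / 2] with a free parameter stands in for
    Cauchy-Schwarz; each use chooses [k] so that the two terms balance. *)
Lemma W2p_osc c d p v v1 v2 k E y z : 0 < k -> W2p_rep c d p v v1 v2 ->
  (\int[mu]_(x in `]c, d[) (v2 x ^+ 2)%:E <= E%:E)%E ->
  c < y < d -> c < z < d -> `|v1 z - v1 y| <= (E / k + k * (d - c)) / 2.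
Proof.
move=> k0 W HE.
wlog yz : y z / y <= z.
  move=> H ycd zcd; have [/H|/ltW/H] := leP y z; first exact.
  by rewrite distrC; exact.
move=> /andP[cy yd] /andP[cz zd].
have cd : c < d by exact: lt_trans yd.
have kn : k != 0 by rewrite gt_eqF.
have mv2 := W2p_measurable2 W.
have vi := W.2.2.1.
have sub : `[y, z] `<=` `]c, d[.
  by move=> x /=; rewrite !in_itv/= => /andP[/(lt_le_trans cy) -> /le_lt_trans ->].
have E1 := W.2.2.2 _ _ cy yz zd.
rewrite -lee_fin -[X in (X <= _)%E]/(`|(v1 z - v1 y)%:E|%E) -E1.
have msq : measurable_fun `]c, d[ (fun x => v2 x ^+ 2) by exact: measurable_funX.
have mabs : measurable_fun `]c, d[ (fun x => `|v2 x|) by exact: measurableT_comp.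
apply: (le_trans (le_abse_integral _ _ _)) => //.
  by apply: measurable_funS (measurable_int _ vi).
apply: (@le_trans _ _ (\int[mu]_(x in `]c, d[) (`|v2 x|)%:E)%E).
  by apply: ge0_subset_integral => //; exact/measurable_EFinP.
apply: (@le_trans _ _ (\int[mu]_(x in `]c, d[) ((2 * k)^-1 * v2 x ^+ 2 + k / 2)%:E)%E).
  apply: ge0_le_integral.
  - exact: measurable_itv.
  - by move=> x _; rewrite lee_fin.
  - exact/measurable_EFinP.
  - by apply/measurable_EFinP; apply: measurable_funD => //; apply: measurable_funM.
  - move=> x _; rewrite lee_fin -subr_ge0 -(@real_normK _ (v2 x)) ?num_real//.
    rewrite (_ : _ - _ = (2 * k)^-1 * (`|v2 x| - k) ^+ 2); last by field.
    by rewrite mulr_ge0 ?sqr_ge0// invr_ge0 mulr_ge0// ltW.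
under eq_integral do rewrite EFinD EFinM.
have k2 : 0 <= (2 * k)^-1 by rewrite invr_ge0 mulr_ge0// ltW.
rewrite (@ge0_integralD _ _ _ mu); last 5 first.
- exact: measurable_itv.
- by move=> x _; rewrite -EFinM lee_fin mulr_ge0 ?sqr_ge0.
- by apply/measurable_EFinP; exact: measurable_funM.
- by move=> x _; rewrite lee_fin divr_ge0// ltW.
- exact: measurable_cst.
rewrite (@ge0_integralZl_EFin _ _ _ mu); last 4 first.
- exact: measurable_itv.
- by move=> x _; rewrite lee_fin sqr_ge0.
- exact/measurable_EFinP.
- exact: k2.
rewrite integral_cst//= lebesgue_measure_itv/= lte_fin cd.
apply: (@le_trans _ _ ((2 * k)^-1%:E * E%:E + (k / 2)%:E * (d - c)%:E)%E).
  by rewrite EFinB leeD2r//; apply: lee_wpmul2l => //; rewrite lee_fin.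
rewrite -!EFinM -EFinD lee_fin le_eqVlt; apply/orP; left; apply/eqP.
by field.
Qed.

(** For [s != 0], [|s^2 - 1|] is the product of the distance to the sign and [|s| + 1 >= 1]. *)
Lemma well_dist (s : R) (e : R) : 0 <= e -> (s ^+ 2 - 1) ^+ 2 < e ^+ 2 ->
  `|s - Num.sg s| <= e.
Proof.
move=> e0 H.
have : `|s ^+ 2 - 1| < e.
  by rewrite -(@ltr_pXn2r _ 2) ?nnegrE// real_normK ?num_real.
rewrite ltr_norml => /andP[h1 h2].
have [sn|sp|->] := ltgtP s 0.
- by rewrite ltr0_sg// ler_norml; apply/andP; split; nra.
- by rewrite gtr0_sg// ler_norml; apply/andP; split; nra.
- by rewrite sgr0 subr0 normr0.
Qed.

Lemma sq_integral_le_energy c d p w w1 w2 c' d' : c <= c' -> d' <= d -> W2p_rep c d p w w1 w2 ->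
  (\int[mu]_(x in `]c', d'[) ((w x ^+ 2 - 1) ^+ 2)%:E <= energy c d w w2)%E /\
  (\int[mu]_(x in `]c', d'[) (w2 x ^+ 2)%:E <= energy c d w w2)%E.
Proof.
move=> cc dd W; rewrite (energyD W).
have sub : `]c', d'[ `<=` `]c, d[.
  move=> x /=; rewrite !in_itv/= => /andP[h1 h2].
  by rewrite (le_lt_trans cc h1) (lt_le_trans h2 dd).
have m1 := measurable_well (W2p_measurable W).
have m2 : measurable_fun `]c, d[ (fun x => w2 x ^+ 2).
  by apply: measurable_funX; exact: W2p_measurable2 W.
split.
  apply: (@le_trans _ _ (\int[mu]_(x in `]c, d[) ((w x ^+ 2 - 1) ^+ 2)%:E)%E).
    apply: ge0_subset_integral; [exact: measurable_itv|exact: measurable_itv| | |exact: sub].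
      exact/measurable_EFinP.
    by move=> x _; rewrite lee_fin sqr_ge0.
  by rewrite leeDl// integral_sq_ge0.
apply: (@le_trans _ _ (\int[mu]_(x in `]c, d[) (w2 x ^+ 2)%:E)%E).
  apply: ge0_subset_integral; [exact: measurable_itv|exact: measurable_itv| | |exact: sub].
    exact/measurable_EFinP.
  by move=> x _; rewrite lee_fin sqr_ge0.
by rewrite leeDr// integral_well_ge0.
Qed.

(** The mean of the potential over a length of 1/5 is at most 5/10000, below [16^-1 ^+ 2]; a value
    that small also excludes [g z = 0]. *)
Lemma pick_well c d p g g1 g2 u : W2p_rep c d p g g1 g2 -> c <= u -> u + 5^-1 <= d ->
  (energy c d g g2 <= (10000^-1)%:E)%E -> exists z,
    [/\ u < z, z < u + 5^-1, Num.sg (g z) = 1 \/ Num.sg (g z) = -1 & `|g z - Num.sg (g z)| <= 16^-1].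
Proof.
move=> Wg u1 us E1.
have uu : u < u + 5^-1 by rewrite ltrDl.
have [i1 _] := sq_integral_le_energy u1 us Wg.
have mg : measurable_fun `]u, (u + 5^-1)[ (fun x => (g x ^+ 2 - 1) ^+ 2).
  apply: measurable_funS (measurable_well (W2p_measurable Wg)) => // z /=.
  by rewrite !in_itv/= => /andP[/(le_lt_trans u1) -> /lt_le_trans ->].
have [||z /andP[uz zu]] := @exists_lt_mean _ u (u + 5^-1) (16^-1 ^+ 2) _ uu mg.
- by move=> z _; rewrite sqr_ge0.
- apply: (le_lt_trans i1); apply: (le_lt_trans E1); rewrite lte_fin.
  by rewrite [u + _]addrC addrK; clear; lra.
clear E1 i1 mg => gz.
have e0 : (0 : R) <= 16^-1 by rewrite invr_ge0.
exists z; split; [exact: uz|exact: zu| |exact: well_dist e0 gz].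
have [gn|gp|g0] := ltgtP (g z) 0; [right|left|].
- by rewrite ltr0_sg.
- by rewrite gtr0_sg.
- by move: gz; rewrite g0 expr0n/=; clear; lra.
Qed.

(* If the energy were small, [g] would be close to 1 or to -1 at three points of
   [x - 1, x]; two of the signs agree, so [|g'| <= 5/8 + 1/100] there, too little
   to reach the value 0 at [x] from [|g| >= 15/16]. *)
Lemma energy_zero_gt c d p g g1 g2 x : W2p_rep c d p g g1 g2 -> c <= x - 1 -> x < d ->
  g x = 0 -> ((10000^-1)%:E < energy c d g g2)%E.
Proof.
move=> Wg cx xs gx; rewrite ltNge; apply/negP => E1.
have pick u : x - 1 <= u -> u + 5^-1 <= x -> exists z,
    [/\ u < z, z < u + 5^-1, Num.sg (g z) = 1 \/ Num.sg (g z) = -1 & `|g z - Num.sg (g z)| <= 16^-1].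
  move=> h1 h2; apply: (pick_well Wg _ _ E1).
    exact: le_trans h1.
  exact: le_trans (ltW xs).
have osc y z : x - 1 < y < x -> x - 1 < z < x -> `|g1 z - g1 y| <= 100^-1.
  move=> ycd zcd.
  have W' := W2p_sub cx (ltW xs) Wg.
  have [_ i2] := sq_integral_le_energy cx (ltW xs) Wg.
  have i2' := le_trans i2 E1.
  (* With this parameter both terms of [W2p_osc] equal 1/100 on an interval of length 1. *)
  have k0 : (0 : R) < 100^-1 by rewrite invr_gt0.
  by have := W2p_osc k0 W' i2' ycd zcd; move/le_trans; apply; clear; lra.
have mvt y z : x - 1 < y -> y < z -> z <= x -> exists2 u, y < u < z & g z - g y = g1 u * (z - y).
  move=> h1 h2 h3; apply: (W2p_MVT Wg _ h2).
    exact: le_lt_trans h1.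
  exact: le_lt_trans xs.
clear E1 Wg cx xs.
(* Three windows of length 1/5 with gaps of length 1/5: any two of the points are at least 1/5
   apart. *)
have [y1 [a1 b1 s1 d1]] := pick (x - 1) ltac:(lra) ltac:(lra).
have [y2 [a2 b2 s2 d2]] := pick (x - 3 / 5) ltac:(lra) ltac:(lra).
have [y3 [a3 b3 s3 d3]] := pick (x - 5^-1) ltac:(lra) ltac:(lra).
clear pick.
have slope y z : x - 1 < y -> y + 5^-1 <= z -> z < x -> Num.sg (g y) = Num.sg (g z) ->
    `|g y - Num.sg (g y)| <= 16^-1 -> `|g z - Num.sg (g z)| <= 16^-1 ->
    exists2 u, x - 1 < u < x & `|g1 u| <= 5 / 8.
  clear osc a1 b1 s1 d1 a2 b2 s2 d2 a3 b3 s3 d3 => ly yz zx sg dy dz.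
  have yz' : y < z by lra.
  have [u /andP[yu uz] E] := mvt _ _ ly yz' (ltW zx).
  exists u; first by apply/andP; split; lra.
  (* A difference of at most 1/8 over a distance of at least 1/5 is the origin of 5/8. *)
  have h1 : `|g z - g y| <= 8^-1.
    rewrite (_ : g z - g y = (g z - Num.sg (g z)) - (g y - Num.sg (g y))); last by rewrite sg; ring.
    by apply: (le_trans (ler_normB _ _)); lra.
  rewrite E normrM (gtr0_norm (_ : 0 < z - y)) in h1; last by lra.
  by have := normr_ge0 (g1 u); clear -h1 yz; nra.
have [u ux gu] : exists2 u, x - 1 < u < x & `|g1 u| <= 5 / 8.
  have l1 : x - 1 < y1 by [].
  have l2 : x - 1 < y2 by clear -a2; lra.
  have g12 : y1 + 5^-1 <= y2 by clear -a2 b1; lra.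
  have g13 : y1 + 5^-1 <= y3 by clear -a3 b1; lra.
  have g23 : y2 + 5^-1 <= y3 by clear -a3 b2; lra.
  have r2 : y2 < x by clear -b2; lra.
  have r3 : y3 < x by clear -b3; lra.
  have H12 (e : Num.sg (g y1) = Num.sg (g y2)) := slope y1 y2 l1 g12 r2 e d1 d2.
  have H13 (e : Num.sg (g y1) = Num.sg (g y3)) := slope y1 y3 l1 g13 r3 e d1 d3.
  have H23 (e : Num.sg (g y2) = Num.sg (g y3)) := slope y2 y3 l2 g23 r3 e d2 d3.
  case: s1 => s1; case: s2 => s2; case: s3 => s3;
  by [apply: H12; rewrite s1 s2|apply: H13; rewrite s1 s3|apply: H23; rewrite s2 s3].
have l3 : x - 1 < y3 by clear -a3; lra.
have r3 : y3 < x by clear -b3; lra.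
have [z /andP[y3z zx] E] := mvt _ _ l3 r3 (lexx x).
have zc : x - 1 < z < x by rewrite zx (lt_trans l3 y3z).
have o := osc _ _ ux zc.
have gz : `|g1 z| <= 5 / 8 + 100^-1.
  rewrite (_ : g1 z = g1 u + (g1 z - g1 u)); last by ring.
  by apply: (le_trans (ler_normD _ _)); rewrite lerD.
have : `|g x - g y3| <= (5 / 8 + 100^-1) * 5^-1.
  rewrite E normrM ler_pM//.
  by rewrite ger0_norm; clear -a3 b3; lra.
rewrite gx sub0r normrN.
have : 15 / 16 <= `|g y3|.
  move: d3; case: s3 => -> ; rewrite ler_distl => /andP[h1 h2].
    by apply: le_trans (ler_norm _); clear -h1 h2; lra.
  by rewrite -normrN; apply: le_trans (ler_norm _); clear -h1 h2; lra.
clear; lra.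
Qed.

(** The bound is uniform in the length [s]. A zero of [w] may lie close to 0, so the profile is
    first prolonged by -1 on []-1, 0[], which leaves a full unit interval to the left of the
    zero. *)
Lemma energy_jump_ge p s w w1 w2 : 0 <= p -> 0 < s -> W2p_rep 0 s p w w1 w2 ->
  w y @[y --> 0^'+] --> (-1 : R) -> w y @[y --> s^'-] --> (1 : R) ->
  w1 y @[y --> 0^'+] --> (0 : R) -> ((10000^-1)%:E < energy 0 s w w2)%E.
Proof.
move=> p0 s0 W wl wr w1l.
have m10 : (-1 : R) < 0 by rewrite ltrN10.
have Wc := W2p_cst (-1) p0 m10.
have l1 : (cst (-1 : R) : R -> R) x @[x --> (0 : R)^'-] --> (-1 : R) by exact: cvg_cst.
have l2 : (cst (0 : R) : R -> R) x @[x --> (0 : R)^'-] --> (0 : R) by exact: cvg_cst.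
have Wg := W2p_glue m10 s0 Wc W l1 wl l2 w1l.
have Eg := energy_glue m10 s0 Wc W l1 wl l2 w1l.
rewrite energy_well ?sqrrN ?expr1n// add0e in Eg.
rewrite -Eg.
have gl x : x < 0 -> glue 0 (-1) (cst (-1)) w x = -1 by move=> x0; rewrite glueL.
have gr x : 0 < x -> glue 0 (-1) (cst (-1)) w x = w x by move=> x0; rewrite glueR.
have gm : glue 0 (-1) (cst (-1)) w 0 = -1 := glueM _ _ _ _.
set g := glue 0 (-1) _ _ in Wg gl gr gm *.
clearbody g; clear Eg.
have [x [x0 xs gx]] : exists x, [/\ 0 < x, x < s & g x = 0].
  have [y [/andP[y0 ys] wy]] : exists y, 0 < y < s /\ 0 < w y.
    have : \forall y \near s^'-, 0 < y < s /\ 0 < w y.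
      move/cvgrPdist_lt : wr => /(_ 1 ltr01) H; near=> y; split.
        by near: y; exact: near_left_itv.
      have : `|1 - w y| < 1 by near: y.
      by rewrite ltr_distl => /andP[_]; clear; lra.
    by move=> /filter_ex.
  have my : - 2^-1 <= y by apply: le_trans (ltW y0); rewrite oppr_le0.
  have cg : {within `[- 2^-1, y], continuous g}.
    apply: continuous_in_subspaceT => z; rewrite inE/= in_itv/= => /andP[z1 z2].
    apply: (W2p_v_cont Wg); rewrite (le_lt_trans z2 ys) andbT.
    by clear -z1; lra.
  have g0 : g (- 2^-1) = -1 by apply: gl; rewrite oppr_lt0.
  have gy : g y = w y by exact: gr.
  have [|x] := IVT my cg (_ : Num.min (g (- 2^-1)) (g y) <= 0 <= Num.max (g (- 2^-1)) (g y)).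
    by rewrite g0 gy ge_min le_max lerN10/= (ltW wy) orbT.
  rewrite in_itv/= => /andP[x1 x2] gx; exists x.
  split; [|exact: le_lt_trans x2 ys|exact: gx].
  rewrite ltNge; apply/negP => x0; move/eqP: gx; apply/negP.
  move: x0; rewrite le_eqVlt => /predU1P[->|/gl ->]; rewrite ?gm oppr_eq0; exact: oner_neq0.
apply: (energy_zero_gt Wg _ xs gx).
by clear -x0; lra.
Unshelve. all: by end_near. Qed.

(** A profile within 1/20000 of the cost still has energy above 1/10000. This positivity bounds the
    number of jumps of a limit of finite energy. *)
Lemma cost_gt0 p : 0 <= p -> (0 < cost True p 1)%E.
Proof.
move=> p0.
have [s [w [w1 [w2 [s0 [W [wl [wr [w1l [_ H]]]]]]]]]] :=
  profile True 1 p0 (ltac:(lra) : 0 < (20000^-1 : R)).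
have := lt_le_trans (energy_jump_ge p0 s0 W wl wr w1l) H.
rewrite -(fineK (cost_fin_num True 1 p0)) -EFinD !lte_fin; clear; lra.
Qed.

Lemma pigeon_cells f c (h : R) (N : nat) : 0 < h ->
  measurable_fun `]c, (c + N%:R * h)[ f -> (forall x, 0 <= f x) ->
  (\int[mu]_(x in `]c, (c + N%:R * h)%R[) (f x)%:E < (N%:R)%:E)%E ->
  exists2 j : nat, (j < N)%N &
    (\int[mu]_(x in `](c + j%:R * h)%R, (c + j.+1%:R * h)%R[) (f x)%:E < 1)%E.
Proof.
move=> h0 mf f0 H; apply: contrapT => nex.
have {}nex j : (j < N)%N ->
    (1 <= \int[mu]_(x in `](c + j%:R * h)%R, (c + j.+1%:R * h)%R[) (f x)%:E)%E.
  by move=> jN; rewrite leNgt; apply/negP => ?; apply: nex; exists j.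
move: H; apply/negP; rewrite -leNgt.
elim: N mf nex => [|n IH] mf nex; first by apply: integral_ge0 => x _; rewrite lee_fin.
have nh : c + n%:R * h < c + n.+1%:R * h by rewrite ltrD2l ltr_pM2r// ltr_nat.
(* A single cell is treated apart: cutting off the last cell would leave an empty interval. *)
case: n => [|n] in IH mf nex nh *.
  by have := nex 0%N isT; rewrite mul0r addr0.
have cn : c < c + n.+1%:R * h by rewrite ltrDl mulr_gt0.
rewrite (ge0_integral_itv_split cn nh); last 2 first.
- exact/measurable_EFinP.
- by move=> x _; rewrite lee_fin.
rewrite {1}(_ : n.+2%:R = n.+1%:R + 1 :> R); last by rewrite -[n.+2]addn1 natrD.
rewrite EFinD; apply: leeD; last exact: (nex n.+1).
apply: IH => [|j jn]; last by apply: nex; exact: ltnW.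
apply: measurable_funS mf => // x /=; rewrite !in_itv/= => /andP[-> /=].
by move/lt_trans; apply.
Qed.

Lemma pick_not (B : set R) c d : c < d -> measurable B -> (mu (B `&` `]c, d[) < (d - c)%:E)%E ->
  exists2 x, c < x < d & ~ B x.
Proof.
move=> cd mB H; apply: contrapT => nex.
have sub : `]c, d[ `<=` B `&` `]c, d[.
  move=> x xcd; split; last exact: xcd.
  apply: contrapT => nB; apply: nex; exists x; last exact: nB.
  by move: xcd; rewrite /= in_itv.
have : (mu `]c, d[ <= mu (B `&` `]c, d[))%E.
  apply: le_measure; [rewrite inE; exact: measurable_itv|rewrite inE|exact: sub].
  exact: measurableI.
rewrite /= lebesgue_measure_itv/= lte_fin cd -EFinB leNgt.
by rewrite H.
Qed.

(** On a cell of length [h] a bending energy of [k^2 / h^3] lets the slope vary by at most [k / h].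
    Two values within [k] of [s], taken in the outer thirds, give a slope of at most [6 k / h]
    somewhere, hence [7 k / h] everywhere and [8 k] for the value at the midpoint. *)
Lemma good_cell c d p k v v1 v2 s y1 y2 : 0 < k -> W2p_rep c d p v v1 v2 ->
  (\int[mu]_(x in `]c, d[) (v2 x ^+ 2)%:E <= (k ^+ 2 / (d - c) ^+ 3)%:E)%E ->
  c < y1 -> 3 * y1 < 2 * c + d -> c + 2 * d < 3 * y2 -> y2 < d ->
  `|v y1 - s| <= k -> `|v y2 - s| <= k ->
  `|v ((c + d) / 2) - s| <= 8 * k /\ `|(d - c) * v1 ((c + d) / 2)| <= 8 * k.
Proof.
move=> k0 W HE cy1 y1d cy2 y2d vy1 vy2.
have [cd y12] : c < d /\ y1 < y2 by clear -cy1 y1d cy2 y2d; split; lra.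
pose h := d - c.
have h0 : 0 < h by rewrite subr_gt0.
have hn : h != 0 by rewrite gt_eqF.
have kn : k != 0 by rewrite gt_eqF.
have k' : 0 < k / h ^+ 2 by rewrite divr_gt0// exprn_gt0.
have osc y z : c < y < d -> c < z < d -> `|v1 z - v1 y| <= k / h.
  move=> ycd zcd; have := W2p_osc k' W HE ycd zcd; move/le_trans; apply.
  rewrite -/h le_eqVlt; apply/orP; left; apply/eqP; field.
  by rewrite hn kn.
have mvt y z : c < y -> y < z -> z < d -> exists2 u, y < u < z & v z - v y = v1 u * (z - y).
  by move=> ? ? ?; exact: (W2p_MVT W).
clear HE W.
have [u /andP[u1 u2] E] := mvt _ _ cy1 y12 y2d.
have ucd : c < u < d by apply/andP; split; lra.
have vu : h * `|v1 u| <= 6 * k.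
  have h1 : `|v y2 - v y1| <= 2 * k.
    rewrite (_ : v y2 - v y1 = (v y2 - s) - (v y1 - s)); last by ring.
    by apply: (le_trans (ler_normB _ _)); lra.
  rewrite E normrM (gtr0_norm (_ : 0 < y2 - y1)) in h1; last by lra.
  have h2 : h <= 3 * (y2 - y1) by rewrite /h; lra.
  have := normr_ge0 (v1 u); nra.
have v1b z : c < z < d -> h * `|v1 z| <= 7 * k.
  move=> zcd; have o := osc _ _ ucd zcd.
  have : `|v1 z| <= `|v1 u| + k / h.
    rewrite (_ : v1 z = v1 u + (v1 z - v1 u)); last by ring.
    by apply: (le_trans (ler_normD _ _)); rewrite lerD2l.
  rewrite -(ler_pM2l h0) mulrDr [h * (k / h)]mulrC divfK//; lra.
have mcd : c < (c + d) / 2 < d by apply/andP; split; lra.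
split.
  2: by rewrite -/h normrM (gtr0_norm h0); apply: le_trans (v1b _ mcd) _; clear -k0; lra.
have y1m : y1 < (c + d) / 2 by lra.
have [_ md] := andP mcd.
have [z /andP[z1 z2] E'] := mvt _ _ cy1 y1m md.
have zcd : c < z < d by apply/andP; split; lra.
rewrite (_ : v ((c + d) / 2) - s = (v y1 - s) + v1 z * ((c + d) / 2 - y1)); last by rewrite -E'; ring.
apply: (le_trans (ler_normD _ _)); rewrite normrM (gtr0_norm (_ : 0 < (c + d) / 2 - y1)); last by lra.
have := v1b _ zcd; have := normr_ge0 (v1 z).
have : (c + d) / 2 - y1 <= h by rewrite /h; lra.
nra.
Qed.

End Profiles.

(** * Cost of a single piece at scale eps *)

Section CostOfPieces.
Context {R : realType}.
Local Notation mu := (@lebesgue_measure R).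
Implicit Types (f g v w : R -> R) (a b c d x y z m l p k M e r s t L E h C : R).

(* Cut the interval into cells of length [h]: in one of them both the bending
   energy and the measure of the bad set [B] are small. *)
Lemma good_point c d p k h C v v1 v2 s (B : set R) :
  c < d -> 0 < h -> 0 < k -> W2p_rep c d p v v1 v2 ->
  (\int[mu]_(x in `]c, d[) (h ^+ 3 * v2 x ^+ 2)%:E <= C%:E)%E ->
  measurable B -> (forall x, c < x < d -> ~ B x -> `|v x - s| <= k) ->
  (mu (B `&` `]c, d[) <= ((d - c) / 6)%:E)%E ->
  4 * h <= d - c -> 4 * C * h <= k ^+ 2 * (d - c) ->
  exists2 x, c < x < d & `|v x - s| <= 8 * k /\ `|h * v1 x| <= 8 * k.
Proof.
move=> cd h0 k0 W HC mB vB muB h4 Ch.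
have hn : h != 0 by rewrite gt_eqF.
have kn : k != 0 by rewrite gt_eqF.
have dc0 : 0 < d - c by rewrite subr_gt0.
pose N := Num.truncn ((d - c) / h).
have [NL LN] : N%:R <= (d - c) / h /\ (d - c) / h < N%:R + 1.
  have L0 : 0 <= (d - c) / h by apply: divr_ge0; exact: ltW.
  by have := truncn_itv L0; rewrite -/N -natr1 => /andP[].
have NhL : c + N%:R * h <= d.
  by move: NL; rewrite ler_pdivlMr//; clear; lra.
(* Normalization: a cell on which the integral of [f] is below 1 has bending energy below
   [k^2 / h^3], as in [good_cell], and meets [B] in measure below [h / 3], so that [B] fills neither
   outer third. *)
pose q := h ^+ 3 / k ^+ 2.
have q0 : 0 < q by rewrite divr_gt0 ?exprn_gt0.
pose f x := q * v2 x ^+ 2 + 3 / h * \1_B x.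
have mv2 := W2p_measurable2 W.
have mf1 : measurable_fun `]c, d[ (fun x => q * v2 x ^+ 2).
  by apply: measurable_funM => //; exact: measurable_funX.
have mf2 : measurable_fun `]c, d[ (fun x => 3 / h * \1_B x).
  by apply: measurable_funM => //; exact: measurable_indic.
have mf : measurable_fun `]c, d[ f by exact: measurable_funD.
have h30 : 0 <= 3 / h by rewrite divr_ge0// ltW.
have f10 x : 0 <= q * v2 x ^+ 2 by rewrite mulr_ge0 ?sqr_ge0// ltW.
have f20 x : 0 <= 3 / h * \1_B x by rewrite mulr_ge0.
have f0 x : 0 <= f x by rewrite addr_ge0.
have subI c' d' : c <= c' -> d' <= d -> `]c', d'[ `<=` `]c, d[.
  move=> cc dd x /=; rewrite !in_itv/= => /andP[h1 h2].
  by rewrite (le_lt_trans cc h1) (lt_le_trans h2 dd).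
have intf c' d' : c <= c' -> d' <= d ->
    (\int[mu]_(x in `]c', d'[) (f x)%:E =
     q%:E * \int[mu]_(x in `]c', d'[) (v2 x ^+ 2)%:E + (3 / h)%:E * mu (B `&` `]c', d'[))%E.
  move=> cc dd; have sub := subI _ _ cc dd.
  have m1 : measurable_fun `]c', d'[ (fun x => q * v2 x ^+ 2) by exact: measurable_funS mf1.
  have m2 : measurable_fun `]c', d'[ (fun x => 3 / h * \1_B x) by exact: measurable_funS mf2.
  under eq_integral do rewrite EFinD.
  rewrite (@ge0_integralD _ _ _ mu); last 5 first.
  - exact: measurable_itv.
  - by move=> x _; rewrite lee_fin.
  - exact/measurable_EFinP.
  - by move=> x _; rewrite lee_fin.
  - exact/measurable_EFinP.
  congr (_ + _)%E.
    under eq_integral do rewrite EFinM.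
    rewrite (@ge0_integralZl_EFin _ _ _ mu)//; last exact: ltW.
    - by move=> x _; rewrite lee_fin sqr_ge0.
    - apply/measurable_EFinP; apply: measurable_funX.
      exact: measurable_funS mv2.
  under eq_integral do rewrite EFinM.
  rewrite (@ge0_integralZl_EFin _ _ _ mu)//.
  - by rewrite integral_indic.
  - by apply/measurable_EFinP; exact: measurable_indic.
(* With [X = (d - c) / h >= 4] the total is at most [X / 4 + X / 2 <= X - 1 < N]. *)
have intN : (\int[mu]_(x in `]c, (c + N%:R * h)%R[) (f x)%:E < (N%:R)%:E)%E.
  apply: (@le_lt_trans _ _ (\int[mu]_(x in `]c, d[) (f x)%:E)%E).
    apply: ge0_subset_integral; [exact: measurable_itv|exact: measurable_itv| | |exact: subI].
      exact/measurable_EFinP.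
    by move=> x _; rewrite lee_fin.
  rewrite intf//.
  have E1 : (q%:E * \int[mu]_(x in `]c, d[) (v2 x ^+ 2)%:E <= (C / k ^+ 2)%:E)%E.
    have -> : (q%:E * \int[mu]_(x in `]c, d[) (v2 x ^+ 2)%:E =
       (k ^- 2)%:E * \int[mu]_(x in `]c, d[) (h ^+ 3 * v2 x ^+ 2)%:E)%E.
      under [in RHS]eq_integral do rewrite EFinM.
      rewrite (@ge0_integralZl_EFin _ _ _ mu)//.
      - by rewrite muleA -EFinM /q [k ^- 2 * _]mulrC.
      - by move=> x _; rewrite lee_fin sqr_ge0.
      - by apply/measurable_EFinP; apply: measurable_funX.
      - by rewrite exprn_ge0// ltW.
    rewrite mulrC EFinM; apply: lee_wpmul2l => //.
    by rewrite lee_fin invr_ge0 exprn_ge0// ltW.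
  have E2 : ((3 / h)%:E * mu (B `&` `]c, d[) <= ((d - c) / h / 2)%:E)%E.
    apply: (@le_trans _ _ ((3 / h)%:E * ((d - c) / 6)%:E)%E).
      by apply: lee_wpmul2l => //; rewrite lee_fin.
    rewrite -EFinM lee_fin le_eqVlt; apply/orP; left; apply/eqP; field.
    by rewrite hn.
  apply: (le_lt_trans (leeD E1 E2)); rewrite -EFinD lte_fin.
  have E3 : C / k ^+ 2 <= (d - c) / h / 4.
    rewrite ler_pdivrMr ?exprn_gt0//.
    rewrite -(@ler_pM2r _ (4 * h)) ?mulr_gt0//.
    rewrite (_ : (d - c) / h / 4 * k ^+ 2 * (4 * h) = k ^+ 2 * (d - c)); last by field; rewrite hn.
    by clear -Ch; lra.
  have E4 : 4 <= (d - c) / h by rewrite ler_pdivlMr.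
  by clear -E3 E4 LN; lra.
have mfN : measurable_fun `]c, (c + N%:R * h)[ f by apply: measurable_funS mf => //; exact: subI.
have [j jN] := pigeon_cells h0 mfN f0 intN.
pose e := c + j%:R * h.
have eE : c + j.+1%:R * h = e + h by rewrite /e -natr1; ring.
rewrite -/e eE => Hcell.
have ce : c <= e by rewrite lerDl mulr_ge0// ltW.
have ed : e + h <= d.
  by apply: le_trans NhL; rewrite -eE lerD2l ler_pM2r// ler_nat.
clear intN.
rewrite intf// in Hcell.
have v20 : (0 <= q%:E * \int[mu]_(x in `]e, (e + h)%R[) (v2 x ^+ 2)%:E)%E.
  by rewrite mule_ge0 ?lee_fin ?integral_sq_ge0// ltW.
have b0 : (0 <= (3 / h)%:E * mu (B `&` `]e, (e + h)%R[))%E by rewrite mule_ge0.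
have H1 : (q%:E * \int[mu]_(x in `]e, (e + h)%R[) (v2 x ^+ 2)%:E < 1)%E.
  by apply: le_lt_trans Hcell; rewrite leeDl.
have H2 : ((3 / h)%:E * mu (B `&` `]e, (e + h)%R[) < 1)%E.
  by apply: le_lt_trans Hcell; rewrite leeDr.
have H1' : (\int[mu]_(x in `]e, (e + h)%R[) (v2 x ^+ 2)%:E <= (k ^+ 2 / (e + h - e) ^+ 3)%:E)%E.
  rewrite [e + h - e]addrC addrA addNr add0r.
  rewrite -(@lee_pmul2l _ q%:E)// -EFinM.
  rewrite (_ : q * (k ^+ 2 / h ^+ 3) = 1); last by rewrite /q; field; rewrite hn kn.
  exact: ltW.
have H2' : (mu (B `&` `]e, (e + h)%R[) < (h / 3)%:E)%E.
  rewrite -(@lte_pmul2l _ (3 / h)%:E) ?lte_fin ?divr_gt0// -EFinM.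
  by rewrite (_ : 3 / h * (h / 3) = 1)//; field.
have sub_mu u t : e <= u -> t <= e + h -> t - u = h / 3 -> (mu (B `&` `]u, t[) < (t - u)%:E)%E.
  move=> eu te ->; apply: le_lt_trans H2'.
  apply: le_measure; [rewrite inE; exact: measurableI|rewrite inE; exact: measurableI|].
  apply: setIS => x /=; rewrite !in_itv/= => /andP[h1 h2].
  by rewrite (le_lt_trans eu h1) (lt_le_trans h2 te).
have W' := W2p_sub ce ed W.
clear H1 H2 Hcell muB HC H2' b0 v20 NL LN.
have e1 : e < e + h / 3 by rewrite ltrDl divr_gt0.
have e2 : e + h * 2 / 3 < e + h by clear -h0; lra.
have [|y1 /andP[y1a y1b] nB1] := pick_not e1 mB.
  by apply: sub_mu => //; clear -h0; lra.
have [|y2 /andP[y2a y2b] nB2] := pick_not e2 mB.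
  by apply: sub_mu => //; clear -h0; lra.
have g1 : 3 * y1 < 2 * e + (e + h) by clear -y1b; lra.
have g2 : e + 2 * (e + h) < 3 * y2 by clear -y2a; lra.
have vy1 : `|v y1 - s| <= k.
  apply: vB => //; rewrite (le_lt_trans ce y1a)/= (lt_le_trans _ ed)//.
  by clear -y1b h0; lra.
have vy2 : `|v y2 - s| <= k.
  apply: vB => //; rewrite (lt_le_trans y2b ed) andbT (le_lt_trans ce)//.
  by clear -y2a h0; lra.
have [r1 r2] := good_cell k0 W' H1' y1a g1 g2 y2b vy1 vy2.
exists ((e + (e + h)) / 2).
  by apply/andP; split; clear -ce ed h0; lra.
split; first exact: r1.
by move: r2; rewrite [e + h - e]addrC addrA addNr add0r.
Qed.

(** Bumps at both ends make the data exact, and [cost_le_energy] applies to the corrected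
    function. *)
Lemma cost_le_energy_approx (full : Prop) c d p t k w w1 w2 (l0 l0' l1 l1' : R) :
  0 <= p -> c + 2 < d -> 0 <= k -> 156 * k <= 1 -> W2p_rep c d p w w1 w2 ->
  w y @[y --> c^'+] --> l0 -> w1 y @[y --> c^'+] --> l0' ->
  w y @[y --> d^'-] --> l1 -> (full -> w1 y @[y --> d^'-] --> l1') ->
  `|l0 + 1| <= k -> `|l0'| <= k -> `|l1 - t| <= k -> (full -> `|l1'| <= k) ->
  (cost full p t <= (1 + 9360 * k)%:E * energy c d w w2 + (9360 * k)%:E)%E.
Proof.
move=> p0 cd k0 k1 W wl w1l wr w1r H1 H2 H3 H4.
(* Without the slope condition the slope at [d] is not assumed to have a limit, and only the value
   is corrected there. *)
pose B1 := if pselect full then - l1' else 0.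
have B1k : `|B1| <= k.
  by rewrite /B1; case: pselect => [hf|nf]; rewrite ?normrN ?normr0//; exact: H4.
have A0k : `|-1 - l0| <= k by rewrite -normrN opprB opprK.
have B0k : `|- l0'| <= k by rewrite normrN.
have A1k : `|t - l1| <= k by rewrite distrC.
have [h [h1 [h2 [Wh [ch ch1] [e1 e2 e3 e4] _ HE]]]] :=
  perturb p0 cd k0 k1 A0k B0k A1k B1k W.
apply: le_trans HE; apply: (cost_le_energy _ Wh).
- by clear -cd; lra.
- have -> : -1 = l0 + h c by rewrite e1; ring.
  by apply: cvgD => //; apply: cvg_at_right_filter; exact: ch.
- have -> : t = l1 + h d by rewrite e3; ring.
  by apply: cvgD => //; apply: cvg_at_left_filter; exact: ch.
- have -> : 0 = l0' + h1 c by rewrite e2; ring.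
  by apply: cvgD => //; apply: cvg_at_right_filter; exact: ch1.
- move=> hf; have -> : 0 = l1' + h1 d by rewrite e4 /B1; case: (pselect full) => [hf'|nf]; [rewrite /= addrN|case: (nf hf)].
  by apply: cvgD; [exact: w1r|apply: cvg_at_left_filter; exact: ch1].
Qed.

(** Written with the representative [v] in both terms, whereas the potential term of [G_eps]
    involves [u]; [G_eps_ltP] passes from one to the other. *)
Definition energy_eps e c d v (v2 : R -> R) : \bar R :=
  (\int[mu]_(x in `]c, d[) (e^-1 * (v x ^+ 2 - 1) ^+ 2 + e ^+ 3 * v2 x ^+ 2)%:E)%E.

Lemma measurable_dens_eps e c d p v v1 v2 : W2p_rep c d p v v1 v2 ->
  measurable_fun `]c, d[ (fun x => e^-1 * (v x ^+ 2 - 1) ^+ 2 + e ^+ 3 * v2 x ^+ 2).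
Proof.
move=> W; apply: measurable_funD; apply: measurable_funM => //.
  by apply: measurable_well; exact: W2p_measurable W.
by apply: measurable_funX; exact: W2p_measurable2 W.
Qed.

(** The energy does not see the sign [s]; the Jacobian [|l|^-1] against 1 and [l ^+ 4] produces the
    two weights at scale [|l|]. *)
Lemma energy_affine c d c' d' p m l s v v1 v2 : l != 0 -> s ^+ 2 = 1 ->
  (forall y, (c' < y < d') = (c < affine m l y < d)) -> W2p_rep c d p v v1 v2 ->
  energy c' d' (fun y => s * v (affine m l y)) (fun y => s * (l ^+ 2 * v2 (affine m l y))) =
  energy_eps `|l| c d v v2.
Proof.
move=> l0 s1 H W.
have e4 (z : R) : z ^+ 4 = (z ^+ 2) ^+ 2 by rewrite -exprM.
have l4 : l ^+ 4 = `|l| ^+ 4 by rewrite !e4 real_normK ?num_real.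
have ln : `|l| != 0 by rewrite normr_eq0.
rewrite /energy /energy_eps /dens.
transitivity (\int[mu]_(y in `]c', d'[)
   (((v (affine m l y) ^+ 2 - 1) ^+ 2 + l ^+ 4 * v2 (affine m l y) ^+ 2)%:E))%E.
  apply: eq_integral => y _; congr EFin.
  have e (z : R) : (s * z) ^+ 2 = z ^+ 2 by rewrite exprMn s1 mul1r.
  by rewrite !e; ring.
have mF : measurable_fun `]c, d[ (fun x => ((v x ^+ 2 - 1) ^+ 2 + l ^+ 4 * v2 x ^+ 2)%:E).
  apply/measurable_EFinP; apply: measurable_funD.
    by apply: measurable_well; exact: W2p_measurable W.
  apply: measurable_funM => //.
  by apply: measurable_funX; exact: W2p_measurable2 W.
have F0 x : (0 <= ((v x ^+ 2 - 1) ^+ 2 + l ^+ 4 * v2 x ^+ 2)%:E)%E.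
  by rewrite lee_fin addr_ge0 ?sqr_ge0// mulr_ge0 ?sqr_ge0// l4 exprn_ge0.
have := ge0_integral_affine_oo l0 H mF; move=> /(_ (fun x _ => F0 x)) /= ->.
rewrite -(@ge0_integralZl_EFin _ _ _ mu).
- apply: eq_integral => x _; rewrite -EFinM; congr EFin; rewrite l4; field.
  by rewrite ln.
- exact: measurable_itv.
- by move=> x _.
- exact: mF.
- by rewrite invr_ge0.
Qed.

(** Rescaling by [h] and multiplying by [s] bring the left end close to -1. A length above [2 h]
    becomes a length above 2, so that the corrections at the two ends do not meet. *)
Lemma cost_le_piece (full : Prop) c d p t k h s v v1 v2 (l0 l0' l1 l1' : R) :
  0 <= p -> 0 < h -> s ^+ 2 = 1 -> c + 2 * h < d -> 0 <= k -> 156 * k <= 1 ->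
  W2p_rep c d p v v1 v2 ->
  v y @[y --> c^'+] --> l0 -> v1 y @[y --> c^'+] --> l0' ->
  v y @[y --> d^'-] --> l1 -> (full -> v1 y @[y --> d^'-] --> l1') ->
  `|s * l0 + 1| <= k -> `|h * l0'| <= k -> `|s * l1 - t| <= k -> (full -> `|h * l1'| <= k) ->
  (cost full p t <= (1 + 9360 * k)%:E * energy_eps h c d v v2 + (9360 * k)%:E)%E.
Proof.
move=> p0 h0 s1 cd k0 k1 W vl v1l vr v1r H1 H2 H3 H4.
have hn : h != 0 by rewrite gt_eqF.
have sn1 := normr_sign1 s1.
have H y : (c / h < y < d / h) = (c < affine 0 h y < d).
  by rewrite /affine add0r ltr_pdivrMr// ltr_pdivlMr// [y * h]mulrC.
have affc x : affine 0 h (x / h) = x by rewrite /affine add0r mulrCA divff// mulr1.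
have W' := W2p_scale s (W2p_affine hn H W).
have cc : affine 0 h y @[y --> (c / h)^'+] --> c^'+.
  by have := @affine_cvg_rr _ 0 h (c / h) h0; rewrite affc.
have dd : affine 0 h y @[y --> (d / h)^'-] --> d^'-.
  by have := @affine_cvg_ll _ 0 h (d / h) h0; rewrite affc.
rewrite -{1}(gtr0_norm h0) -(energy_affine hn s1 H W).
apply: (@cost_le_energy_approx full _ _ _ _ _ _ _ _ (s * l0) (s * (h * l0')) (s * l1) (s * (h * l1'))
  p0 _ k0 k1 W').
- rewrite -(ltr_pM2r h0) mulrDl !divfK//; exact: cd.
- by apply: cvgMr; exact: (cvg_comp _ _ cc vl).
- by do 2 apply: cvgMr; exact: (cvg_comp _ _ cc v1l).
- by apply: cvgMr; exact: (cvg_comp _ _ dd vr).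
- by move=> hf; do 2 apply: cvgMr; exact: (cvg_comp _ _ dd (v1r hf)).
- exact: H1.
- by rewrite normrM sn1 mul1r.
- exact: H3.
- by move=> hf; rewrite normrM sn1 mul1r; exact: H4.
Qed.

(** The left boundary layer is a transition run backwards: rescaling by [- h] puts the flat end
    first. *)
Lemma cost_le_piece_left c d p t k h s v v1 v2 (l0 l1 l1' : R) :
  0 <= p -> 0 < h -> s ^+ 2 = 1 -> c + 2 * h < d -> 0 <= k -> 156 * k <= 1 ->
  W2p_rep c d p v v1 v2 ->
  v y @[y --> c^'+] --> l0 -> v y @[y --> d^'-] --> l1 -> v1 y @[y --> d^'-] --> l1' ->
  `|s * l1 + 1| <= k -> `|h * l1'| <= k -> `|s * l0 - t| <= k ->
  (cost False p t <= (1 + 9360 * k)%:E * energy_eps h c d v v2 + (9360 * k)%:E)%E.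
Proof.
move=> p0 h0 s1 cd k0 k1 W vl vr v1r H1 H2 H3.
have hn : - h != 0 by rewrite oppr_eq0 gt_eqF.
have hm : - h < 0 by rewrite oppr_lt0.
have sn1 := normr_sign1 s1.
have H y : (- d / h < y < - c / h) = (c < affine 0 (- h) y < d).
  rewrite /affine add0r ltr_pdivrMr// ltr_pdivlMr// mulNr [y * h]mulrC.
  by rewrite ltrNr ltrNl andbC.
have affc x : affine 0 (- h) (- x / h) = x.
  by rewrite /affine add0r; field; rewrite gt_eqF.
have W' := W2p_scale s (W2p_affine hn H W).
have dd : affine 0 (- h) y @[y --> (- d / h)^'+] --> d^'-.
  by have := @affine_cvg_rl _ 0 (- h) (- d / h) hm; rewrite affc.
have cc : affine 0 (- h) y @[y --> (- c / h)^'-] --> c^'+.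
  by have := @affine_cvg_lr _ 0 (- h) (- c / h) hm; rewrite affc.
have hN : `|- h| = h by rewrite normrN gtr0_norm.
rewrite -{1}hN -(energy_affine hn s1 H W).
apply: (@cost_le_energy_approx False _ _ _ _ _ _ _ _ (s * l1) (s * (- h * l1')) (s * l0) 0
  p0 _ k0 k1 W').
- rewrite -(ltr_pM2r h0) mulrDl !divfK ?gt_eqF//; by clear -cd; lra.
- by apply: cvgMr; exact: (cvg_comp _ _ dd vr).
- by do 2 apply: cvgMr; exact: (cvg_comp _ _ dd v1r).
- by apply: cvgMr; exact: (cvg_comp _ _ cc vl).
- by [].
- exact: H1.
- by rewrite normrM sn1 mul1r mulNr normrN.
- exact: H3.
- by [].
Qed.

End CostOfPieces.

(** * Lower bound along alternating chains; step structure of the limit *)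

Section LowerBound.
Context {R : realType}.
Local Notation mu := (@lebesgue_measure R).
Implicit Types (f g v w u : R -> R) (a b c d x y z m l p k M e r s t L E h C A B : R).

Lemma energy_eps_split e c m d p v v1 v2 : 0 < e -> c < m -> m < d ->
  W2p_rep c d p v v1 v2 ->
  energy_eps e c d v v2 = (energy_eps e c m v v2 + energy_eps e m d v v2)%E.
Proof.
move=> e0 cm md W; rewrite /energy_eps (ge0_integral_itv_split cm md)//.
- by apply/measurable_EFinP; exact: measurable_dens_eps W.
- by move=> x _; rewrite lee_fin addr_ge0// mulr_ge0 ?sqr_ge0// ?invr_ge0 ?exprn_ge0// ltW.
Qed.

Lemma energy_eps_ge0 e c d v (v2 : R -> R) : 0 < e -> (0 <= energy_eps e c d v v2)%E.
Proof.
move=> e0; apply: integral_ge0 => x _.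
by rewrite lee_fin addr_ge0// mulr_ge0 ?sqr_ge0// ?invr_ge0 ?exprn_ge0// ltW.
Qed.

Lemma sign_dist s x : s ^+ 2 = 1 -> `|- s * x + 1| = `|x - s|.
Proof.
move=> s1; rewrite -s1 (_ : - s * x + s ^+ 2 = - s * (x - s)); last by ring.
by rewrite normrM normrN (normr_sign1 s1) mul1r.
Qed.

Lemma sign_dist2 s x y : s ^+ 2 = 1 -> `|- s * x - (- y * s)| = `|x - y|.
Proof.
move=> s1; rewrite (_ : - s * x - (- y * s) = - s * (x - y)); last by ring.
by rewrite normrM normrN (normr_sign1 s1) mul1r.
Qed.

Lemma addK_bound (K : R) (t1 t2 c1 c2 : R) (E1 E2 : \bar R) : 0 <= K ->
  (0 <= E1 -> 0 <= E2 ->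
   t1%:E <= (1 + K)%:E * E1 + c1%:E -> t2%:E <= (1 + K)%:E * E2 + c2%:E ->
   (t1 + t2)%:E <= (1 + K)%:E * (E1 + E2) + (c1 + c2)%:E)%E.
Proof.
move=> K0 E10 E20 H1 H2.
by rewrite (EFinD t1 t2) (EFinD c1 c2) ge0_muleDr// addeACA; exact: leeD.
Qed.

Lemma chain_in a b m (n : nat) (y z : nat -> R) : 0 < m -> a + m <= y 0%N -> z n + m <= b ->
  (forall i, (i <= n)%N -> y i + m <= z i) -> (forall i, (i < n)%N -> z i + m <= y i.+1) ->
  forall i, (i <= n)%N -> a < y i /\ z i < b.
Proof.
move=> m0 ay zb yz zy i iN; split.
  elim: i iN => [|i IH] iN; first by move: ay m0; clear; lra.
  by have := zy i iN; have := IH (ltnW iN); have := yz i (ltnW iN); move: m0; clear; lra.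
(* Downward induction from [z n], carried out on [n - i]. *)
rewrite -(subKn iN); elim: (n - i)%N => [|j IH].
  by rewrite subn0; move: zb m0; clear; lra.
have [jn|nj] := ltnP j n; last first.
  by move: IH; rewrite (_ : n - j.+1 = n - j)%N//; move: nj; rewrite -subn_eq0 subnS => /eqP ->.
have E : (n - j = (n - j.+1).+1)%N by rewrite subnSK.
have h1 : (n - j.+1 < n)%N by rewrite -subSn// subSS leq_subr.
have := zy _ h1; rewrite -E; have := yz (n - j)%N (leq_subr _ _).
by move: IH m0; clear; lra.
Qed.

(** The good points [xi i] cut []a, b[] into [n] transitions and two boundary layers; each of these
    [n + 2] pieces brings one absolute error [K]. The [8 * k] is the precision that [good_point]
    delivers. *)
Lemma chain_core a b p k h C (A B a0 b0 s : R) (n : nat) (y z : nat -> R) v v1 v2 (m : R) :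
  0 <= p -> 0 < h -> 0 < k -> 156 * (8 * k) <= 1 -> s ^+ 2 = 1 -> 0 < m ->
  W2p_rep a b p v v1 v2 -> v x @[x --> a^'+] --> A -> v x @[x --> b^'-] --> B ->
  `|A - a0| <= 8 * k -> `|B - b0| <= 8 * k ->
  (energy_eps h a b v v2 <= C%:E)%E -> 0 <= C -> 4 * h <= m -> 4 * C * h <= k ^+ 2 * m ->
  a + m <= y 0%N -> z n + m <= b ->
  (forall i, (i <= n)%N -> y i + m <= z i) ->
  (forall i, (i < n)%N -> z i + m <= y i.+1) ->
  (forall i, (i <= n)%N -> (mu ([set x | (k < `|v x - s * (-1) ^+ i|)%R] `&` `]y i, z i[) <= ((z i - y i) / 6)%:E)%E) ->
  ((fine (cost False p (- a0 * s)) + n%:R * fine (cost True p 1)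
    + fine (cost False p (- b0 * (s * (-1) ^+ n))))%:E
   <= (1 + 9360 * (8 * k))%:E * energy_eps h a b v v2 + ((n%:R + 2) * (9360 * (8 * k)))%:E)%E.
Proof.
move=> p0 h0 k0 k1 s1 m0 W vA vB Aa Bb HC C0 hm Chm ay zb yz zy muB.
have K0 : 0 <= 9360 * (8 * k).
  by apply: mulr_ge0; [exact: ler0n|apply: mulr_ge0; [exact: ler0n|exact: ltW]].
have [K KE] : exists K, K = 9360 * (8 * k) by exists (9360 * (8 * k)).
rewrite -KE in K0 *.
have k80 : 0 <= 8 * k by rewrite mulr_ge0// ltW.
have si i : (s * (-1) ^+ i) ^+ 2 = 1.
  by rewrite exprMn s1 mul1r -exprM muln2 -signr_odd odd_double expr0.
have yzi i : (i <= n)%N -> y i < z i by move=> /yz; clear -m0; lra.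
have za i : (i <= n)%N -> a < y i by move=> iN; case: (chain_in m0 ay zb yz zy iN).
have zb' i : (i <= n)%N -> z i < b by move=> iN; case: (chain_in m0 ay zb yz zy iN).
have HC3 : (\int[mu]_(x in `]a, b[) (h ^+ 3 * v2 x ^+ 2)%:E <= C%:E)%E.
  apply: le_trans HC; apply: ge0_le_integral.
  - exact: measurable_itv.
  - by move=> x _; rewrite lee_fin mulr_ge0 ?sqr_ge0// exprn_ge0// ltW.
  - apply/measurable_EFinP; apply: measurable_funM => //.
    by apply: measurable_funX; exact: W2p_measurable2 W.
  - by apply/measurable_EFinP; exact: measurable_dens_eps W.
  - by move=> x _; rewrite lee_fin lerDr mulr_ge0 ?sqr_ge0// invr_ge0 ltW.
have [xi Hxi] : exists xi : nat -> R, forall i, (i <= n)%N ->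
    [/\ y i < xi i < z i, `|v (xi i) - s * (-1) ^+ i| <= 8 * k & `|h * v1 (xi i)| <= 8 * k].
  have H i : exists x : R, (i <= n)%N ->
    [/\ y i < x < z i, `|v x - s * (-1) ^+ i| <= 8 * k & `|h * v1 x| <= 8 * k].
    have [iN|] := leqP i n; last by move=> _; exists 0.
    have ayi := za i iN; have zbi := zb' i iN; have yzi' := yz i iN.
    have Wi := W2p_sub (ltW ayi) (ltW zbi) W.
    have sub : `]y i, z i[ `<=` `]a, b[.
      by move=> x /=; rewrite !in_itv/= => /andP[/(lt_trans ayi) -> /lt_trans ->].
    have [||||||x xyz [Hx1 Hx2]] := @good_point _ (y i) (z i) p k h C v v1 v2 (s * (-1) ^+ i)
      ([set x | k < `|v x - s * (-1) ^+ i|] `&` `]a, b[) (yzi i iN) h0 k0 Wi.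
    + apply: le_trans HC3; apply: ge0_subset_integral; [exact: measurable_itv|exact: measurable_itv| | |exact: sub].
        apply/measurable_EFinP; apply: measurable_funM => //.
        by apply: measurable_funX; exact: W2p_measurable2 W.
      by move=> x _; rewrite lee_fin mulr_ge0 ?sqr_ge0// exprn_ge0// ltW.
    + by apply: measurable_superlevel; apply: measurable_funB => //; exact: W2p_measurable W.
    + move=> x xyz nB; rewrite leNgt; apply/negP => kx; apply: nB; split => //.
      by apply: sub; rewrite /= in_itv.
    + by rewrite -setIA (_ : `]a, b[ `&` `]y i, z i[ = `]y i, z i[)%classic ?muB//; apply/setIidPr.
    + by clear -hm yzi'; lra.
    + apply: (le_trans Chm); rewrite ler_pM2l ?exprn_gt0//.
      by clear -yzi'; lra.
    by exists x.
  by have [xi Hxi] := choice H; exists xi.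
have xia i : (i <= n)%N -> a < xi i < b.
  move=> iN; have [/andP[h1 h2] _ _] := Hxi i iN.
  by rewrite (lt_trans (za i iN) h1) (lt_trans h2 (zb' i iN)).
have cv i : (i <= n)%N -> v x @[x --> (xi i)^'+] --> v (xi i) /\ v x @[x --> (xi i)^'-] --> v (xi i).
  move=> iN; have := W2p_v_cont W (xia i iN) => cx.
  by split; [exact: cvg_at_right_filter|exact: cvg_at_left_filter].
have cv1 i : (i <= n)%N -> v1 x @[x --> (xi i)^'+] --> v1 (xi i) /\ v1 x @[x --> (xi i)^'-] --> v1 (xi i).
  move=> iN; have := W2p_v1_cont W (xia i iN) => cx.
  by split; [exact: cvg_at_right_filter|exact: cvg_at_left_filter].
(* Induction over the pieces: the left boundary layer and the first [j] transitions. *)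
have P j : (j <= n)%N ->
  ((fine (cost False p (- a0 * s)) + j%:R * fine (cost True p 1))%:E
   <= (1 + K)%:E * energy_eps h a (xi j) v v2 + ((j%:R + 1) * K)%:E)%E.
  elim: j => [|j IH] jn.
    have /andP[x1 x2] := xia 0%N jn; have [/andP[y1 y2] v0 v10] := Hxi 0%N jn.
    rewrite mul0r addr0 add0r mul1r fineK ?cost_fin_num// KE.
    (* Multiplication by [- s] turns the value near [s] at the right end into one near -1, and [A]
       into a value near [- a0 * s], the argument of [beta]. *)
    apply: (@cost_le_piece_left _ a (xi 0%N) p (- a0 * s) (8 * k) h (- s) v v1 v2 A (v (xi 0%N)) (v1 (xi 0%N)) p0 h0 _ _ k80 k1) => //.
    - by rewrite sqrrN.
    - by clear -y1 ay hm h0; lra.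
    - exact: W2p_sub (ltW x2) W.
    - exact: (cv 0%N jn).2.
    - exact: (cv1 0%N jn).2.
    - by rewrite sign_dist// -[X in _ - X]mulr1.
    - by rewrite sign_dist2.
  have jn' := ltnW jn.
  have /andP[x1 x2] := xia j jn'; have /andP[x3 x4] := xia j.+1 jn.
  have [/andP[y1 y2] vj v1j] := Hxi j jn'; have [/andP[y3 y4] vj1 v1j1] := Hxi j.+1 jn.
  have xx : xi j < xi j.+1 by have := zy j jn; clear -y2 y3 m0; lra.
  have W' := W2p_sub (lexx a) (ltW x4) W.
  rewrite (energy_eps_split h0 x1 xx W').
  rewrite -natr1 mulrDl mul1r addrA [(_ + 1 + 1) * K]mulrDl mul1r.
  apply: addK_bound => //; [exact: energy_eps_ge0|exact: energy_eps_ge0|exact: IH|].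
  rewrite fineK ?cost_fin_num// KE.
  apply: (@cost_le_piece _ True (xi j) (xi j.+1) p 1 (8 * k) h (- (s * (-1) ^+ j)) v v1 v2
    (v (xi j)) (v1 (xi j)) (v (xi j.+1)) (v1 (xi j.+1)) p0 h0 _ _ k80 k1) => //.
  - by rewrite sqrrN.
  - by have := zy j jn; clear -y2 y3 hm h0; lra.
  - exact: W2p_sub (ltW x1) (ltW x4) W.
  - exact: (cv j jn').1.
  - exact: (cv1 j jn').1.
  - exact: (cv _ jn).2.
  - by move=> _; exact: (cv1 _ jn).2.
  - by rewrite sign_dist.
  - have -> : - (s * (-1) ^+ j) = s * (-1) ^+ j.+1 by rewrite exprS; ring.
    rewrite (_ : _ - 1 = - (- (s * (-1) ^+ j.+1) * v (xi j.+1) + 1)); last by ring.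
    by rewrite normrN sign_dist.
have /andP[x1 x2] := xia n (leqnn n); have [/andP[y1 y2] vn v1n] := Hxi n (leqnn n).
rewrite (energy_eps_split h0 x1 x2 W).
rewrite (_ : (n%:R + 2) * K = (n%:R + 1) * K + K); last by ring.
apply: addK_bound => //; [exact: energy_eps_ge0|exact: energy_eps_ge0|exact: P|].
rewrite fineK ?cost_fin_num// KE.
(* No slope is prescribed at [b]: [full] is false, and 0 fills the slot of the slope limit. *)
apply: (@cost_le_piece _ False (xi n) b p (- b0 * (s * (-1) ^+ n)) (8 * k) h (- (s * (-1) ^+ n)) v v1 v2
    (v (xi n)) (v1 (xi n)) B 0 p0 h0 _ _ k80 k1) => //.
- by rewrite sqrrN.
- by clear -y2 zb hm h0; lra.
- exact: W2p_sub (ltW x1) (lexx b) W.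
- exact: (cv n (leqnn n)).1.
- exact: (cv1 n (leqnn n)).1.
- by rewrite sign_dist.
- by rewrite sign_dist2.
Qed.

(* Weaker than being a density point of [u = s], but stable enough for the
   pigeonhole argument; 1/12 leaves room for the points where [u_n] is far from [u]. *)
Definition dense_at a b u s x : Prop := forall r, 0 < r -> exists y z : R,
  [/\ x - r < y, y < z, z < x + r, a < y & z < b] /\
  (mu ([set t | u t <> s] `&` `]y, z[) <= ((z - y) / 12)%:E)%E.

Lemma fin_min (n : nat) (f : nat -> R) : (forall i, (i < n)%N -> 0 < f i) ->
  exists2 m : R, 0 < m & forall i, (i < n)%N -> m <= f i.
Proof.
elim: n => [|n IH] H; first by exists 1.
have [|m m0 Hm] := IH; first by move=> i iN; apply: H; exact: ltnW.
exists (Num.min m (f n)); first by rewrite lt_min m0 H.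
move=> i; rewrite ltnS leq_eqVlt => /predU1P[->|/Hm h]; rewrite ge_min ?lexx ?orbT//.
by rewrite h.
Qed.

(** With [r] at most half of every gap between consecutive points, the intervals given by [dense_at]
    are disjoint; [m] is the least of the finitely many lengths and distances. *)
Lemma chain_intervals a b u s (n : nat) (x : nat -> R) :
  (forall i, (i <= n)%N -> dense_at a b u (s * (-1) ^+ i) (x i)) ->
  (forall i, (i < n)%N -> x i < x i.+1) ->
  exists (y z : nat -> R) (m : R), [/\ 0 < m, a + m <= y 0%N, z n + m <= b,
   forall i, (i <= n)%N -> y i + m <= z i &
   forall i, (i < n)%N -> z i + m <= y i.+1] /\
   forall i, (i <= n)%N -> (mu ([set t | (u t <> s * (-1) ^+ i)%R] `&` `]y i, z i[) <= ((z i - y i) / 12)%:E)%E.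
Proof.
move=> D xx.
have [|r r0 Hr] := @fin_min n (fun i => (x i.+1 - x i) / 2).
  by move=> i /xx h; rewrite divr_gt0// subr_gt0.
have H i : exists yz : R * R, (i <= n)%N ->
    [/\ x i - r < yz.1, yz.1 < yz.2, yz.2 < x i + r, a < yz.1 & yz.2 < b] /\
    (mu ([set t | (u t <> s * (-1) ^+ i)%R] `&` `]yz.1, yz.2[) <= ((yz.2 - yz.1) / 12)%:E)%E.
  have [iN|_] := leqP i n; last by exists (0, 0).
  by have [y [z Hyz]] := D i iN r r0; exists (y, z).
have [yz Hyz] := choice H.
pose y i := (yz i).1; pose z i := (yz i).2.
have [|m1 m10 Hm1] := @fin_min n.+1 (fun i => z i - y i).
  by move=> i /Hyz[[_ h _ _ _] _]; rewrite subr_gt0.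
have [|m2 m20 Hm2] := @fin_min n (fun i => y i.+1 - z i).
  move=> i iN; have [[_ _ h1 _ _] _] := Hyz i (ltnW iN); have [[h2 _ _ _ _] _] := Hyz i.+1 iN.
  have := Hr i iN; rewrite /y /z; clear -h1 h2; lra.
have [[_ _ _ ha _] _] := Hyz 0%N isT; have [[_ _ _ _ hb] _] := Hyz n (leqnn n).
exists y, z, (Num.min (Num.min m1 m2) (Num.min (y 0%N - a) (b - z n))).
split; last by move=> i /Hyz[].
split.
- by rewrite !lt_min m10 m20 !subr_gt0 ha hb.
- by rewrite -lerBrDl !ge_min lexx !orbT.
- by rewrite -lerBrDl !ge_min lexx !orbT.
- by move=> i iN; rewrite -lerBrDl !ge_min Hm1.
- by move=> i iN; rewrite -lerBrDl !ge_min Hm2// !orbT.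
Qed.

Lemma Lp_cvg_near a b p (un : nat -> R -> R) u e : Lp_cvg a b p un u -> 0 < e ->
  \forall n \near \oo, (\int[mu]_(x in `]a, b[) ((`|un n x - u x| `^ p)%:E) < e%:E)%E.
Proof.
move=> H e0; apply: (H [set x | (x < e%:E)%E]).
rewrite /nbhs/=.
have : \forall r \near (0 : R), r < e by exact: lt_nbhsl.
by apply: filterS => r re; rewrite /= lte_fin.
Qed.

Lemma chebyshev_Lp a b p f k : 0 < p -> 0 < k -> measurable_fun `]a, b[ f ->
  ((k `^ p)%:E * mu ([set x | (k < `|f x|)%R] `&` `]a, b[) <=
   \int[mu]_(x in `]a, b[) ((`|f x| `^ p)%:E))%E.
Proof.
move=> p0 k0 mf.
pose S := [set x | k < `|f x|] `&` `]a, b[.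
have mS : measurable S by exact: measurable_superlevel.
have mfp := measurable_normr_powR p mf.
rewrite -/S -integral_cst//.
apply: (@le_trans _ _ (\int[mu]_(x in S) ((`|f x| `^ p)%:E))%E).
  apply: ge0_le_integral.
  - exact: mS.
  - by move=> x _; rewrite lee_fin powR_ge0.
  - exact: measurable_cst.
  - by apply: measurable_funS mfp => //; exact: subIsetr.
  - move=> x [/= kx _]; rewrite lee_fin ge0_ler_powR ?nnegrE ?(ltW p0) ?(ltW k0)//.
    exact: ltW.
apply: ge0_subset_integral; [exact: mS|exact: measurable_itv|exact: mfp| |exact: subIsetr].
by move=> x _; rewrite lee_fin powR_ge0.
Qed.

(** A strict bound on an infimum is realized by some representative, and [u] may be replaced by it
    in the potential term, as they agree a.e. *)
Lemma G_eps_ltP a b p A B e u (c : \bar R) : 0 < e -> Lp a b p u -> (G_eps a b p A B e u < c)%E ->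
  exists v v1 v2, [/\ W2p_rep a b p v v1 v2, Defs.ae_eq a b u v,
    v x @[x --> a^'+] --> A, v x @[x --> b^'-] --> B &
    (energy_eps e a b v v2 < c)%E].
Proof.
move=> e0 [mu_ _] /ereal_inf_lt[_ [v [v1 [v2 [_ [W [uv [vA [vB ->]]]]]]]] Hc].
exists v, v1, v2; split => //.
apply: le_lt_trans Hc; rewrite le_eqVlt; apply/orP; left; apply/eqP.
apply: ge0_ae_eq_integral.
- exact: measurable_itv.
- by apply/measurable_EFinP; exact: measurable_dens_eps W.
- apply/measurable_EFinP; apply: measurable_funD; apply: measurable_funM => //.
    exact: measurable_well.
  apply: measurable_funX; apply: measurableT_comp => //; exact: W2p_measurable2 W.
- by move=> x _; rewrite lee_fin addr_ge0// mulr_ge0 ?sqr_ge0// ?invr_ge0 ?exprn_ge0// ltW.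
- by move=> x _; rewrite lee_fin addr_ge0// mulr_ge0 ?sqr_ge0// ?invr_ge0 ?exprn_ge0// ltW.
apply: negligibleS uv => x /=; rewrite in_itv/= => Hx.
have /not_implyP [xab H] := Hx.
split => //; apply: contra_not H => ->.
by rewrite real_normK ?num_real.
Qed.

Lemma small_const (K1 K2 q d : R) : 0 < K1 -> 0 < K2 -> 0 <= q -> 0 < d ->
  exists2 k, 0 < k & K1 * k <= 1 /\ K2 * k * q <= d.
Proof.
move=> K10 K20 q0 d0.
have q1 : 0 < 1 + q by rewrite ltr_wpDr.
exists (Num.min K1^-1 (d / (1 + q) / K2)).
  by rewrite lt_min invr_gt0 K10 divr_gt0// divr_gt0.
split.
  by rewrite -(@mulfV _ K1) ?gt_eqF// ler_pM2l// ge_min lexx.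
apply: (@le_trans _ _ (K2 * (d / (1 + q) / K2) * q)).
  by rewrite ler_wpM2r// ler_pM2l// ge_min lexx orbT.
rewrite [K2 * _]mulrC divfK ?gt_eqF// -mulrA ler_piMr ?(ltW d0)// mulrC ler_pdivrMr// mul1r.
by rewrite lerDr.
Qed.

(** By contradiction: an energy below [c] would give [T <= (1 + K) c + (n + 2) K], and [k] is chosen
    so small that the right-hand side stays below [T]. *)
Lemma chain_lower a b p (An Bn en : nat -> R) (a0 b0 : R) (un : nat -> R -> R) u s (n : nat) (x : nat -> R) (c : R) :
  1 <= p -> An j @[j --> \oo] --> a0 -> Bn j @[j --> \oo] --> b0 ->
  (forall j, 0 < en j) -> en j @[j --> \oo] --> (0 : R) ->
  Lp a b p u -> (forall j, Lp a b p (un j)) -> Lp_cvg a b p un u -> s ^+ 2 = 1 ->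
  (forall i, (i <= n)%N -> dense_at a b u (s * (-1) ^+ i) (x i)) ->
  (forall i, (i < n)%N -> x i < x i.+1) ->
  c < fine (cost False p (- a0 * s)) + n%:R * fine (cost True p 1)
    + fine (cost False p (- b0 * (s * (-1) ^+ n))) ->
  \forall j \near \oo, (c%:E <= G_eps a b p (An j) (Bn j) (en j) (un j))%E.
Proof.
move=> p1 cA cB en0 ce Lu Lun cu s1 D xx cT.
have p0 : 0 < p by exact: lt_le_trans p1.
have [y [z [m [[m0 ay zb yz zy] muB]]]] := chain_intervals D xx.
(* For [c <= 0] nonnegativity of the energy suffices; afterwards [c] serves as a divisor. *)
have [cn|cp] := leP c 0.
  near=> j; apply: (@le_trans _ _ 0%E); first by rewrite lee_fin.
  apply: le_ereal_inf_tmp => _ [v [v1 [v2 [_ [_ [_ [_ [_ ->]]]]]]]].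
  apply: integral_ge0 => t _.
  by rewrite lee_fin addr_ge0// mulr_ge0 ?sqr_ge0// ?invr_ge0 ?exprn_ge0// ltW.
set T := (X in c < X) in cT.
have dT : 0 < (T - c) / 2 by clear -cT; lra.
have q0 : 0 <= c + (n%:R + 2) by rewrite addr_ge0 ?(ltW cp)// addr_ge0.
have [k k0 [k1 k2]] : exists2 k, 0 < k & 156 * (8 * k) <= 1 /\ 9360 * (8 * k) * (c + (n%:R + 2)) <= (T - c) / 2.
  have K10 : 0 < 156 * 8 :> R by apply: mulr_gt0; exact: ltr0Sn.
  have K20 : 0 < 9360 * 8 :> R by apply: mulr_gt0; exact: ltr0Sn.
  have [k k0] := @small_const _ _ _ _ K10 K20 q0 dT.
  rewrite -[156 * 8 * k]mulrA -[9360 * 8 * k]mulrA => h; exists k; [exact: k0|exact: h].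
have kk0 : 0 < 8 * k by rewrite mulr_gt0.
(* Budget for the bad set: 1/12 of the length where [u] has another value, and [m / 12], again at
   most 1/12 of the length, where [u_n] is farther than [k] from [u]. Together they make the 1/6 of
   [good_point]. *)
have d1 : 0 < k `^ p * (m / 12) by rewrite mulr_gt0 ?powR_gt0 ?divr_gt0.
near=> j.
have HA : `|An j - a0| <= 8 * k.
  rewrite distrC; near: j; move/cvgrPdist_le : cA; exact.
have HB : `|Bn j - b0| <= 8 * k.
  rewrite distrC; near: j; move/cvgrPdist_le : cB; exact.
have He1 : en j <= m / 4.
  have : `|0 - en j| <= m / 4.
    by near: j; move/cvgrPdist_le : ce; apply; rewrite divr_gt0.
  by rewrite sub0r normrN gtr0_norm.
have He2 : en j <= k ^+ 2 * m / (4 * c).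
  have : `|0 - en j| <= k ^+ 2 * m / (4 * c).
    near: j; move/cvgrPdist_le : ce; apply.
    by rewrite divr_gt0 ?mulr_gt0 ?exprn_gt0.
  by rewrite sub0r normrN gtr0_norm.
have Hd : (\int[mu]_(t in `]a, b[) ((`|un j t - u t| `^ p)%:E) < (k `^ p * (m / 12))%:E)%E.
  by near: j; exact: Lp_cvg_near.
rewrite leNgt; apply/negP => /(G_eps_ltP (en0 j) (Lun j)) [v [v1 [v2 [W uv vA vB Hc]]]].
have mun := (Lun j).1; have muu := Lu.1.
have mfd : measurable_fun `]a, b[ (fun t => un j t - u t) by exact: measurable_funB.
have Hch := chebyshev_Lp p0 k0 mfd.
set S := (_ `&` _) in Hch.
have mS : measurable S by exact: measurable_superlevel.
have muS : (mu S <= (m / 12)%:E)%E.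
  rewrite -(@lee_pmul2l _ (k `^ p)%:E) ?lte_fin ?powR_gt0// -EFinM.
  exact: le_trans Hch (ltW Hd).
have [N [mN N0 uvN]] := uv.
have aby i : (i <= n)%N -> `]y i, z i[ `<=` `]a, b[.
  move=> iN; have [ai bi] := chain_in m0 ay zb yz zy iN.
  by move=> t /=; rewrite !in_itv/= => /andP[/(lt_trans ai) -> /lt_trans ->].
have mne (q c' d' : R) : `]c', d'[ `<=` `]a, b[ -> measurable ([set t | u t <> q] `&` `]c', d'[).
  by move=> sub; apply: measurable_neq; exact: measurable_funS muu.
have mvk (q c' d' : R) : `]c', d'[ `<=` `]a, b[ -> measurable ([set t | k < `|v t - q|] `&` `]c', d'[).
  move=> sub; apply: measurable_superlevel; apply: measurable_funB => //.
  by apply: measurable_funS (W2p_measurable W).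
have muB' i : (i <= n)%N -> (mu ([set x | (k < `|v x - s * (-1) ^+ i|)%R] `&` `]y i, z i[) <= ((z i - y i) / 6)%:E)%E.
  move=> iN; have sub := aby i iN.
  apply: (@le_trans _ _ (mu (N `|` (S `|` ([set t | (u t <> s * (-1) ^+ i)%R] `&` `]y i, z i[))))).
    apply: le_measure.
    - by rewrite inE; exact: mvk.
    - by rewrite inE; apply: measurableU => //; apply: measurableU => //; exact: mne.
    move=> t [/= kt tyz].
    have tab := sub _ tyz; have tab' := tab; rewrite /= in_itv/= in tab'.
    have [ut|ut] := pselect (un j t <> v t); first by left; apply: uvN; split.
    have [us|us] := pselect (u t <> s * (-1) ^+ i); first by right; right; split.
    right; left; split => //=.
    by rewrite (contrapT us) (contrapT ut).
  have mX := mne (s * (-1) ^+ i) _ _ sub.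
  apply: (@le_trans _ _ (mu N + (mu S + mu ([set t | (u t <> s * (-1) ^+ i)%R] `&` `]y i, z i[)))%E).
    set X := (_ `&` _).
    have h1 : (mu (S `|` X) <= mu S + mu X)%E by exact: (@measureU2 _ _ _ mu).
    have h2 : (mu (N `|` (S `|` X)) <= mu N + mu (S `|` X))%E.
      by apply: (@measureU2 _ _ _ mu) => //; exact: measurableU.
    by apply: (le_trans h2); apply: leeD2l.
  rewrite N0 add0e.
  apply: (le_trans (leeD muS (muB i iN))); rewrite -EFinD lee_fin.
  by have := yz i iN; clear; lra.
have Hh1 : 4 * en j <= m by clear -He1; lra.
have Hh2 : 4 * c * en j <= k ^+ 2 * m.
  by move: He2; rewrite ler_pdivlMr ?mulr_gt0//; clear; lra.
have := chain_core (ltW p0) (en0 j) k0 k1 s1 m0 W vA vB HA HB (ltW Hc) (ltW cp) Hh1 Hh2 ay zb yz zy muB'.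
rewrite -/T; apply/negP; rewrite -ltNge.
have K0 : 0 <= 9360 * (8 * k).
  by apply: mulr_ge0; [exact: ler0n|exact: ltW].
move: K0 k2; move: (9360 * (8 * k)) => K K0 k2.
apply: (@le_lt_trans _ _ ((1 + K)%:E * c%:E + ((n%:R + 2) * K)%:E)%E).
  apply: leeD => //; apply: lee_wpmul2l; last exact: ltW.
  by rewrite lee_fin addr_ge0.
rewrite -EFinM -EFinD lte_fin.
clear -k2 cT; move: k2; rewrite mulrDr => k2; lra.
Unshelve. all: by end_near. Qed.

(* [p <= 4] enters through [t^4 <= t^p] for [0 <= t <= 1]. *)
Lemma well_limit_bound p x y : 0 < p -> p <= 4 ->
  Num.min 1 `| `|x| - 1| ^+ 4 <= 8 * ((y ^+ 2 - 1) ^+ 2 + `|y - x| `^ p).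
Proof.
move=> p0 p4.
pose A := Num.min 1 `| `|y| - 1|; pose B := Num.min 1 `|y - x|.
have A0 : 0 <= A by rewrite le_min ler01/=.
have B0 : 0 <= B by rewrite le_min ler01/=.
have h0 : 0 <= Num.min 1 `| `|x| - 1| by rewrite le_min ler01/=.
have hAB : Num.min 1 `| `|x| - 1| <= A + B.
  rewrite /A /B; case: (leP 1 `| `|y| - 1|) => h1.
    apply: (@le_trans _ _ 1); first by rewrite ge_min lexx.
    by rewrite lerDl.
  case: (leP 1 `|y - x|) => h2.
    apply: (@le_trans _ _ 1); first by rewrite ge_min lexx.
    by rewrite lerDr.
  rewrite ge_min; apply/orP; right.
  rewrite (_ : `|x| - 1 = (`|y| - 1) + (`|x| - `|y|)); last by ring.
  apply: (le_trans (ler_normD _ _)); rewrite lerD2l.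
  by rewrite [leRHS]distrC; exact: ler_dist_dist.
have hA : A ^+ 4 <= (y ^+ 2 - 1) ^+ 2.
  apply: (@le_trans _ _ (A ^+ 2)).
    by apply: ler_wiXn2l => //; rewrite ge_min lexx.
  apply: (@le_trans _ _ (`| `|y| - 1| ^+ 2)).
    by rewrite lerXn2r ?nnegrE// ge_min lexx orbT.
  rewrite real_normK ?num_real// (_ : y ^+ 2 = `|y| ^+ 2); last by rewrite real_normK ?num_real.
  have := normr_ge0 y; move: `|y| => q q0.
  have -> : (q ^+ 2 - 1) ^+ 2 = (q - 1) ^+ 2 * (q + 1) ^+ 2 by ring.
  by rewrite ler_peMr ?sqr_ge0//; nra.
have hB : B ^+ 4 <= `|y - x| `^ p.
  rewrite /B; have := normr_ge0 (y - x); move: `|y - x| => q.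
  rewrite le_eqVlt => /predU1P[<-|q0].
    by rewrite min_r ?ler01// expr0n/= powR_ge0.
  case: (leP 1 q) => q1.
    by rewrite expr1n -(powRr0 q); exact: ler_powR (ltW p0).
  rewrite -powR_mulrn ?(ltW q0)//; apply: ger_powR => //.
  by rewrite q0 ltW.
apply: (@le_trans _ _ ((A + B) ^+ 4)); first by rewrite lerXn2r ?nnegrE ?addr_ge0.
(* [(A + B)^4 <= 8 (A^4 + B^4)], by applying convexity of the square twice. *)
apply: (@le_trans _ _ (8 * (A ^+ 4 + B ^+ 4))); last by rewrite ler_pM2l ?ltr0n// lerD.
clear; have h1 : (A + B) ^+ 2 <= 2 * (A ^+ 2 + B ^+ 2) by have := sqr_ge0 (A - B); lra.
have h2 : ((A + B) ^+ 2) ^+ 2 <= (2 * (A ^+ 2 + B ^+ 2)) ^+ 2.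
  by rewrite lerXn2r ?nnegrE ?sqr_ge0// mulr_ge0// addr_ge0// sqr_ge0.
have := sqr_ge0 (A ^+ 2 - B ^+ 2); rewrite (_ : (A + B) ^+ 4 = ((A + B) ^+ 2) ^+ 2); last by ring.
by move: h2; lra.
Qed.

(** If [u] is not a sign a.e., the truncated distance [hh] to the wells has integral at least some
    [d > 0]. An energy below [c] puts the potential integral below [en j * c], and for large [j]
    this gives [d < 8 (d / 16 + d / 16) = d]. *)
Lemma well_limit a b p (An Bn en : nat -> R) (un : nat -> R -> R) u (c : R) :
  1 <= p <= 4 -> (forall j, 0 < en j) -> en j @[j --> \oo] --> (0 : R) ->
  Lp a b p u -> (forall j, Lp a b p (un j)) -> Lp_cvg a b p un u ->
  ~ mu.-negligible [set x | a < x < b /\ u x <> 1 /\ u x <> -1] ->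
  \forall j \near \oo, (c%:E <= G_eps a b p (An j) (Bn j) (en j) (un j))%E.
Proof.
move=> /andP[p1 p4] en0 ce Lu Lun cu H.
have p0 : 0 < p by exact: lt_le_trans p1.
pose hh x := Num.min 1 `| `|u x| - 1| ^+ 4.
have hh0 x : 0 <= hh x by rewrite exprn_ge0// le_min ler01/=.
have muu := Lu.1.
have mhh : measurable_fun `]a, b[ hh.
  apply: measurable_funX; apply: measurable_minr => //.
  apply: measurableT_comp => //; apply: measurable_funB => //.
  exact: measurableT_comp.
have [d d0 Hd] : exists2 d : R, 0 < d & (d%:E <= \int[mu]_(x in `]a, b[) (hh x)%:E)%E.
  have : (\int[mu]_(x in `]a, b[) (hh x)%:E)%E != 0%E.
    apply/eqP => I0; apply: H.
    have : (\int[mu]_(x in `]a, b[) `|(hh x)%:E|)%E = 0%E.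
      by rewrite -[RHS]I0; apply: eq_integral => x _; rewrite gee0_abs// lee_fin.
    move/(ae_eq_integral_abs mu (measurable_itv _)) => /(_ _)[]; first exact/measurable_EFinP.
    move=> N [mN N0 sN]; exists N; split => //; apply: subset_trans sN => x /= [xab [u1 u2]] h.
    have := h xab; move=> [] /eqP; rewrite expf_eq0/= => /eqP.
    case: leP => _ //; first by move/eqP; rewrite oner_eq0.
    move/eqP; rewrite normr_eq0 subr_eq0 eqr_norml ler01 andbT => /orP[] /eqP; by [].
  have : (0 <= \int[mu]_(x in `]a, b[) (hh x)%:E)%E by apply: integral_ge0 => x _; rewrite lee_fin.
  case: (\int[mu]_(x in `]a, b[) (hh x)%:E)%E => [r| |]// r0 rn.
    exists r => //; rewrite lt_neqAle; move: r0 rn; rewrite lee_fin eqe => -> h.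
    by rewrite eq_sym h.
  by exists 1 => //; rewrite leey.
near=> j.
rewrite leNgt; apply/negP => /(G_eps_ltP (en0 j) (Lun j)) [v [v1 [v2 [W uv vA vB Hc]]]].
have Hn : (\int[mu]_(t in `]a, b[) ((`|un j t - u t| `^ p)%:E) < (d / 16)%:E)%E.
  by near: j; apply: Lp_cvg_near => //; rewrite divr_gt0.
have He : en j * c < d / 16.
  have : `|0 - en j * c| < d / 16.
    near: j; have : (en j * c) @[j --> \oo] --> (0 : R).
      by rewrite -(mul0r c); apply: cvgM => //; exact: cvg_cst.
    by move/cvgrPdist_lt; apply; rewrite divr_gt0.
  by rewrite sub0r normrN; apply: le_lt_trans; exact: ler_norm.
have mun := (Lun j).1.
have mw : measurable_fun `]a, b[ (fun x => (un j x ^+ 2 - 1) ^+ 2) by exact: measurable_well.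
have mfd : measurable_fun `]a, b[ (fun t => un j t - u t) by exact: measurable_funB.
have mfpE := measurable_normr_powR p mfd.
have mfp : measurable_fun `]a, b[ (fun t => `|un j t - u t| `^ p) by exact/measurable_EFinP.
have I1 : (\int[mu]_(x in `]a, b[) ((un j x ^+ 2 - 1) ^+ 2)%:E <= (en j * c)%:E)%E.
  have mwv := measurable_well (W2p_measurable W).
  have -> : (\int[mu]_(x in `]a, b[) ((un j x ^+ 2 - 1) ^+ 2)%:E = \int[mu]_(x in `]a, b[) ((v x ^+ 2 - 1) ^+ 2)%:E)%E.
    apply: ge0_ae_eq_integral.
    - exact: measurable_itv.
    - exact/measurable_EFinP.
    - exact/measurable_EFinP.
    - by move=> x _; rewrite lee_fin sqr_ge0.
    - by move=> x _; rewrite lee_fin sqr_ge0.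
    - apply: negligibleS uv => x /=; rewrite in_itv/= => /not_implyP [xab h].
      by split => //; apply: contra_not h => ->.
  have -> : (en j * c)%:E = ((en j)%:E * c%:E)%E by [].
  apply: (@le_trans _ _ ((en j)%:E * energy_eps (en j) a b v v2)%E); last first.
    by apply: lee_wpmul2l (ltW Hc); rewrite lee_fin ltW.
  rewrite /energy_eps -ge0_integralZl_EFin; last first.
  - exact: ltW.
  - by apply/measurable_EFinP; exact: measurable_dens_eps W.
  - by move=> x _; rewrite lee_fin addr_ge0// mulr_ge0 ?sqr_ge0// ?invr_ge0 ?exprn_ge0// ltW.
  - exact: measurable_itv.
  apply: ge0_le_integral.
  - exact: measurable_itv.
  - by move=> x _; rewrite lee_fin sqr_ge0.
  - exact/measurable_EFinP.
  - by apply/measurable_EFinP/measurable_funM => //; exact: measurable_dens_eps W.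
  - move=> x _; rewrite -EFinM lee_fin mulrDr mulVKf ?gt_eqF// lerDl.
    by have := ltW (en0 j); move: (en j) => e e0; rewrite mulr_ge0// mulr_ge0 ?sqr_ge0// exprn_ge0.
have : (d%:E <= 8%:E * ((en j * c)%:E + (d / 16)%:E))%E.
  apply: (le_trans Hd).
  apply: (@le_trans _ _ (\int[mu]_(x in `]a, b[) (8%:E * (((un j x ^+ 2 - 1) ^+ 2)%:E + (`|un j x - u x| `^ p)%:E)))%E).
    apply: ge0_le_integral.
    - exact: measurable_itv.
    - by move=> x _; rewrite lee_fin.
    - exact/measurable_EFinP.
    - by apply/measurable_EFinP; apply: measurable_funM => //; exact: measurable_funD.
    - by move=> x _; rewrite -EFinD -EFinM lee_fin; exact: well_limit_bound.
  rewrite ge0_integralZl_EFin; last first.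
  - exact: ler0n.
  - by apply: emeasurable_funD; exact/measurable_EFinP.
  - by move=> x _; rewrite -EFinD lee_fin addr_ge0 ?sqr_ge0 ?powR_ge0.
  - exact: measurable_itv.
  apply: lee_wpmul2l; first by rewrite lee_fin ler0n.
  rewrite ge0_integralD; last first.
  - exact/measurable_EFinP.
  - by move=> x _; rewrite lee_fin powR_ge0.
  - exact/measurable_EFinP.
  - by move=> x _; rewrite lee_fin sqr_ge0.
  - exact: measurable_itv.
  by apply: leeD => //; exact: ltW.
rewrite -EFinD -EFinM lee_fin; clear -He d0; lra.
Unshelve. all: by end_near. Qed.

(** At a Lebesgue density point of the level set, small symmetric intervals contain it in a
    proportion above 11/12, which leaves the 1/12 of [dense_at]. *)
Lemma dense_ae a b u s : measurable_fun `]a, b[ u ->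
  mu.-negligible [set x | a < x < b /\ u x = s /\ ~ dense_at a b u s x].
Proof.
move=> mu_.
pose A := `]a, b[ `&` u @^-1` [set s].
have mA : measurable A by apply: mu_.
have [N [mN N0 sN]] := lebesgue_density mA.
exists N; split => // x [/andP[ax xb] [us nd]]; apply: sN => /= cv; apply: nd => r r0.
have A1 : \1_A x = 1 :> R.
  by rewrite indicE mem_set//; split => //=; rewrite in_itv/= ax.
rewrite A1 in cv.
have near1 : \forall h \near (0 : R)^'+, ((11 / 12)%:E < mu (A `&` ball x h) * (mu (ball x h))^-1)%E.
  apply: (cv [set y | ((11 / 12)%:E < y)%E]).
  rewrite /nbhs/=.
  have : \forall y \near (1 : R), 11 / 12 < y by apply: lt_nbhsr; lra.
  by apply: filterS => y h; rewrite /= lte_fin.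
near (0 : R)^'+ => h.
have h0 : 0 < h by near: h; exact: nbhs_right_gt.
have hr : h < r by near: h; exact: nbhs_right_lt.
have ha : h < x - a by near: h; apply: nbhs_right_lt; rewrite subr_gt0.
have hb : h < b - x by near: h; apply: nbhs_right_lt; rewrite subr_gt0.
have : ((11 / 12)%:E < mu (A `&` ball x h) * (mu (ball x h))^-1)%E by near: h.
have B2 : mu (ball x h) = (h *+ 2)%:E by apply: lebesgue_measure_ball; exact: ltW.
have mB : measurable (ball x h) by exact: measurable_ball.
rewrite B2 inver mulrn_eq0/= gt_eqF// => H1.
exists (x - h), (x + h); split.
  by split; move: h0 hr ha hb; clear; lra.
have E : [set t | u t <> s] `&` `]x - h, x + h[ = ball x h `\` A.
  rewrite ball_itv; apply/seteqP; split => t /=.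
    by move=> [ut tx]; split => // -[].
  move=> [tx nA]; split => // uts; apply: nA; split => //=.
  move: tx; rewrite !in_itv/= => /andP[h1 h2]; apply/andP; split.
    by move: h1 ha; clear; lra.
  by move: h2 hb; clear; lra.
rewrite E.
have : mu (ball x h) = (mu (ball x h `\` A) + mu (ball x h `&` A))%E by exact: (@measureDI _ _ _ mu).
rewrite B2.
have hD : (mu (ball x h `\` A) <= (h *+ 2)%:E)%E.
  by rewrite -B2; apply: le_measure; [rewrite inE; exact: measurableD|rewrite inE; exact: mB|exact: subDsetl].
have hI : (mu (A `&` ball x h) <= (h *+ 2)%:E)%E.
  by rewrite -B2; apply: le_measure; [rewrite inE; exact: measurableI|rewrite inE; exact: mB|exact: subIsetr].
have D0 : (0 <= mu (ball x h `\` A))%E by exact: measure_ge0.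
have I0 : (0 <= mu (A `&` ball x h))%E by exact: measure_ge0.
move: H1 hD hI D0 I0; rewrite setIC.
case: (mu (ball x h `&` A)) => [q| |]//; case: (mu (ball x h `\` A)) => [q'| |]//.
rewrite -EFinM -EFinD !lee_fin lte_fin => H1 _ _ _ _ [] H2.
have h2 : 0 < h *+ 2 by rewrite mulr2n addr_gt0.
move: H1; rewrite ltr_pdivlMr//.
by move: H2; rewrite mulr2n; clear; lra.
Unshelve. all: by end_near. Qed.

(** Built from the left, because [jumps_struct] extends chains by prepending a point of the opposite
    sign. *)
Fixpoint chainable (P : R -> R -> Prop) (n : nat) (s lo hi : R) : Prop :=
  exists2 x : R, lo < x < hi & P s x /\
    (if n is n'.+1 then chainable P n' (- s) x hi else True).

Lemma chainable_first P n s lo hi : chainable P n s lo hi ->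
  exists2 x : R, lo < x < hi & P s x /\ forall y, y < x -> chainable P n s y hi.
Proof.
case: n => [|n] [x xlh [Px H]]; exists x => //; split => // y yx; exists x => //;
  by rewrite yx; case/andP: xlh.
Qed.

Lemma chainable_cons P n s lo hi : forall x : R, lo < x -> P s x ->
  chainable P n (- s) x hi -> chainable P n.+1 s lo hi.
Proof.
move=> x lx Px H; exists x => //; rewrite lx/=.
by have [y /andP[xy yh] _] := chainable_first H; exact: lt_trans yh.
Qed.

Lemma chainable_wide P n s lo lo' hi : lo' <= lo -> chainable P n s lo hi -> chainable P n s lo' hi.
Proof.
move=> ll H; have [x /andP[lx _] [_]] := chainable_first H; apply.
exact: le_lt_trans lx.
Qed.

Lemma chainable_seq P n s lo hi : chainable P n s lo hi -> exists x : nat -> R,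
  [/\ lo < x 0%N, forall i, (i <= n)%N -> P (s * (-1) ^+ i) (x i) & forall i, (i < n)%N -> x i < x i.+1].
Proof.
elim: n s lo => [|n IH] s lo [y /andP[ly yh] [Py H]].
  by exists (fun=> y); split => // -[|]//; rewrite expr0 mulr1.
have [x [x0 xP xx]] := IH _ _ H.
exists (fun i => if i is j.+1 then x j else y); split => //.
- case=> [|i] iN; first by rewrite expr0 mulr1.
  by rewrite exprS mulN1r mulrN -mulNr; exact: xP.
- by case=> [|i] iN //; exact: xx.
Qed.

Lemma sgn_or s x : s ^+ 2 = 1 -> x ^+ 2 = 1 -> x = s \/ x = - s.
Proof.
move=> s1 x1; have : (x - s) * (x + s) = 0 by rewrite -subr_sqr s1 x1 subrr.
move/eqP; rewrite mulf_eq0 subr_eq0 addr_eq0 => /orP[/eqP|/eqP]; [left|right]; done.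
Qed.

Definition jumps a b u s (n : nat) (t : nat -> R) : Prop :=
  [/\ t 0%N = a, t n.+1 = b, forall i, (i <= n)%N -> t i < t i.+1 &
    forall i, (i <= n)%N -> Defs.ae_eq (t i) (t i.+1) u (fun=> s * (-1) ^+ i)].

(** The density feeds the energy bound, the value identifies [u] almost everywhere. *)
Definition sign_at a b u s x := dense_at a b u s x /\ u x = s.

Lemma ae_eq_union a b c u v : Defs.ae_eq a c u v -> Defs.ae_eq c b u v -> Defs.ae_eq a b u v.
Proof.
move=> h1 h2; pose Z : set R := [set c] `|` ([set x | a < x < c /\ u x <> v x] `|` [set x | c < x < b /\ u x <> v x]).
have Z0 : mu.-negligible Z.
  apply: negligibleU; last exact: negligibleU.
  by exists [set c]; split => //; exact: lebesgue_measure_set1.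
apply: negligibleS Z0.
move=> x [/andP[ax xb] uv]; have [xc|cx|->] := ltgtP x c.
- by right; left; split => //; rewrite ax.
- by right; right; split => //; rewrite cx.
- by left.
Qed.

Lemma pick_dense a b u s y z (N : set R) : measurable_fun `]a, b[ u -> y < z -> a <= y -> z <= b ->
  (mu ([set t | u t <> s] `&` `]y, z[) <= ((z - y) / 12)%:E)%E -> mu.-negligible N ->
  exists2 t : R, y < t < z & u t = s /\ ~ N t.
Proof.
move=> muu yz ay zb H [A [mA A0 NA]]; apply: contrapT => no.
have mS : measurable ([set t | u t <> s] `&` `]y, z[).
  apply: measurable_neq; apply: measurable_funS muu => // t /=.
  by rewrite !in_itv/= => /andP[/(le_lt_trans ay) -> /lt_le_trans ->].
have : (mu `]y, z[ <= mu (A `|` ([set t | u t <> s] `&` `]y, z[)))%E.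
  apply: le_measure; rewrite ?inE//; first exact: measurableU.
  move=> t /= tyz; have [ts|ts] := pselect (u t = s); last by right.
  left; apply: NA; apply: contrapT => nN; apply: no; exists t => //.
have h1 : (mu (A `|` ([set t | u t <> s] `&` `]y, z[)) <= mu A + mu ([set t | u t <> s] `&` `]y, z[))%E.
  by apply: (@measureU2 _ _ _ mu).
move/le_trans => /(_ _ h1); rewrite A0 add0e => /le_trans/(_ H).
by rewrite lebesgue_measure_itv/= lte_fin yz -EFinB lee_fin; move: yz; clear; lra.
Qed.

Lemma dense_at_pick a b u s c d x (N : set R) : measurable_fun `]a, b[ u -> c < x < d ->
  dense_at a b u s x -> mu.-negligible N -> exists2 t : R, c < t < d & u t = s /\ ~ N t.
Proof.
move=> muu /andP[cx xd] D N0.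
have [|y [z [[h1 yz h2 ay zb] H]]] := D (Num.min (x - c) (d - x)); first by rewrite lt_min !subr_gt0 cx.
have [t /andP[yt tz] ut] := pick_dense muu yz (ltW ay) (ltW zb) H N0.
exists t => //; apply/andP; split.
  apply: lt_trans yt; apply: le_lt_trans h1; rewrite lerBrDr -lerBrDl.
  by rewrite ge_min lexx.
apply: (lt_trans tz); apply: (lt_le_trans h2); rewrite -lerBrDl.
by rewrite ge_min lexx orbT.
Qed.

(* Induction on [N]: the first jump is the supremum [T] of the [x] such that only
   one sign occurs on [lo, x]; a chain beyond [T] can be extended to the left. *)
Lemma jumps_struct a b u (N : nat) : measurable_fun `]a, b[ u ->
  mu.-negligible [set x | a < x < b /\ ~ (sign_at a b u 1 x \/ sign_at a b u (-1) x)] ->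
  forall lo hi : R, a <= lo -> lo < hi -> hi <= b ->
  (forall s : R, s ^+ 2 = 1 -> ~ chainable (sign_at a b u) N s lo hi) ->
  exists (n : nat) (s : R) (t : nat -> R), s ^+ 2 = 1 /\ jumps lo hi u s n t.
Proof.
move=> muu HD.
have pick (c d : R) : a <= c -> c < d -> d <= b ->
    exists2 x : R, c < x < d & exists2 s : R, s ^+ 2 = 1 & sign_at a b u s x.
  move=> ac cd db; have [x xcd h] := negligible_itv HD cd.
  exists x => //; have [[Px|Px]|no] := pselect (sign_at a b u 1 x \/ sign_at a b u (-1) x).
  - by exists 1 => //; rewrite expr1n.
  - by exists (-1) => //; rewrite sqrrN expr1n.
  - exfalso; apply: h; split => //.
    by have /andP[cx xd] := xcd; rewrite (le_lt_trans ac cx) (lt_le_trans xd db).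
have single (c d s : R) : a <= c -> d <= b -> s ^+ 2 = 1 ->
    (forall x, c < x < d -> ~ sign_at a b u (- s) x) -> Defs.ae_eq c d u (fun=> s).
  move=> ac db s1 no; apply: negligibleS HD => x [/andP[cx xd] us]; split.
    by rewrite (le_lt_trans ac cx) (lt_le_trans xd db).
  have nos : ~ sign_at a b u (- s) x by apply: no; rewrite cx.
  have nos' : ~ sign_at a b u s x by case.
  have [E|E] := @sgn_or s 1 s1 (expr1n _ _).
    by rewrite -E in nos nos' => -[].
  have E' : s = -1 by rewrite E opprK.
  by rewrite -E in nos; rewrite E' in nos' => -[].
elim: N => [|N IH] lo hi alo lohi hib H.
  have [x xlh [s s1 Px]] := pick lo hi alo lohi hib.
  by exfalso; apply: (H s s1); exists x.
(* Either some sign is absent from the whole interval, and there is no jump, or both occur. *)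
have [[s s1 Hs]|two] := pselect (exists2 s : R, s ^+ 2 = 1 & forall x, lo < x < hi -> ~ sign_at a b u (- s) x).
  exists 0%N, s, (fun i => if i is 0%N then lo else hi); split => //; split => //.
    by case.
  by case=> // _; rewrite expr0 mulr1; exact: single.
(* If both signs occurred arbitrarily close to [lo], prepending points would build alternating
   chains of every length. *)
have [s [x [s1 xlh Hx]]] : exists s x : R, [/\ s ^+ 2 = 1, lo < x < hi &
    forall y, lo < y < x -> ~ sign_at a b u (- s) y].
  apply: contrapT => no.
  have both (s x : R) : s ^+ 2 = 1 -> lo < x < hi -> exists2 y, lo < y < x & sign_at a b u s y.
    move=> s1 xlh; apply: contrapT => no'; apply: no; exists (- s), x; split => //.
      by rewrite sqrrN.
    by move=> y yx; rewrite opprK => Py; apply: no'; exists y.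
  have all n : forall s : R, s ^+ 2 = 1 -> chainable (sign_at a b u) n s lo hi.
    elim: n => [|n IHn] s s1.
      have [|y /andP[ly yx] Py] := both s ((lo + hi) / 2) s1; first by apply/andP; split; move: lohi; clear; lra.
      by exists y => //; rewrite ly (lt_trans yx)//; move: lohi; clear; lra.
    have [|q /andP[lq qh] [_ Hq]] := chainable_first (IHn (- s) _); first by rewrite sqrrN.
    have [|y /andP[ly yq] Py] := both s q s1; first by rewrite lq.
    exact: (chainable_cons ly Py (Hq _ yq)).
  by apply: (H 1); [rewrite expr1n|apply: all; rewrite expr1n].
(* An occurrence of [- s] bounds [E], so that its supremum lies strictly inside the interval. *)
have [q qlh Pq] : exists2 q, lo < q < hi & sign_at a b u (- s) q.
  apply: contrapT => no; apply: two; exists s => // y ylh Py; apply: no; by exists y.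
pose E := [set x | lo < x < hi /\ forall y, lo < y < x -> ~ sign_at a b u (- s) y].
have Ex : E x by [].
have ubq y : E y -> y <= q.
  move=> [/andP[_ _] Ey]; rewrite leNgt; apply/negP => qy; apply: (Ey q) => //.
  by case/andP: qlh => ->.
have hsE : has_sup E by split; [exists x|exists q => y; exact: ubq].
pose T := sup E.
have xT : x <= T by apply: ub_le_sup => //; exact: hsE.2.
have Tq : T <= q by apply: ge_sup => //; exists x.
have loT : lo < T by case/andP: xlh => h _; exact: lt_le_trans xT.
have Thi : T < hi by case/andP: qlh => _; exact: le_lt_trans.
have noT y : lo < y < T -> ~ sign_at a b u (- s) y.
  move=> /andP[ly yT] Py.
  have e0 : 0 < T - y by rewrite subr_gt0.
  have [z [zlh Ez]] := sup_adherent e0 hsE; rewrite subKr => yz.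
  by apply: (Ez y) => //; rewrite ly.
(* [- s] occurs arbitrarily close to [T] on its right, possibly at [T] itself. *)
have withT z : T < z < hi -> exists2 w, T <= w < z & sign_at a b u (- s) w.
  move=> /andP[Tz zh]; apply: contrapT => no.
  have : E z.
    split; first by rewrite (lt_trans loT).
    move=> y /andP[ly yz] Py; have [yT|Ty] := ltP y T; first by apply: (noT y) => //; rewrite ly.
    by apply: no; exists y => //; rewrite Ty.
  by move/(ub_le_sup hsE.2); rewrite leNgt Tz.
have [p ploT Pp] : exists2 p, lo < p < T & sign_at a b u s p.
  have [p plT [s' s'1 Pp]] := pick lo T alo loT (le_trans (ltW Thi) hib).
  exists p => //; have [<-//|E'] := sgn_or s1 s'1.
  by exfalso; apply: (noT p plT); rewrite -E'.
have [lop pT] := andP ploT.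
have sT : Defs.ae_eq lo T u (fun=> s) by apply: single => //; exact: (le_trans (ltW Thi) hib).
have [||n [s' [t [s'1 [t0 tn tt tu]]]]] := IH T hi _ Thi hib.
- exact: le_trans (ltW loT).
(* A chain beyond [T] that starts with [s] is preceded by a point of sign [- s] close to [T]; one
   that starts with [- s] is preceded by [p]. Either way it reaches the forbidden length. *)
- move=> s' s'1 C; have [E'|E'] := sgn_or s1 s'1; subst s'.
    have [z /andP[Tz zh] [_ Cz]] := chainable_first C.
    have [|w /andP[Tw wz] Pw] := withT z; first by rewrite Tz.
    apply: (H (- s)); first by rewrite sqrrN.
    apply: (chainable_cons (lt_le_trans loT Tw) Pw); rewrite opprK; exact: Cz.
  apply: (H s s1); apply: (chainable_cons lop Pp).
  exact: chainable_wide (ltW pT) C.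
have [E'|E'] := sgn_or s1 s'1; subst s'.
  (* If the sign after [T] were again [s], then [u = s] a.e. on []lo, t 1[], although a density
     point of sign [- s] lies inside. *)
  exfalso.
  have := tu 0%N isT; rewrite t0 expr0 mulr1 => u1.
  have Tt : T < t 1%N by rewrite -t0; exact: tt.
  have u2 : Defs.ae_eq lo (t 1%N) u (fun=> s) by exact: ae_eq_union sT u1.
  have t1h : t 1%N <= hi.
    have : forall i, (i <= n)%N -> t (n - i).+1 <= hi.
      elim=> [|i IHi] ni; first by rewrite subn0 tn.
      apply: le_trans (IHi (ltnW ni)); rewrite subnSK//; exact: ltW (tt _ (leq_subr _ _)).
    by move/(_ n (leqnn n)); rewrite subnn.
  have [|w /andP[Tw wz] [Dw _]] := withT ((T + t 1%N) / 2).
    by apply/andP; split; move: Tt t1h; clear; lra.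
  have [|z zz [uz]] := dense_at_pick muu (_ : lo < w < t 1%N) Dw u2.
    by rewrite (lt_le_trans loT Tw)/=; move: wz Tt; clear; lra.
  apply; split => //; rewrite uz => /eqP; rewrite eq_sym -subr_eq0 opprK -mulr2n mulrn_eq0/= => /eqP s0.
  by move: s1; rewrite s0 expr0n/= => /eqP; rewrite eq_sym oner_eq0.
exists n.+1, s, (fun i => if i is j.+1 then t j else lo); split => //; split => //.
  by case=> [|i] iN; [rewrite t0|exact: tt].
case=> [|i] iN; first by rewrite t0 expr0 mulr1.
by rewrite exprS mulN1r mulrN -mulNr; exact: tu.
Qed.

End LowerBound.

(** * Step functions: essential variation and value of the limit functional *)

Section Structure.
Context {R : realType}.
Local Notation mu := (@lebesgue_measure R).
Implicit Types (f g v w u : R -> R) (a b c d x y z m l p k M e r s L E h C A B : R) (t : nat -> R).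

Lemma sign_ae a b u : measurable_fun `]a, b[ u ->
  mu.-negligible [set x | a < x < b /\ u x <> 1 /\ u x <> -1] ->
  mu.-negligible [set x | a < x < b /\ ~ (sign_at a b u 1 x \/ sign_at a b u (-1) x)].
Proof.
move=> muu H1.
have H2 := negligibleU H1 (negligibleU (dense_ae 1 muu) (dense_ae (-1) muu)).
apply: negligibleS H2 => x [xab no].
have [u1|u1] := pselect (u x = 1).
  by right; left; split => //; split => // D; apply: no; left.
have [u2|u2] := pselect (u x = -1).
  by right; right; split => //; split => // D; apply: no; right.
by left.
Qed.

Lemma sign_jump s (i : nat) : s ^+ 2 = 1 -> `|s * (-1) ^+ i.+1 - s * (-1) ^+ i| = 2.
Proof.
move=> s1; have sn := normr_sign1 s1.
by rewrite exprS mulN1r mulrN -opprD normrN -mulr2n normrMn normrM sn mul1r normrX normrN1 expr1n.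
Qed.

(** On each interval of the chain the exceptional sets leave a point where [v] has the predominant
    sign; consecutive signs differ by 2. *)
Lemma var_chain a b u v s (n : nat) (x : nat -> R) : measurable_fun `]a, b[ u -> s ^+ 2 = 1 ->
  (forall i, (i <= n)%N -> dense_at a b u (s * (-1) ^+ i) (x i)) ->
  (forall i, (i < n)%N -> x i < x i.+1) -> Defs.ae_eq a b u v ->
  (((2 * n)%:R)%:E <= Var a b v)%E.
Proof.
move=> muu s1 D xx uv.
have [y [z [m [[m0 ay zb yz zy] muB]]]] := chain_intervals D xx.
have H i : exists q : R, (i <= n)%N -> y i < q < z i /\ v q = s * (-1) ^+ i.
  have [iN|_] := leqP i n; last by exists 0.
  have [ai bi] := chain_in m0 ay zb yz zy iN.
  have yzi : y i < z i by move: (yz i iN) m0; clear; lra.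
  have [q /andP[yq qz] [uq nq]] := pick_dense muu yzi (ltW ai) (ltW bi) (muB i iN) uv.
  exists q => _; split; first by rewrite yq.
  rewrite -uq; apply: contrapT => h; apply: nq; split; last by move=> h'; apply: h.
  by rewrite (lt_trans ai yq) (lt_trans qz bi).
have [q Hq] := choice H.
apply: ereal_sup_ubound; exists n, q; split; last split.
- move=> i iN; have [ai bi] := chain_in m0 ay zb yz zy iN.
  by have [/andP[yq qz] _] := Hq i iN; rewrite (lt_trans ai yq) (lt_trans qz bi).
- move=> i iN; have [/andP[_ h1] _] := Hq i (ltnW iN); have [/andP[h2 _] _] := Hq i.+1 iN.
  by move: (zy i iN) m0 h1 h2; clear; lra.
- congr EFin; rewrite (eq_bigr (fun=> 2)); last first.
    move=> i _; have [_ ->] := Hq i.+1 (ltn_ord i); have [_ ->] := Hq i (ltnW (ltn_ord i)).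
    exact: sign_jump.
  by rewrite sumr_const card_ord natrM mulr_natr.
Qed.

Lemma incr_lt (n : nat) t i j : (forall i, (i <= n)%N -> t i < t i.+1) ->
  (i < j)%N -> (j <= n.+1)%N -> t i < t j.
Proof.
move=> TT; elim: j => // j IH; rewrite ltnS leq_eqVlt => /predU1P[->|ij] jn; first exact: TT.
by apply: lt_trans (IH ij (ltnW jn)) _; exact: TT.
Qed.

Lemma incr_le (n : nat) t i j : (forall i, (i <= n)%N -> t i < t i.+1) ->
  (i <= j)%N -> (j <= n.+1)%N -> t i <= t j.
Proof.
by move=> TT; rewrite leq_eqVlt => /predU1P[->//|ij] jn; apply: ltW; exact: (incr_lt TT).
Qed.

Lemma jumps_le a b u s (n : nat) t i j : jumps a b u s n t -> (i <= j)%N -> (j <= n.+1)%N -> t i <= t j.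
Proof. by move=> [_ _ tt _]; exact: incr_le. Qed.

Lemma jumps_in a b u s (n : nat) t i : jumps a b u s n t -> (i <= n.+1)%N -> a <= t i <= b.
Proof.
move=> J iN; have [ta tb _ _] := J.
by rewrite -[X in X <= _]ta -[X in _ && (_ <= X)]tb (jumps_le J)//= (jumps_le J).
Qed.

Lemma jumps_dense a b u s (n : nat) t i x : jumps a b u s n t -> (i <= n)%N -> t i < x < t i.+1 ->
  dense_at a b u (s * (-1) ^+ i) x.
Proof.
move=> J iN /andP[tx xt] r r0.
have /andP[at_ _] := jumps_in J (leqW iN); have /andP[_ tb] := jumps_in J (iN : (i.+1 <= n.+1)%N).
pose h := Num.min r (Num.min (x - t i) (t i.+1 - x)) / 2.
have h0 : 0 < h by rewrite divr_gt0// !lt_min r0 !subr_gt0 tx.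
have h1 : 2 * h <= r by rewrite /h mulrC divfK// ge_min lexx.
have h2 : 2 * h <= x - t i by rewrite /h mulrC divfK// !ge_min lexx orbT.
have h3 : 2 * h <= t i.+1 - x by rewrite /h mulrC divfK// !ge_min lexx !orbT.
exists (x - h), (x + h); split.
  by split; move: h0 h1 h2 h3 at_ tb; clear; lra.
have [_ _ _ /(_ i iN) [N [mN N0 sN]]] := J.
apply: (@le_trans _ _ (mu N)); last first.
  by rewrite N0 lee_fin; move: h0; clear; lra.
apply: le_outer_measure => q /= [uq]; rewrite in_itv/= => /andP[q1 q2].
apply: sN; split => //; apply/andP; split; by move: q1 q2 h0 h2 h3; clear; lra.
Qed.

Lemma jumps_chain a b u s (n : nat) t : jumps a b u s n t -> exists x : nat -> R,
  (forall i, (i <= n)%N -> dense_at a b u (s * (-1) ^+ i) (x i)) /\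
  (forall i, (i < n)%N -> x i < x i.+1).
Proof.
move=> J; have [_ _ tt _] := J; exists (fun i => (t i + t i.+1) / 2); split => i iN.
  apply: (jumps_dense J iN); have := tt i iN; clear => h; apply/andP; split; lra.
by have := tt i (ltnW iN); have := tt i.+1 iN; clear; lra.
Qed.

Definition cnt (n : nat) t x : nat := (\sum_(j < n) (t j.+1 < x)%R)%N.
(** A representative of minimal variation. At a knot it keeps the value from the left, since [cnt]
    counts the knots strictly before [x]. *)
Definition stepf s (n : nat) t x : R := s * (-1) ^+ cnt n t x.

Lemma stepf_sqr s (n : nat) t x : s ^+ 2 = 1 -> stepf s n t x ^+ 2 = 1.
Proof. by move=> s1; rewrite exprMn s1 mul1r sqrr_sign. Qed.

Lemma cnt_le (n : nat) t x y : x <= y -> (cnt n t x <= cnt n t y)%N.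
Proof.
move=> xy; apply: leq_sum => j _; case: (ltP (t j.+1) x) => // h.
by rewrite (lt_le_trans h xy).
Qed.

Lemma cnt_jumps a b u s (n : nat) t i x : jumps a b u s n t -> (i <= n)%N -> t i < x < t i.+1 ->
  cnt n t x = i.
Proof.
move=> J iN /andP[tx xt]; rewrite /cnt (eq_bigr (fun j : 'I_n => (j < i)%N : nat)); last first.
  move=> j _; congr nat_of_bool; have [ji|ij] := ltnP j i.
    by rewrite (le_lt_trans _ tx)// (jumps_le J)// leqW.
  apply/negbTE; rewrite -leNgt; apply: le_trans (ltW xt) _.
  by apply: (jumps_le J) => //; exact: leqW (ltn_ord j).
rewrite -(big_mkord predT (fun j => (j < i)%N : nat)) (big_cat_nat _ iN)//=.
rewrite (@eq_big_nat _ _ _ 0 i _ (fun=> 1%N)); last by move=> j /andP[_ ->].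
rewrite sum_nat_const_nat subn0 muln1 big_nat_cond big1 ?addn0// => j /andP[/andP[ij _] _].
by rewrite ltnNge ij.
Qed.

Lemma stepf_jumps a b u s (n : nat) t i x : jumps a b u s n t -> (i <= n)%N -> t i < x < t i.+1 ->
  stepf s n t x = s * (-1) ^+ i.
Proof. by move=> J iN tx; rewrite /stepf (cnt_jumps J iN tx). Qed.

Lemma stepf_ae a b u s (n : nat) t : jumps a b u s n t -> Defs.ae_eq a b u (stepf s n t).
Proof.
move=> J; have [ta tb tt tu] := J.
have H i : (i <= n)%N -> Defs.ae_eq (t i) (t i.+1) u (stepf s n t).
  move=> iN; apply: negligibleS (tu i iN) => x [tx us]; split => //.
  by rewrite -(stepf_jumps J iN tx).
rewrite -ta -tb.
suff K (k : nat) : (k <= n)%N -> Defs.ae_eq (t 0%N) (t k.+1) u (stepf s n t) by exact: K.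
elim: k => [|k IH] kn; first exact: H.
by apply: ae_eq_union (IH (ltnW kn)) (H _ kn).
Qed.

Lemma sign_exp_dist (i j : nat) s : s ^+ 2 = 1 -> (i <= j)%N ->
  `|s * (-1) ^+ j - s * (-1) ^+ i| <= 2 * (j%:R - i%:R) :> R.
Proof.
move=> s1; elim: j => [|j IH]; first by rewrite leqn0 => /eqP ->; rewrite !subrr normr0 mulr0.
rewrite leq_eqVlt => /predU1P[->|/IH h]; first by rewrite !subrr normr0 mulr0.
have := ler_distD (s * (-1) ^+ j) (s * (-1) ^+ j.+1) (s * (-1) ^+ i).
by rewrite sign_jump// -[j.+1%:R]natr1; move: h; clear; lra.
Qed.

(** [cnt] is nondecreasing with values between 0 and [n], and each unit of increase contributes at
    most 2, so the sum telescopes. *)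
Lemma stepf_Var a b s (n : nat) t : s ^+ 2 = 1 -> (Var a b (stepf s n t) <= ((2 * n)%:R)%:E)%E.
Proof.
move=> s1; apply: ge_ereal_sup => _ [m [x [xab [xx ->]]]]; rewrite lee_fin.
apply: (@le_trans _ _ (\sum_(i < m) 2 * ((cnt n t (x i.+1))%:R - (cnt n t (x i))%:R))).
  apply: ler_sum => i _; apply: sign_exp_dist => //; apply: cnt_le; exact: ltW (xx i (ltn_ord i)).
rewrite -mulr_sumr natrM ler_pM2l//.
rewrite -(big_mkord predT (fun i => (cnt n t (x i.+1))%:R - (cnt n t (x i))%:R)).
rewrite telescope_sumr// lerBlDr -natrD ler_nat.
apply: (@leq_trans n); last exact: leq_addr.
by rewrite -{2}(card_ord n) -sum1_card; apply: leq_sum => j _; case: (_ < _).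
Qed.

Lemma essVar_jumps a b u s (n : nat) t : measurable_fun `]a, b[ u -> s ^+ 2 = 1 ->
  jumps a b u s n t -> essVar a b u = ((2 * n)%:R)%:E /\ Var a b (stepf s n t) = ((2 * n)%:R)%:E.
Proof.
move=> muu s1 J; have [x [D xx]] := jumps_chain J.
have h1 : (((2 * n)%:R)%:E <= essVar a b u)%E.
  by apply: le_ereal_inf_tmp => _ [v uv <-]; exact: (var_chain muu s1 D xx uv).
have h2 : (essVar a b u <= Var a b (stepf s n t))%E.
  by apply: ereal_inf_lbound; exists (stepf s n t) => //; exact: stepf_ae.
have h3 := stepf_Var a b n t s1.
by split; apply/eqP; rewrite eq_le ?h1 ?h3 ?(le_trans h2 h3) ?(le_trans h1 h2).
Qed.

Lemma cvg_right_ae c d v k l : c < d -> Defs.ae_eq c d v (fun=> k) ->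
  v x @[x --> c^'+] --> l -> l = k.
Proof.
move=> cd vk vl; apply: contrapT => lk.
have e0 : 0 < `|l - k| by rewrite normr_gt0 subr_eq0; exact/eqP.
have H : \forall x \near c^'+, `|l - v x| < `|l - k| by move/cvgrPdist_lt : vl; apply.
have [d' d'0 Hd] : exists2 d', 0 < d' & forall x, c < x < c + d' -> `|l - v x| < `|l - k|.
  move: H; rewrite /at_right near_withinE => /nbhs_ballP[d' /= d'0 Hd]; exists d' => // x /andP[cx xd].
  by apply: Hd => //; rewrite /ball/= distrC ger0_norm ?subr_ge0 ?(ltW cx)// ltrBlDl.
have [|x /andP[cx xm] nx] := negligible_itv vk (_ : c < Num.min d (c + d')).
  by rewrite lt_min cd ltrDl.
move: xm; rewrite lt_min => /andP[xd xd'].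
have := Hd x; rewrite cx xd' => /(_ isT).
have -> : v x = k by apply: contrapT => h; apply: nx; split => //; rewrite cx xd.
by rewrite ltxx.
Qed.

Lemma cvg_left_ae c d v k l : c < d -> Defs.ae_eq c d v (fun=> k) ->
  v x @[x --> d^'-] --> l -> l = k.
Proof.
move=> cd vk vl; apply: contrapT => lk.
have e0 : 0 < `|l - k| by rewrite normr_gt0 subr_eq0; exact/eqP.
have H : \forall x \near d^'-, `|l - v x| < `|l - k| by move/cvgrPdist_lt : vl; apply.
have [d' d'0 Hd] : exists2 d', 0 < d' & forall x, d - d' < x < d -> `|l - v x| < `|l - k|.
  move: H; rewrite /at_left near_withinE => /nbhs_ballP[d' /= d'0 Hd]; exists d' => // x /andP[cx xd].
  by apply: Hd => //; rewrite /ball/= ger0_norm ?subr_ge0 ?(ltW xd)// ltrBlDr -ltrBlDl.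
have [|x /andP[xm xd] nx] := negligible_itv vk (_ : Num.max c (d - d') < d).
  by rewrite gt_max cd gtrBl.
move: xm; rewrite gt_max => /andP[cx xd'].
have := Hd x; rewrite xd xd' => /(_ isT).
have -> : v x = k by apply: contrapT => h; apply: nx; split => //; rewrite cx xd.
by rewrite ltxx.
Qed.

Lemma cvg_right_const c d v k : c < d -> (forall x, c < x < d -> v x = k) -> v x @[x --> c^'+] --> k.
Proof.
move=> cd vk; apply: cvg_near_cst; have := near_right_itv cd; apply: filterS => x; exact: vk.
Qed.

Lemma cvg_left_const c d v k : c < d -> (forall x, c < x < d -> v x = k) -> v x @[x --> d^'-] --> k.
Proof.
move=> cd vk; apply: cvg_near_cst; have := near_left_itv cd; apply: filterS => x; exact: vk.
Qed.

Lemma sgr_sign s : s ^+ 2 = 1 -> Num.sg s = s.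
Proof.
move=> s1; have [->|->] := sgn_or (expr1n _ 2) s1; [exact: sgr1|exact: sgrN1].
Qed.

Lemma alpha_beta p (n : nat) (x y : R) : 0 <= p ->
  (alpha p * ((2 * n)%:R)%:E + beta p x + beta p y)%E =
  (fine (cost False p x) + n%:R * fine (cost True p 1) + fine (cost False p y))%:E.
Proof.
move=> p0; rewrite /alpha /beta infJE !infJ'E.
rewrite EFinD EFinD [X in _ = (_ + X + _)%E]EFinM !fineK ?cost_fin_num// /cost /kappa.
have : inf_Phi True p 1 \is a fin_num by rewrite ge0_fin_numE ?inf_Phi_ge0//; exact: inf_Phi_lty.
case: (inf_Phi True p 1) => // r _.
rewrite [X in (X + _)%E = _]addeC; congr (_ + _ + _)%E.
by rewrite -!EFinM natrM; congr EFin; field; rewrite gt_eqF// powR_gt0.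
Qed.

(** The infimum in [G_lim] runs over a single value: agreement with [u] a.e. forces the end limits
    to be the first and the last sign, and [stepf] shows that an admissible representative
    exists. *)
Lemma G_lim_jumps a b p a0 b0 u s (n : nat) t : 1 <= p -> Lp a b p u -> s ^+ 2 = 1 ->
  jumps a b u s n t ->
  G_lim a b p a0 b0 u = (fine (cost False p (- a0 * s)) + n%:R * fine (cost True p 1)
    + fine (cost False p (- b0 * (s * (-1) ^+ n))))%:E.
Proof.
move=> p1 Lu s1 J; have [muu _] := Lu.
have p0 : 0 <= p by exact: le_trans p1.
have [eV sV] := essVar_jumps muu s1 J.
have uv := stepf_ae J.
have [ta tb tt tu] := J.
have sn : (s * (-1) ^+ n) ^+ 2 = 1 by rewrite exprMn s1 mul1r sqrr_sign.
have B : BPV a b p u.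
  split => //; last by rewrite eV ltry.
  apply: negligibleS uv => x [xab [u1 u2]]; split => // E.
  have [] := sgn_or (expr1n _ 2) (stepf_sqr n t x s1); by rewrite -E.
rewrite -alpha_beta//; apply/eqP; rewrite eq_le; apply/andP; split.
  apply: ereal_inf_lbound; exists (stepf s n t), s, (s * (-1) ^+ n).
  do 3 (split; first by rewrite ?eV).
  split; last split; last by rewrite eV !sgr_sign.
    rewrite -{1}ta; apply: (cvg_right_const (tt 0%N isT)) => x tx.
    by rewrite (stepf_jumps J _ tx)// expr0 mulr1.
  rewrite -{1}tb; apply: (cvg_left_const (tt n (leqnn n))) => x tx.
  by rewrite (stepf_jumps J _ tx).
apply: le_ereal_inf_tmp => _ [v [la [lb [_ [uv' [_ [vl [vr ->]]]]]]]].
have vu i : (i <= n)%N -> Defs.ae_eq (t i) (t i.+1) v (fun=> s * (-1) ^+ i).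
  move=> iN; have /andP[h1 _] := jumps_in J (leqW iN); have /andP[_ h2] := jumps_in J (iN : (i.+1 <= n.+1)%N).
  have h3 := negligibleU (tu i iN) uv'; apply: negligibleS h3 => x [/andP[tx xt] vx].
  have [ux|ux] := pselect (u x = s * (-1) ^+ i).
    right; split; first by rewrite (le_lt_trans h1 tx) (lt_le_trans xt h2).
    by rewrite ux => h; apply: vx.
  by left; split => //; rewrite tx.
have -> : la = s.
  rewrite -ta in vl; have := cvg_right_ae (tt 0%N isT) (vu 0%N isT) vl.
  by rewrite expr0 mulr1.
have -> : lb = s * (-1) ^+ n.
  by rewrite -tb in vr; have := cvg_left_ae (tt n (leqnn n)) (vu n (leqnn n)) vr.
by rewrite eV !sgr_sign// addeAC.
Qed.

End Structure.

(** * Recovery sequences and the two Gamma inequalities *)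

Section GammaLimit.
Context {R : realType}.
Local Notation mu := (@lebesgue_measure R).
Implicit Types (f g v w u : R -> R) (a b c d x y z m l p k M e r s L E h C A B q : R) (t T : nat -> R).

Lemma energy_eps1 c d v (v2 : R -> R) : energy_eps 1 c d v v2 = energy c d v v2.
Proof. by apply: eq_integral => x _; rewrite invr1 mul1r expr1n mul1r. Qed.

(** [l] is 1 or -1: translations and reflections leave the energy unchanged. *)
Lemma place_aux p q s c m l w w1 w2 M : l ^+ 2 = 1 -> s ^+ 2 = 1 ->
  (forall y, (c < y < c + q) = (0 < affine m l y < q)) -> W2p_rep 0 q p w w1 w2 ->
  (forall y, 0 < y < q -> `|w y| <= M) ->
  let W := fun y => s * w (affine m l y) in
  let W1 := fun y => s * (l * w1 (affine m l y)) in
  let W2 := fun y => s * (l ^+ 2 * w2 (affine m l y)) in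
  [/\ W2p_rep c (c + q) p W W1 W2, energy c (c + q) W W2 = energy 0 q w w2 &
    forall y, c < y < c + q -> `|W y| <= M].
Proof.
move=> l1 s1 H Ww wM W W1 W2.
have l0 : l != 0 by rewrite -sqrf_eq0 l1 oner_eq0.
have nl := normr_sign1 l1; have ns := normr_sign1 s1.
split.
- exact: (W2p_scale s (W2p_affine l0 H Ww)).
- by rewrite (energy_affine l0 s1 H Ww) nl energy_eps1.
- by move=> y; rewrite H => /wM; rewrite /W normrM ns mul1r.
Qed.

Lemma place p q s c w w1 w2 l r M : s ^+ 2 = 1 -> W2p_rep 0 q p w w1 w2 ->
  (forall y, 0 < y < q -> `|w y| <= M) ->
  w y @[y --> 0^'+] --> l -> w1 y @[y --> 0^'+] --> (0 : R) ->
  w y @[y --> q^'-] --> r ->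
  exists W W1 W2 : R -> R, [/\ W2p_rep c (c + q) p W W1 W2, energy c (c + q) W W2 = energy 0 q w w2,
    forall y, c < y < c + q -> `|W y| <= M,
    W y @[y --> c^'+] --> s * l /\ W1 y @[y --> c^'+] --> (0 : R) &
    W y @[y --> (c + q)^'-] --> s * r /\ (w1 y @[y --> q^'-] --> (0 : R) -> W1 y @[y --> (c + q)^'-] --> (0 : R))].
Proof.
move=> s1 Ww wM wl w1l wr.
have H y : (c < y < c + q) = (0 < affine (- c) 1 y < q).
  by rewrite /affine mul1r [- c + y]addrC subr_gt0 ltrBlDr [q + c]addrC.
have [h1 h2 h3] := place_aux (expr1n _ _) s1 H Ww wM.
have A0 : affine (- c) 1 c = 0 by rewrite /affine mul1r addNr.
have A1 : affine (- c) 1 (c + q) = q by rewrite /affine mul1r addKr.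
have C0 : affine (- c) 1 y @[y --> c^'+] --> (0 : R)^'+.
  by rewrite -A0; exact: (@affine_cvg_rr _ (- c) 1 c ltr01).
have C1 : affine (- c) 1 y @[y --> (c + q)^'-] --> q^'-.
  by rewrite -{2}A1; exact: (@affine_cvg_ll _ (- c) 1 (c + q) ltr01).
eexists _, _, _; split; [exact: h1|exact: h2|exact: h3| |]; split.
- by apply: cvgMr; exact: (cvg_comp _ _ C0 wl).
- rewrite -[X in _ --> X](mulr0 s); apply: cvgMr.
  rewrite -[X in _ --> X](mulr0 1); apply: cvgMr.
  exact: (cvg_comp _ _ C0 w1l).
- by apply: cvgMr; exact: (cvg_comp _ _ C1 wr).
- move=> w1r; rewrite -[X in _ --> X](mulr0 s); apply: cvgMr.
  rewrite -[X in _ --> X](mulr0 1); apply: cvgMr.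
  exact: (cvg_comp _ _ C1 w1r).
Qed.

(** The reflected placement, for the left boundary layer: the flat end of the profile comes last. *)
Lemma place_rev p q s c w w1 w2 l r M : s ^+ 2 = 1 -> W2p_rep 0 q p w w1 w2 ->
  (forall y, 0 < y < q -> `|w y| <= M) ->
  w y @[y --> 0^'+] --> l -> w1 y @[y --> 0^'+] --> (0 : R) ->
  w y @[y --> q^'-] --> r ->
  exists W W1 W2 : R -> R, [/\ W2p_rep c (c + q) p W W1 W2, energy c (c + q) W W2 = energy 0 q w w2,
    forall y, c < y < c + q -> `|W y| <= M,
    W y @[y --> c^'+] --> s * r &
    W y @[y --> (c + q)^'-] --> s * l /\ W1 y @[y --> (c + q)^'-] --> (0 : R)].
Proof.
move=> s1 Ww wM wl w1l wr.
have N1 : (-1 : R) < 0 by rewrite oppr_lt0.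
have H y : (c < y < c + q) = (0 < affine (c + q) (-1) y < q).
  by rewrite /affine; apply/andP/andP => -[h1 h2]; split; move: h1 h2; clear; lra.
have [h1 h2 h3] := place_aux (sqrr_sign _ 1) s1 H Ww wM.
have A0 : affine (c + q) (-1) c = q by rewrite /affine mulN1r addrAC subrr add0r.
have A1 : affine (c + q) (-1) (c + q) = 0 by rewrite /affine mulN1r subrr.
have C0 : affine (c + q) (-1) y @[y --> c^'+] --> q^'-.
  by rewrite -{2}A0; exact: (@affine_cvg_rl _ (c + q) (-1) c N1).
have C1 : affine (c + q) (-1) y @[y --> (c + q)^'-] --> (0 : R)^'+.
  by rewrite -[X in _ --> X^'+]A1; exact: (@affine_cvg_lr _ (c + q) (-1) (c + q) N1).
eexists _, _, _; split; [exact: h1|exact: h2|exact: h3| |].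
  by apply: cvgMr; exact: (cvg_comp _ _ C0 wr).
split; first by apply: cvgMr; exact: (cvg_comp _ _ C1 wl).
rewrite -[X in _ --> X](mulr0 s); apply: cvgMr.
rewrite -[X in _ --> X](mulr0 (-1)); apply: cvgMr.
exact: (cvg_comp _ _ C1 w1l).
Qed.

(** A constant sign has energy 0 and slope 0, so a flat end is prolonged for free up to the next
    window. *)
Lemma extend_cst c m d p g g1 g2 s M : 0 <= p -> c < m -> m < d -> s ^+ 2 = 1 -> 1 <= M ->
  W2p_rep c m p g g1 g2 -> (forall y, c < y < m -> `|g y| <= M) ->
  g x @[x --> m^'-] --> s -> g1 x @[x --> m^'-] --> (0 : R) ->
  exists W W1 W2 : R -> R, [/\ W2p_rep c d p W W1 W2, energy c d W W2 = energy c m g g2,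
    forall y, c < y < d -> `|W y| <= M,
    forall y, y < m -> W y = g y /\ W1 y = g1 y &
    forall y, m <= y -> W y = s /\ W1 y = 0].
Proof.
move=> p0 cm md s1 M1 Wg gM gs g10.
have Wc := W2p_cst s p0 md.
have cs : cst s x @[x --> m^'+] --> s by exact: cvg_cst.
have c0 : cst (0 : R) x @[x --> m^'+] --> (0 : R) by exact: cvg_cst.
have Wh := W2p_glue cm md Wg Wc gs cs g10 c0.
have Eh := energy_glue cm md Wg Wc gs cs g10 c0.
have ns := normr_sign1 s1.
have R2 y : m <= y -> glue m s g (cst s) y = s /\ glue m 0 g1 (cst 0) y = 0.
  by rewrite le_eqVlt => /predU1P[<-|my]; rewrite ?glueM// !glueR.
have L2 y : y < m -> glue m s g (cst s) y = g y /\ glue m 0 g1 (cst 0) y = g1 y.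
  by move=> ym; rewrite !glueL.
exists (glue m s g (cst s)), (glue m 0 g1 (cst 0)), (glue m 0 g2 (cst 0)); split => //.
- by rewrite Eh energy_well// adde0.
- move=> y /andP[cy yd]; have [ym|my] := ltP y m.
    by rewrite (L2 y ym).1; apply: gM; rewrite cy.
  by rewrite (R2 y my).1 ns.
Qed.

Lemma cvg_right_eq c d f g l : c < d -> (forall x, c < x < d -> g x = f x) ->
  f x @[x --> c^'+] --> l -> g x @[x --> c^'+] --> l.
Proof.
move=> cd fg; apply: cvg_trans; apply: near_eq_cvg.
by have := near_right_itv cd; apply: filterS => x /fg ->.
Qed.

Lemma cvg_left_eq c d f g l : c < d -> (forall x, c < x < d -> g x = f x) ->
  f x @[x --> d^'-] --> l -> g x @[x --> d^'-] --> l.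
Proof.
move=> cd fg; apply: cvg_trans; apply: near_eq_cvg.
by have := near_left_itv cd; apply: filterS => x /fg ->.
Qed.

Lemma W2p_profile_bounded p q w w1 w2 : 0 < q -> W2p_rep 0 q p w w1 w2 ->
  exists2 M, 1 <= M & forall y, 0 < y < q -> `|w y| <= M.
Proof.
move=> q0 Ww; have [M HM] := W2p_bounded q0 Ww.
exists (Num.max 1 M); first by rewrite le_max lexx.
by move=> y /HM h; rewrite le_max h orbT.
Qed.

(* The transition at [T i] takes place in the window [T i, T i + Q]. *)
Lemma transitions p (a0 s : R) (e : R) : 0 <= p -> s ^+ 2 = 1 -> 0 < e ->
  exists Q M : R, [/\ 0 < Q, 1 <= M & forall (n : nat) T, (forall i, (i <= n)%N -> T i + Q < T i.+1) ->
    exists W W1 W2 : R -> R, [/\ W2p_rep (T 0%N) (T n.+1) p W W1 W2,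
      W x @[x --> (T 0%N)^'+] --> a0,
      (energy (T 0%N) (T n.+1) W W2 <= (fine (cost False p (- a0 * s)) + e + n%:R * (fine (cost True p 1) + e))%:E)%E,
      forall x, T 0%N < x < T n.+1 -> `|W x| <= M &
      forall i x, (i <= n)%N -> T i + Q <= x < T i.+1 -> W x = s * (-1) ^+ i /\ W1 x = 0]].
Proof.
move=> p0 s1 e0.
have [q0 [f [f1 [f2 [q00 [Wf [fl [fr [f1l [_ Ef]]]]]]]]]] := profile False (- a0 * s) p0 e0.
have [q1 [g [g1 [g2 [q10 [Wg [gl [gr [g1l [/(_ I) g1r Eg]]]]]]]]]] := profile True 1 p0 e0.
rewrite -(fineK (cost_fin_num False (- a0 * s) p0)) -EFinD in Ef.
rewrite -(fineK (cost_fin_num True 1 p0)) -EFinD in Eg.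
have [M0 M01 fM] := W2p_profile_bounded q00 Wf.
have [M1 M11 gM] := W2p_profile_bounded q10 Wg.
pose Q := Num.max q0 q1; pose M := Num.max M0 M1.
have M1le : 1 <= M by rewrite le_max M01.
(* Both are fixed before [n] and the knots, so that after rescaling the same window serves every
   [eps]. *)
exists Q, M; split => //; first by rewrite lt_max q00.
elim=> [|n IH] T HT.
  have sN : (- s) ^+ 2 = 1 by rewrite sqrrN.
  have fM' y : 0 < y < q0 -> `|f y| <= M by move=> /fM h; rewrite le_max h.
  (* The reversed profile times [- s] runs from [- s * (- a0 * s) = a0] to [- s * -1 = s]. *)
  have [W [W1 [W2 [WW EW WM Wl [Wr W1r]]]]] := place_rev (T 0%N) sN Wf fM' fl f1l fr.
  rewrite mulrNN mulr1 in Wr.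
  have Wl' : W x @[x --> (T 0%N)^'+] --> a0.
    rewrite (_ : a0 = - s * (- a0 * s)); first exact: Wl.
    by rewrite !mulNr mulrN opprK mulrCA -expr2 s1 mulr1.
  have lq : T 0%N < T 0%N + q0 by rewrite ltrDl.
  have qr : T 0%N + q0 < T 1%N.
    by apply: le_lt_trans (HT 0%N isT); rewrite lerD2l le_max lexx.
  have [V [V1 [V2 [WV EV VM VL VR]]]] := extend_cst p0 lq qr s1 M1le WW WM Wr W1r.
  exists V, V1, V2; split => //.
  - apply: (cvg_right_eq lq) Wl' => x /andP[_ /VL[]//].
  - by rewrite EV EW mul0r addr0.
  - case=> // x _ /andP[Qx _]; rewrite expr0 mulr1; apply: VR.
    by apply: le_trans Qx; rewrite lerD2l le_max lexx.
have [|W [W1 [W2 [WW Wl EW WM WC]]]] := IH T; first by move=> i iN; apply: HT; exact: leqW.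
have TT i : (i <= n.+1)%N -> T i < T i.+1.
  by move=> /HT; apply: lt_trans; rewrite ltrDl lt_max q00.
have T0n : T 0%N < T n.+1.
  exact: (incr_lt TT).
(* The sign after the new transition; the profile multiplied by [sn] starts at [- sn], the sign
   already reached. *)
pose sn : R := s * (-1) ^+ n.+1.
have sn1 : sn ^+ 2 = 1 by rewrite exprMn s1 mul1r sqrr_sign.
have snE : sn * (-1) = s * (-1) ^+ n by rewrite /sn exprS mulN1r mulrN1 mulrN opprK.
have gM' y : 0 < y < q1 -> `|g y| <= M by move=> /gM h; rewrite le_max h orbT.
have [G [G1 [G2 [WG EG GM [Gl G1l] [Gr G1r]]]]] := place (T n.+1) sn1 Wg gM' gl g1l gr.
have lq : T n.+1 < T n.+1 + q1 by rewrite ltrDl.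
have qr : T n.+1 + q1 < T n.+2.
  by apply: le_lt_trans (HT n.+1 (leqnn _)); rewrite lerD2l le_max lexx orbT.
rewrite mulr1 in Gr.
have [V [V1 [V2 [WV EV VM VL VR]]]] := extend_cst p0 lq qr sn1 M1le WG GM Gr (G1r g1r).
have Vl : V x @[x --> (T n.+1)^'+] --> s * (-1) ^+ n.
  by rewrite -snE; apply: (cvg_right_eq lq) Gl => x /andP[_ /VL[]].
have V1l : V1 x @[x --> (T n.+1)^'+] --> (0 : R).
  by apply: (cvg_right_eq lq) G1l => x /andP[_ /VL[]].
have Qn : T n + Q < T n.+1 by apply: HT; exact: leqnSn.
have Wr : W x @[x --> (T n.+1)^'-] --> s * (-1) ^+ n.
  by apply: (cvg_left_const Qn) => x /andP[h1 h2]; have [] := WC n x (leqnn _); rewrite ?(ltW h1).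
have W1r : W1 x @[x --> (T n.+1)^'-] --> (0 : R).
  by apply: (cvg_left_const Qn) => x /andP[h1 h2]; have [] := WC n x (leqnn _); rewrite ?(ltW h1).
have Tn := TT n.+1 (leqnn _).
have Wh := W2p_glue T0n Tn WW WV Wr Vl W1r V1l.
have Eh := energy_glue T0n Tn WW WV Wr Vl W1r V1l.
eexists _, _, _; split; [exact: Wh| | | |].
- by apply: (cvg_right_eq T0n) Wl => x /andP[_ h]; rewrite glueL.
- rewrite Eh EV EG; move: Eg EW.
  move: (fine (cost False p (- a0 * s))) (fine (cost True p 1)) => F0 F1 Eg EW.
  rewrite (_ : F0 + e + n.+1%:R * (F1 + e) = (F0 + e + n%:R * (F1 + e)) + (F1 + e)).
    by rewrite EFinD; apply: leeD.
  by rewrite -[n.+1%:R]natr1; ring.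
- move=> x /andP[x0 xn]; have [xm|mx|->] := ltgtP x (T n.+1).
  + by rewrite glueL// WM// x0.
  + by rewrite glueR// VM// mx.
  + rewrite glueM (le_trans _ M1le)// normrM normrX normrN1 expr1n mulr1.
    by rewrite normr_sign1.
- move=> i x; rewrite leq_eqVlt => /predU1P[->|iN] /andP[h1 h2].
    have mx : T n.+1 < x by apply: lt_le_trans h1; rewrite ltrDl lt_max q00.
    rewrite !glueR//; apply: VR; apply: le_trans h1; rewrite lerD2l le_max lexx orbT.
    by [].
  have xm : x < T n.+1.
    by apply: lt_le_trans h2 _; apply: (incr_le TT).
  by rewrite !glueL//; apply: WC => //; rewrite h1.
Qed.

(** The right boundary layer overwrites the last stretch of length [q], starting where the function
    is constant; cutting that stretch off does not increase the energy. The [n + 2] profiles share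
    the error [e] equally. *)
Lemma recovery_unit p (a0 b0 s : R) (n : nat) (e : R) : 0 <= p -> s ^+ 2 = 1 -> 0 < e ->
  exists Q M : R, [/\ 0 < Q, 1 <= M & forall T, (forall i, (i <= n)%N -> T i + Q < T i.+1) ->
    exists W W1 W2 : R -> R, [/\ W2p_rep (T 0%N) (T n.+1) p W W1 W2,
      W x @[x --> (T 0%N)^'+] --> a0 /\ W x @[x --> (T n.+1)^'-] --> b0,
      (energy (T 0%N) (T n.+1) W W2 <= (fine (cost False p (- a0 * s)) + n%:R * fine (cost True p 1)
         + fine (cost False p (- b0 * (s * (-1) ^+ n))) + e)%:E)%E,
      forall x, T 0%N < x < T n.+1 -> `|W x| <= M &
      forall i x, (i <= n)%N -> T i + Q <= x <= T i.+1 - Q -> W x = s * (-1) ^+ i]].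
Proof.
move=> p0 s1 e0.
have e'0 : 0 < e / n.+2%:R by rewrite divr_gt0.
have [Q0 [M0 [Q00 M01 HT]]] := transitions a0 p0 s1 e'0.
pose sn : R := s * (-1) ^+ n.
have sn1 : sn ^+ 2 = 1 by rewrite exprMn s1 mul1r sqrr_sign.
have [q [f [f1 [f2 [q0 [Wf [fl [fr [f1l [_ Ef]]]]]]]]]] := profile False (- b0 * sn) p0 e'0.
rewrite -(fineK (cost_fin_num False (- b0 * sn) p0)) -EFinD in Ef.
have [M1 M11 fM] := W2p_profile_bounded q0 Wf.
exists (Q0 + q), (Num.max M0 M1); split; [by rewrite addr_gt0|by rewrite le_max M01|].
move=> T TQ.
have TQ0 i : (i <= n)%N -> T i + Q0 < T i.+1.
  by move=> /TQ; apply: le_lt_trans; rewrite lerD2l lerDl ltW.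
have TT i : (i <= n)%N -> T i < T i.+1 by move=> /TQ0; apply: lt_trans; rewrite ltrDl.
have [W [W1 [W2 [WW Wl EW WM WC]]]] := HT n T TQ0.
pose m := T n.+1 - q.
have mE : m + q = T n.+1 by rewrite subrK.
have Tm : T n + Q0 < m by rewrite ltrBrDr -addrA; exact: TQ.
have T0m : T 0%N < m.
  apply: lt_trans Tm; apply: le_lt_trans (incr_le TT (leq0n n) (leqnSn n)) _.
  by rewrite ltrDl.
have mT : m < T n.+1 by rewrite gtrBl.
have Ws := W2p_sub (lexx _) (ltW mT) WW.
have sN : (- sn) ^+ 2 = 1 by rewrite sqrrN.
have [G [G1 [G2 [WG EG GM [Gl G1l] [Gr _]]]]] := place m sN Wf fM fl f1l fr.
rewrite mulrNN mulr1 in Gl; rewrite mE in WG EG GM Gr.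
have Gr' : G y @[y --> (T n.+1)^'-] --> b0.
  rewrite (_ : b0 = - sn * (- b0 * sn)); first exact: Gr.
  by rewrite !mulNr mulrN opprK mulrCA -expr2 sn1 mulr1.
have Wr : W x @[x --> m^'-] --> sn.
  apply: (cvg_left_const Tm) => x /andP[h1 h2].
  by have [] := WC n x (leqnn _); rewrite ?(ltW h1)// (lt_trans h2).
have W1r : W1 x @[x --> m^'-] --> (0 : R).
  apply: (cvg_left_const Tm) => x /andP[h1 h2].
  by have [] := WC n x (leqnn _); rewrite ?(ltW h1)// (lt_trans h2).
have Wh := W2p_glue T0m mT Ws WG Wr Gl W1r G1l.
have Eh := energy_glue T0m mT Ws WG Wr Gl W1r G1l.
eexists _, _, _; split; [exact: Wh| | | |].
- split; first by apply: (cvg_right_eq T0m) Wl => x /andP[_ h]; rewrite glueL.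
  by apply: (cvg_left_eq mT) Gr' => x /andP[h _]; rewrite glueR.
- rewrite Eh EG.
  have E1 : (energy (T 0%N) m W W2 <= energy (T 0%N) (T n.+1) W W2)%E.
    by rewrite (energy_split T0m mT WW) leeDl// energy_ge0.
  apply: (le_trans (leeD (le_trans E1 EW) Ef)).
  rewrite -/sn -EFinD lee_fin.
  move: (fine (cost False p (- a0 * s))) (fine (cost False p (- b0 * sn))) (fine (cost True p 1)) => F0 F2 F1.
  rewrite le_eqVlt; apply/orP; left; apply/eqP.
  have eE : e = e / n.+2%:R * (n%:R + 2) by rewrite -natrD addn2 divfK// pnatr_eq0.
  by move: (e / n.+2%:R) eE => e' ->; ring.
- move=> x /andP[x0 xn]; have [xm|mx|->] := ltgtP x m.
  + by rewrite glueL// le_max WM// x0.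
  + by rewrite glueR// le_max GM ?orbT// mx.
  + rewrite glueM le_max normrM normrX normrN1 expr1n mulr1.
    by rewrite normr_sign1// M01.
- move=> i x iN /andP[h1 h2].
  have xm : x < m.
    apply: (le_lt_trans h2); rewrite opprD addrA addrAC.
    apply: (@lt_le_trans _ _ (T i.+1 - q)); first by rewrite gtrBl.
    by rewrite lerD2r; exact: (incr_le TT).
  rewrite glueL//; apply: (WC i x iN _).1.
  rewrite (le_trans _ h1)/=; last by rewrite lerD2l lerDl ltW.
  by apply: (le_lt_trans h2); rewrite gtrBl addr_gt0.
Qed.

(** The unit-scale construction on the knots [t i / h], corrected at both ends from [a0], [b0] to
    [A], [B], and scaled back. *)
Lemma recovery p (a0 b0 s : R) (n : nat) t (e : R) : 0 <= p -> s ^+ 2 = 1 -> 0 < e ->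
  (forall i, (i <= n)%N -> t i < t i.+1) ->
  exists Q M r k : R, [/\ 0 < r, 0 < k, 0 < Q & forall h A B, 0 < h -> h < r ->
    `|A - a0| <= k -> `|B - b0| <= k ->
    exists v v1 v2 : R -> R, [/\ W2p_rep (t 0%N) (t n.+1) p v v1 v2,
      v x @[x --> (t 0%N)^'+] --> A /\ v x @[x --> (t n.+1)^'-] --> B,
      (energy_eps h (t 0%N) (t n.+1) v v2 <= (fine (cost False p (- a0 * s)) + n%:R * fine (cost True p 1)
         + fine (cost False p (- b0 * (s * (-1) ^+ n))) + e)%:E)%E,
      forall x, t 0%N < x < t n.+1 -> `|v x| <= M &
      forall i x, (i <= n)%N -> t i + h * Q <= x <= t i.+1 - h * Q -> v x = s * (-1) ^+ i]].
Proof.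
move=> p0 s1 e0 tt.
have e20 : 0 < e / 2 by rewrite divr_gt0.
have [Q0 [M [Q00 M1 HT]]] := recovery_unit a0 b0 n p0 s1 e20.
pose G := fine (cost False p (- a0 * s)) + n%:R * fine (cost True p 1)
  + fine (cost False p (- b0 * (s * (-1) ^+ n))).
rewrite -/G in HT *.
have G0 : 0 <= G.
  by rewrite !addr_ge0// ?mulr_ge0// fine_ge0// cost_ge0.
(* The extra 3 makes room for the corrections, which live within distance 1 of the two ends. *)
pose Q := Q0 + 3.
have Qgt : 0 < Q by rewrite addr_gt0.
have [|m0 m00 Hm] := @fin_min R n.+1 (fun i => t i.+1 - t i).
  by move=> i /tt; rewrite subr_gt0.
(* With [K = 9360 * k] this gives [(1 + K) (G + e / 2) + K <= G + e]. *)
have [k k0 [k1 k2]] : exists2 k, 0 < k & 156 * k <= 1 /\ 9360 * k * (G + e / 2 + 1) <= e / 2.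
  have K10 : 0 < 156 :> R by exact: ltr0Sn.
  have K20 : 0 < 9360 :> R by exact: ltr0Sn.
  have q0 : 0 <= G + e / 2 + 1 by apply: addr_ge0; [apply: addr_ge0; [exact: G0|exact: ltW]|exact: ler01].
  exact: (small_const K10 K20 q0 e20).
(* The correction is at most [18 k <= 1], hence [M + 1]; [h < m0 / Q] lets windows of length [h * Q]
   fit between consecutive knots. *)
exists Q, (M + 1), (m0 / Q), k; split => //; first by rewrite divr_gt0.
move=> h A B h0 hr hA hB.
pose T i := t i / h.
have TQ i : (i <= n)%N -> T i + Q < T i.+1.
  move=> iN; rewrite /T -ltrBDl -mulrBl ltr_pdivlMr//.
  by apply: lt_le_trans (Hm i iN); rewrite mulrC -ltr_pdivlMr.
have TQ0 i : (i <= n)%N -> T i + Q0 < T i.+1.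
  by move=> /TQ; apply: le_lt_trans; rewrite lerD2l lerDl.
have TT i : (i <= n)%N -> T i < T i.+1 by move=> /TQ0; apply: lt_trans; rewrite ltrDl.
have T2 : T 0%N + 2 < T n.+1.
  apply: (@lt_le_trans _ _ (T 1%N)); last exact: (incr_le TT).
  by apply: le_lt_trans (TQ 0%N isT); rewrite lerD2l /Q; move: Q00; clear; lra.
have [W [W1 [W2 [WW [Wl Wr] EW WM WC]]]] := HT T TQ0.
have n0 : `|0 : R| <= k by rewrite normr0 ltW.
have [g [g1 [g2 [Wg [cg _] [gc _ gd _] [gM g0] Eg]]]] :=
  perturb p0 T2 (ltW k0) k1 hA n0 hB n0 WW.
set w := fun x => W x + g x in Wg Eg.
set w2 := fun x => W2 x + g2 x in Wg Eg.
have wl : w x @[x --> (T 0%N)^'+] --> A.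
  rewrite (_ : A = a0 + g (T 0%N)); last by rewrite gc addrC subrK.
  by apply: cvgD => //; apply: cvg_at_right_filter; exact: cg.
have wr : w x @[x --> (T n.+1)^'-] --> B.
  rewrite (_ : B = b0 + g (T n.+1)); last by rewrite gd addrC subrK.
  by apply: cvgD => //; apply: cvg_at_left_filter; exact: cg.
have hi0 : 0 < h^-1 by rewrite invr_gt0.
have affE x : affine 0 h^-1 x = x / h by rewrite /affine add0r mulrC.
have H y : (t 0%N < y < t n.+1) = (T 0%N < affine 0 h^-1 y < T n.+1).
  by rewrite affE /T !ltr_pM2r.
have Wv := W2p_affine (lt0r_neq0 hi0) H Wg.
eexists _, _, _; split; [exact: Wv| | | |].
- split.
    have C := @affine_cvg_rr _ 0 h^-1 (t 0%N) hi0; rewrite affE in C.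
    exact: (cvg_comp _ _ C wl).
  have C := @affine_cvg_ll _ 0 h^-1 (t n.+1) hi0; rewrite affE in C.
  exact: (cvg_comp _ _ C wr).
- have H' y : (T 0%N < y < T n.+1) = (t 0%N < affine 0 h y < t n.+1).
    by rewrite /affine add0r /T ltr_pdivrMr// ltr_pdivlMr// [h * y]mulrC.
  have E := energy_affine (lt0r_neq0 h0) (expr1n _ _) H' Wv.
  rewrite gtr0_norm// in E; rewrite -E.
  have aK y : affine 0 h^-1 (affine 0 h y) = y.
    by rewrite affE /affine add0r mulrC mulKf ?gt_eqF.
  have -> : energy (T 0%N) (T n.+1) (fun y => 1 * (w \o affine 0 h^-1) (affine 0 h y))
      (fun y => 1 * (h ^+ 2 * (h^-1 ^+ 2 * w2 (affine 0 h^-1 (affine 0 h y))))) = energy (T 0%N) (T n.+1) w w2.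
    apply: energy_eq => y _; rewrite /= aK mul1r//.
    by rewrite mulrA -exprMn mulfV ?gt_eqF// expr1n mul1r.
  apply: (le_trans Eg).
  have K0 : 0 <= 9360 * k by apply: mulr_ge0; [exact: ler0n|exact: ltW].
  move: k2 K0; move: (9360 * k) => K k2 K0.
  apply: (@le_trans _ _ ((1 + K)%:E * (G + e / 2)%:E + K%:E)%E).
    by apply: leeD => //; apply: lee_wpmul2l => //; rewrite lee_fin addr_ge0.
  rewrite -EFinM -EFinD lee_fin; clear -k2; lra.
- move=> x; rewrite H => xT; apply: (le_trans (ler_normD _ _)); apply: lerD; first exact: WM.
  apply: (le_trans (gM _ xT)); clear -k0 k1; lra.
- move=> i x iN /andP[h1 h2]; rewrite /= affE.
  have h1' : T i + Q <= x / h by rewrite /T ler_pdivlMr// mulrDl divfK ?gt_eqF// [Q * h]mulrC.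
  have h2' : x / h <= T i.+1 - Q by rewrite /T ler_pdivrMr// mulrBl divfK ?gt_eqF// [Q * h]mulrC.
  have t1 : T 0%N <= T i by apply: (incr_le TT) => //; exact: leqW.
  have t2 : T i.+1 <= T n.+1 by exact: (incr_le TT).
  rewrite /w g0 ?addr0; last first.
    by apply/andP; split; move: h1' h2' t1 t2 Q00; rewrite /Q; clear; lra.
  by apply: WC => //; apply/andP; split; move: h1' h2'; rewrite /Q; clear; lra.
Qed.

Lemma knots_measure (n : nat) t r : 0 <= r ->
  let S := [set x : R | exists2 i, (i < n)%N & `|x - t i| <= r] in
  measurable S /\ (mu S <= (n%:R * (2 * r))%:E)%E.
Proof.
move=> r0; elim: n => [|n [mS IH]] S.
  have -> : S = set0 by apply/seteqP; split => x // [].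
  by rewrite measure0 mul0r.
set S' := [set x : R | _] in mS IH.
pose I : set R := `[t n - r, t n + r]%classic.
have E : S = S' `|` I.
  apply/seteqP; split => x /=.
    move=> [i]; rewrite ltnS leq_eqVlt => /predU1P[->|iN] h; last by left; exists i.
    by right; rewrite /I/= in_itv/= -ler_distl.
  move=> [[i iN h]|]; first by exists i => //; exact: leqW.
  by rewrite /I/= in_itv/= -ler_distl => h; exists n.
have mI : measurable I by exact: measurable_itv.
rewrite E; split; first exact: measurableU.
have h1 : (mu (S' `|` I) <= mu S' + mu I)%E by apply: (@measureU2 _ _ _ mu).
apply: (le_trans h1); rewrite -natr1 mulrDl mul1r EFinD; apply: leeD => //.
have le1 : t n - r <= t n + r by move: r0; clear; lra.
rewrite /I lebesgue_measure_itv/= lte_fin.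
move: le1; rewrite le_eqVlt => /predU1P[->|h].
  by rewrite ltxx lee_fin mulr_ge0.
by rewrite h -EFinB lee_fin; clear; lra.
Qed.

Lemma incr_find (n : nat) T x : T 0%N < x -> x <= T n -> exists2 i, (i < n)%N & T i < x <= T i.+1.
Proof.
elim: n => [|n IH] h0 hn; first by move: (lt_le_trans h0 hn); rewrite ltxx.
have [h|h] := leP x (T n); last by exists n => //; rewrite h.
by have [i iN hi] := IH h0 h; exists i => //; exact: leqW.
Qed.

(** Farther than [q] from all [n + 2] knots, end points included, [v] equals [u] a.e.; closer to
    them the difference is at most [M + 1]. With [q] proportional to [eps] the distance tends to
    0. *)
Lemma jumps_Lp_dist a b p u v s (n : nat) t M q : 0 < p -> s ^+ 2 = 1 -> 0 <= q -> 0 <= M ->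
  measurable_fun `]a, b[ u -> measurable_fun `]a, b[ v -> jumps a b u s n t ->
  (forall x, a < x < b -> `|v x| <= M) ->
  (forall i x, (i <= n)%N -> t i + q <= x <= t i.+1 - q -> v x = s * (-1) ^+ i) ->
  (\int[mu]_(x in `]a, b[) ((`|v x - u x| `^ p)%:E) <=
    ((M + 1) `^ p * (n.+2%:R * (2 * q)))%:E)%E.
Proof.
move=> p0 s1 q0 M0 muu mv J vM vC.
have [mS muS] := knots_measure n.+2 t q0; set S := [set x : R | _] in mS muS.
have [ta tb tt _] := J.
pose K := (M + 1) `^ p.
have K0 : 0 <= K by exact: powR_ge0.
have mvu : measurable_fun `]a, b[ (fun x => v x - u x) by exact: measurable_funB.
apply: (@le_trans _ _ (\int[mu]_(x in `]a, b[) (K * \1_S x)%:E)%E).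
  apply: ae_ge0_le_integral.
  - exact: measurable_itv.
  - by move=> x _; rewrite lee_fin powR_ge0.
  - exact: measurable_normr_powR.
  - by move=> x _; rewrite lee_fin mulr_ge0// indicE; case: (_ \in _).
  - apply/measurable_EFinP; apply: measurable_funM => //; exact: measurable_indic.
  have [N [mN N0 sN]] := stepf_ae J; exists N; split => //; apply: subset_trans sN => x /=.
  move=> /not_implyP[]; rewrite in_itv/= => xab h; split => //.
  apply: contra_not h => ux; rewrite lee_fin indicE.
  have [xS|xS] := pselect (S x).
    rewrite mem_set// mulr1 /K ge0_ler_powR ?nnegrE ?(ltW p0)// ?addr_ge0//.
    apply: (le_trans (ler_normB _ _)); apply: lerD; first exact: vM.
    by rewrite normr_sign1// ux stepf_sqr.
  rewrite memNset// mulr0.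
  have /andP[ax xb] := xab; rewrite -ta in ax; rewrite -tb in xb.
  have [i iN /andP[h1 h2]] := incr_find ax (ltW xb).
  have nS j : (j < n.+2)%N -> q < `|x - t j|.
    by move=> jn; rewrite ltNge; apply/negP => h; apply: xS; exists j.
  have d1 := nS i (leqW iN); have d2 := nS i.+1 iN.
  rewrite gtr0_norm ?subr_gt0// in d1; rewrite ler0_norm ?subr_le0// opprB in d2.
  have tx : t i < x < t i.+1 by move: d1 d2 q0; clear => d1 d2 q0; apply/andP; split; lra.
  rewrite ux (stepf_jumps J iN tx) (vC i x iN) ?subrr ?normr0 ?powR0 ?gt_eqF//.
  by move: d1 d2; clear => d1 d2; apply/andP; split; lra.
under eq_integral do rewrite EFinM.
rewrite (@ge0_integralZl_EFin _ _ _ mu); last 4 first.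
- exact: measurable_itv.
- by move=> x _; rewrite lee_fin.
- apply/measurable_EFinP; exact: measurable_indic.
- exact: K0.
rewrite integral_indic//= EFinM; apply: lee_wpmul2l; first by rewrite lee_fin.
apply: le_trans muS; apply: le_measure.
- by rewrite inE; apply: measurableI => //; exact: measurable_itv.
- by rewrite inE.
- exact: subIsetl.
Qed.

Lemma eventually_recovery a b p (a0 b0 : R) (An Bn en : nat -> R) u s (n : nat) t e :
  1 <= p -> An j @[j --> \oo] --> a0 -> Bn j @[j --> \oo] --> b0 ->
  (forall j, 0 < en j) -> en j @[j --> \oo] --> (0 : R) ->
  Lp a b p u -> s ^+ 2 = 1 -> jumps a b u s n t -> 0 < e ->
  \forall j \near \oo, exists v : R -> R, [/\ Lp a b p v,
    (G_eps a b p (An j) (Bn j) (en j) v <= G_lim a b p a0 b0 u + e%:E)%E &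
    (\int[mu]_(x in `]a, b[) ((`|v x - u x| `^ p)%:E) <= e%:E)%E].
Proof.
move=> p1 cA cB en0 ce Lu s1 J e0.
have p0 : 0 < p by exact: lt_le_trans p1.
have [ta tb tt _] := J.
have [Q [M0 [r [k [r0 k0 Q0 H]]]]] := recovery a0 b0 (ltW p0) s1 e0 tt.
rewrite ta tb in H.
pose M := Num.max 0 M0.
have MM : 0 <= M by rewrite le_max lexx.
pose K := (M + 1) `^ p * (n.+2%:R * (2 * Q)).
have K0 : 0 <= K by rewrite mulr_ge0 ?powR_ge0// !mulr_ge0// ltW.
near=> j.
have HA : `|An j - a0| <= k.
  rewrite distrC; near: j; move/cvgrPdist_le : cA; exact.
have HB : `|Bn j - b0| <= k.
  rewrite distrC; near: j; move/cvgrPdist_le : cB; exact.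
have He1 : en j < r.
  have : `|0 - en j| < r by near: j; move/cvgrPdist_lt : ce; exact.
  by rewrite sub0r normrN gtr0_norm.
have He2 : en j <= e / (K + 1).
  have : `|0 - en j| <= e / (K + 1).
    by near: j; move/cvgrPdist_le : ce; apply; rewrite divr_gt0// ltr_wpDl.
  by rewrite sub0r normrN gtr0_norm.
have [v [v1 [v2 [W [vA vB] Ev vM vC]]]] := H _ _ _ (en0 j) He1 HA HB.
have vM' x : a < x < b -> `|v x| <= M by move=> /vM h; rewrite le_max h orbT.
have Lv : Lp a b p v by exact: Lp_bounded (ltW p0) (W2p_measurable W) vM'.
exists v; split => //.
  rewrite (G_lim_jumps a0 b0 p1 Lu s1 J) -EFinD; apply: le_trans Ev.
  apply: ereal_inf_lbound; exists v, v1, v2; do 2 (split => //); split; last first.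
    do 2 (split => //); apply: eq_integral => x _.
    by rewrite real_normK ?num_real.
  by exists set0; split => // x [_].
have q0 : 0 <= en j * Q by rewrite mulr_ge0// ltW.
apply: (le_trans (jumps_Lp_dist p0 s1 q0 MM Lu.1 (W2p_measurable W) J vM' vC)).
rewrite lee_fin (_ : _ * _ = en j * K); last by rewrite /K; ring.
apply: (@le_trans _ _ (en j * (K + 1))); first by rewrite ler_pM2l// lerDl.
by rewrite -ler_pdivlMr// ltr_wpDl.
Unshelve. all: by end_near. Qed.

(** [f n] is the largest [m <= n] with [P m n], or 0 if there is none; since each [P m] holds
    eventually, [f] passes every bound. *)
Lemma diagonal (P : nat -> nat -> Prop) : (forall m : nat, \forall n \near \oo, P m n) ->
  exists f : nat -> nat, forall m : nat, \forall n \near \oo, (m <= f n)%N /\ P (f n) n.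
Proof.
move=> H.
have sel (n : nat) : exists m : nat, forall m0 : nat, (m0 <= n)%N -> P m0 n -> P m n /\ (m0 <= m)%N.
  have [[m0 [m0n Pm0]]|no] := pselect (exists m : nat, (m <= n)%N /\ P m n); last first.
    by exists 0%N => m0 m0n Pm0; exfalso; apply: no; exists m0.
  have ex : exists m : nat, (m <= n)%N && `[< P m n >] by exists m0; rewrite m0n; exact/asboolP.
  have ub (m : nat) : (m <= n)%N && `[< P m n >] -> (m <= n)%N by case/andP.
  have [m /andP[mn /asboolP Pm] Hm] := ex_maxnP ex ub.
  exists m => m1 m1n Pm1; split => //; apply: Hm; rewrite m1n; exact/asboolP.
have [f Hf] := choice sel.
exists f => m; near=> n.
have [||Pf mf] := Hf n m; last by [].
- by near: n; exact: nbhs_infty_ge.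
- by near: n; exact: H.
Unshelve. all: by end_near. Qed.

Lemma limn_esup_le (F : nat -> \bar R) (c : \bar R) : (\forall n \near \oo, (F n <= c)%E) -> (limn_esup F <= c)%E.
Proof.
move=> H; apply: (@le_trans _ _ (ereal_sup (F @` [set n | (F n <= c)%E]))).
  by apply: ereal_inf_lbound; exists [set n | (F n <= c)%E].
by apply: ge_ereal_sup => _ [n h <-].
Qed.

Lemma limn_einf_ge (F : nat -> \bar R) (c : \bar R) : (\forall n \near \oo, (c <= F n)%E) -> (c <= limn_einf F)%E.
Proof.
move=> H; rewrite /limn_einf leeNr; apply: limn_esup_le; apply: filterS H => n h.
by rewrite leeN2.
Qed.

Lemma limn_einf_ge_fin (F : nat -> \bar R) L :
  (forall c, c < L -> \forall n \near \oo, (c%:E <= F n)%E) -> (L%:E <= limn_einf F)%E.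
Proof.
move=> H; apply/lee_subgt0Pr => e e0; rewrite -EFinB; apply: limn_einf_ge.
by apply: H; rewrite gtrBl.
Qed.

Lemma limn_einf_ge_pinfty (F : nat -> \bar R) :
  (forall c, \forall n \near \oo, (c%:E <= F n)%E) -> limn_einf F = +oo%E.
Proof. by move=> H; apply/eqyP => c c0; exact: limn_einf_ge. Qed.

(** A chain with [N] alternations gives every representative a variation of at least [2 N], so a
    finite essential variation bounds the chains. *)
Lemma BPV_jumps a b p u : a < b -> BPV a b p u ->
  exists (n : nat) s t, s ^+ 2 = 1 /\ jumps a b u s n t.
Proof.
move=> ab [[muu _] u1 eV].
have [N HN] : exists N : nat, (essVar a b u < ((2 * N)%:R)%:E)%E.
  have V0 : (0 <= essVar a b u)%E.
    apply: le_ereal_inf_tmp => _ [v _ <-]; apply: ereal_sup_ubound.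
    exists 0%N, (fun=> (a + b) / 2); split.
      by move=> _ _; apply/andP; split; move: ab; clear; lra.
    by split => //; rewrite big_ord0.
  move: eV V0; case: (essVar a b u) => [r| |]// _ _.
  exists (Num.truncn r).+1.
  rewrite lte_fin natrM; apply: (@lt_le_trans _ _ (Num.truncn r).+1%:R).
    exact: truncnS_gt.
  by rewrite ler_peMl// ler1n.
apply: (jumps_struct muu (sign_ae muu u1) (lexx a) ab (lexx b) (N := N)) => s s1 C.
have [x [_ xP xx]] := chainable_seq C.
have D i : (i <= N)%N -> dense_at a b u (s * (-1) ^+ i) (x i) by move=> /xP[].
move: HN; rewrite ltNge => /negP; apply.
by apply: le_ereal_inf_tmp => _ [v uv <-]; exact: (var_chain muu s1 D xx uv).
Qed.

Lemma G_lim_notBPV a b p a0 b0 u : ~ BPV a b p u -> G_lim a b p a0 b0 u = +oo%E.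
Proof.
move=> nB; rewrite /G_lim (_ : [set e | _] = set0) ?ereal_inf0//.
by apply/seteqP; split => // e [v [la [lb []]]].
Qed.

Lemma liminf_G_eps a b p (a0 b0 : R) (An Bn en : nat -> R) (un : nat -> R -> R) u :
  a < b -> 1 <= p <= 4 -> An j @[j --> \oo] --> a0 -> Bn j @[j --> \oo] --> b0 ->
  (forall j, 0 < en j) -> en j @[j --> \oo] --> (0 : R) ->
  Lp a b p u -> (forall j, Lp a b p (un j)) -> Lp_cvg a b p un u ->
  (G_lim a b p a0 b0 u <= limn_einf (fun j => G_eps a b p (An j) (Bn j) (en j) (un j)))%E.
Proof.
move=> ab p14 cA cB en0 ce Lu Lun cu.
have /andP[p1 p4] := p14.
have p0 : 0 <= p by exact: le_trans p1.
(* If [u] is not a sign a.e., the potential term alone sends the energies to infinity. *)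
have [u1|u1] := pselect (mu.-negligible [set x | a < x < b /\ u x <> 1 /\ u x <> -1]); last first.
  rewrite limn_einf_ge_pinfty ?leey// => c.
  exact: (well_limit An Bn c p14 en0 ce Lu Lun cu u1).
(* Bounded chains make [u] a step function, and the midpoints between its knots form the chain that
   yields the sharp bound. *)
have [[N HN]|no] := pselect (exists N : nat, forall s : R, s ^+ 2 = 1 -> ~ chainable (sign_at a b u) N s a b).
  have [n [s [t [s1 J]]]] := jumps_struct Lu.1 (sign_ae Lu.1 u1) (lexx a) ab (lexx b) HN.
  have [x [D xx]] := jumps_chain J.
  rewrite (G_lim_jumps a0 b0 p1 Lu s1 J); apply: limn_einf_ge_fin => c cG.
  exact: (chain_lower p1 cA cB en0 ce Lu Lun cu s1 D xx cG).
(* Chains of every length exist: [N] transitions, each of positive cost, exceed any [c]. *)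
rewrite limn_einf_ge_pinfty ?leey// => c.
have T0 : 0 < fine (cost True p 1) by rewrite fine_gt0// cost_gt0//= ltey_eq cost_fin_num.
pose N := (Num.truncn (`|c| / fine (cost True p 1))).+1.
have cN : c < N%:R * fine (cost True p 1).
  rewrite -ltr_pdivrMr//; apply: (@le_lt_trans _ _ (`|c| / fine (cost True p 1))).
    by rewrite ler_pM2r ?invr_gt0// ler_norm.
  exact: truncnS_gt.
have [s [s1 C]] : exists s : R, s ^+ 2 = 1 /\ chainable (sign_at a b u) N s a b.
  apply: contrapT => h; apply: no; exists N => s s1 C; apply: h; by exists s.
have [x [_ xP xx]] := chainable_seq C.
have D i : (i <= N)%N -> dense_at a b u (s * (-1) ^+ i) (x i) by move=> /xP[].
apply: (chain_lower p1 cA cB en0 ce Lu Lun cu s1 D xx).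
by apply: (lt_le_trans cN); rewrite addrAC lerDr addr_ge0// fine_ge0// cost_ge0.
Qed.

Lemma limsup_G_eps a b p (a0 b0 : R) (An Bn en : nat -> R) u :
  a < b -> 1 <= p -> An j @[j --> \oo] --> a0 -> Bn j @[j --> \oo] --> b0 ->
  (forall j, 0 < en j) -> en j @[j --> \oo] --> (0 : R) -> Lp a b p u ->
  exists un : nat -> R -> R, (forall j, Lp a b p (un j)) /\ Lp_cvg a b p un u /\
    (limn_esup (fun j => G_eps a b p (An j) (Bn j) (en j) (un j)) <= G_lim a b p a0 b0 u)%E.
Proof.
move=> ab p1 cA cB en0 ce Lu.
have p0 : 0 < p by exact: lt_le_trans p1.
(* Outside [BPV] the limit functional is infinite, and the constant sequence will do. *)
have [B|nB] := pselect (BPV a b p u); last first.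
  exists (fun=> u); split => //; split; last by rewrite G_lim_notBPV// leey.
  rewrite /Lp_cvg (_ : (fun n : nat => _) = cst 0%E); first exact: cvg_cst.
  apply/funext => n; rewrite integral0_eq// => x _.
  by rewrite subrr normr0 powR0 ?gt_eqF.
have [n [s [t [s1 J]]]] := BPV_jumps ab B.
pose e_ (m : nat) : R := m.+1%:R^-1.
have e_0 (m : nat) : 0 < e_ m by rewrite invr_gt0.
have [f Hf] := diagonal (fun m : nat => eventually_recovery p1 cA cB en0 ce Lu s1 J (e_0 m)).
(* [u] itself is the default for the indices without a recovery function, of which [diagonal] leaves
   only finitely many. *)
have sel (j : nat) : exists v : R -> R, Lp a b p v /\
    ((exists v : R -> R, [/\ Lp a b p v,
    (G_eps a b p (An j) (Bn j) (en j) v <= G_lim a b p a0 b0 u + (e_ (f j))%:E)%E &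
    (\int[mu]_(x in `]a, b[) ((`|v x - u x| `^ p)%:E) <= (e_ (f j))%:E)%E]) ->
    (G_eps a b p (An j) (Bn j) (en j) v <= G_lim a b p a0 b0 u + (e_ (f j))%:E)%E /\
    (\int[mu]_(x in `]a, b[) ((`|v x - u x| `^ p)%:E) <= (e_ (f j))%:E)%E).
  have [[v [Lv h1 h2]]|no] := pselect (exists v : R -> R, [/\ Lp a b p v,
    (G_eps a b p (An j) (Bn j) (en j) v <= G_lim a b p a0 b0 u + (e_ (f j))%:E)%E &
    (\int[mu]_(x in `]a, b[) ((`|v x - u x| `^ p)%:E) <= (e_ (f j))%:E)%E]).
    by exists v.
  exists u; split => // h; by exfalso; apply: no.
have [un Hun] := choice sel.
have small e : 0 < e -> exists m : nat, forall j : nat, (m <= j)%N -> e_ j <= e.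
  move=> e0; exists (Num.truncn e^-1) => j mj.
  rewrite /e_ -[leRHS]invrK lef_pV2 ?posrE ?invr_gt0//.
  apply: (@le_trans _ _ (Num.truncn e^-1).+1%:R); first exact: ltW (truncnS_gt _).
  by rewrite ler_nat.
have ev e : 0 < e -> \forall j \near \oo,
    (G_eps a b p (An j) (Bn j) (en j) (un j) <= G_lim a b p a0 b0 u + e%:E)%E /\
    (\int[mu]_(x in `]a, b[) ((`|un j x - u x| `^ p)%:E) <= e%:E)%E.
  move=> /small[m Hm]; apply: filterS (Hf m) => j [mj Pj].
  have [_ /(_ Pj)[h1 h2]] := Hun j; have he := Hm _ mj.
  split; last by apply: (le_trans h2); rewrite lee_fin.
  by apply: (le_trans h1); apply: leeD => //; rewrite lee_fin.
exists un; split; first by move=> j; case: (Hun j).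
split.
  move=> A; rewrite /nbhs/= => -[e /= e0 He].
  have e20 : 0 < e / 2 by rewrite divr_gt0.
  apply: filterS (ev _ e20) => j [_ hj]; rewrite /=.
  have : (0 <= \int[mu]_(x in `]a, b[) ((`|un j x - u x| `^ p)%:E))%E.
    by apply: integral_ge0 => x _; rewrite lee_fin powR_ge0.
  move: hj; case: (\int[mu]_(x in `]a, b[) _)%E => [r| |]//; rewrite !lee_fin => r1 r0.
  apply: He; rewrite /ball/= sub0r normrN ger0_norm//.
  by apply: (le_lt_trans r1); rewrite ltr_pdivrMr// ltr_pMr// ltr1n.
apply/lee_addgt0Pr => e e0; apply: limn_esup_le; apply: filterS (ev e e0) => j [h _]; exact: h.
Qed.

End GammaLimit.

Theorem theorem1p1 (R : realType) (a b p a0 b0 : R) (aeps beps : R -> R)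
    (eps : nat -> R) :
  a < b -> 1 <= p <= 4 ->
  aeps x @[x --> 0^'+] --> a0 ->
  beps x @[x --> 0^'+] --> b0 ->
  (forall n, 0 < eps n) -> eps n @[n --> \oo] --> 0 ->
  Gamma_cvg_Lp a b p
    (fun n => G_eps a b p (aeps (eps n)) (beps (eps n)) (eps n))
    (G_lim a b p a0 b0).
Proof.
move=> ab p14 cA cB e0 ce.
(* Positivity makes the convergence one-sided, as the boundary data are known to converge only from
   the right of 0. *)
have ce' : eps n @[n --> \oo] --> (0 : R)^'+.
  move=> A [r /= r0 Ar].
  have : \forall n \near \oo, `|0 - eps n| < r by move/cvgrPdist_lt : ce; exact.
  by apply: filterS => n h; apply: Ar.
have cA' : aeps (eps n) @[n --> \oo] --> a0 by exact: (cvg_comp _ _ ce' cA).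
have cB' : beps (eps n) @[n --> \oo] --> b0 by exact: (cvg_comp _ _ ce' cB).
have /andP[p1 _] := p14.
move=> u Lu; split.
  by move=> un Lun cu; exact: liminf_G_eps.
exact: limsup_G_eps.
Qed.
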